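(* Let $d\ge 1$ be an integer, let $\{X_v : v\in\mathbb{Z}^d\}$ be i.i.d. real-valued random variables, and write $X_0$ for the variable at the origin. For $n\ge 1$ let $$M_n=\max\{S(\pi) : \pi \text{ is a self-avoiding path of length } n \text{ in } \mathbb{Z}^d \text{ starting from the origin}\},\qquad S(\pi)=\sum_{v\in\pi}X_v .$$ Assume that there exists $\alpha>0$ such that $$E\big((X_0^{+})^d(\log^{+}X_0^{+})^{d+\alpha}\big)<+\infty$$ and that $E(X_0^{-})<+\infty$. Then there exists a deterministic constant $M\in(-\infty,+\infty)$ such that $$\frac{M_n}{n}\to M\quad\text{in } L^1 \text{ as } n\to\infty .$$ If we further assume that $E((X_0^{-})^4)<+\infty$, then, with the same constant $M$, $$\frac{M_n}{n}\to M\quad\text{almost surely as } n\to\infty .$$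
   Context: The lattice $\mathbb{Z}^d$ is viewed as a graph with the usual nearest-neighbour adjacency. A self-avoiding path of length $n$ starting from $v$ is a sequence of $n$ pairwise distinct vertices $v_1=v,v_2,\ldots,v_n$ of $\mathbb{Z}^d$ such that $v_i$ and $v_{i+1}$ are adjacent for each $1\le i\le n-1$ (so length counts the number of vertices). The notation $v\in\pi$ means that $v$ is one of the vertices of $\pi$. Notation: $x^{+}=\max(x,0)$, $x^{-}=\max(-x,0)$, $\log^{+}(x)=\max(\log x,0)$ (with $\log^{+}(0)=0$). *)

(* Defs.v *)
From HB Require Import structures.
From mathcomp Require Import all_boot all_order all_algebra.
From mathcomp Require Import finmap zify.
From mathcomp Require Import all_classical all_reals all_analysis.

Set Implicit Arguments.
Unset Strict Implicit.
Unset Printing Implicit Defensive.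
Import Order.TTheory GRing.Theory Num.Theory.
Import numFieldNormedType.Exports.

Local Open Scope classical_set_scope.
Local Open Scope ring_scope.

Definition lattice_adj (d : nat) (u v : 'rV[int]_d) : bool :=
  \sum_(i < d) `|u ord0 i - v ord0 i| == 1.

(* The length [n] of a path is its number of vertices. *)
Definition self_avoiding_path (d : nat) (v : 'rV[int]_d) (n : nat)
    (p : seq 'rV[int]_d) : bool :=
  [&& size p == n, ohead p == Some v, uniq p & sorted (@lattice_adj d) p].

Definition path_sum (d : nat) (R : realType) (x : 'rV[int]_d -> R)
    (p : seq 'rV[int]_d) : R :=
  \sum_(v <- p) x v.

(* The set of sums is finite, and nonempty when d, n >= 1, so this supremum is
   a maximum: see [greedy_path_max_attained]. *)
Definition greedy_path_max (d : nat) (R : realType) (x : 'rV[int]_d -> R)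
    (n : nat) : R :=
  sup [set path_sum x p | p in [set p | self_avoiding_path 0 n p]].

Definition log_plus (R : realType) (x : R) : R := Num.max (ln x) 0.

Definition mutually_independent (disp : measure_display)
    (T : measurableType disp) (R : realType) (P : probability T R)
    (I : choiceType) (X : I -> {RV P >-> R}) : Prop :=
  forall (J : {fset I}) (B : I -> set R),
    (forall i, measurable (B i)) ->
    P (\bigcap_(i in [set` J]) (X i @^-1` B i)) =
    (\prod_(i <- J) P (X i @^-1` B i))%E.

Definition identically_distributed (disp : measure_display)
    (T : measurableType disp) (R : realType) (P : probability T R)
    (I : Type) (X : I -> {RV P >-> R}) : Prop :=
  forall (i j : I) (B : set R), measurable B ->
    distribution P (X i) B = distribution P (X j) B.

Definition cvg_L1 (disp : measure_display) (T : measurableType disp)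
    (R : realType) (P : probability T R) (Y : nat -> T -> R) (Z : T -> R)
    : Prop :=
  [/\ forall n, P.-integrable setT (EFin \o Y n),
      P.-integrable setT (EFin \o Z)
    & 'E_P[fun w => `|Y n w - Z w|%R]%E @[n --> \oo] --> 0%E].

Lemma lattice_adj_finite (d : nat) (u : 'rV[int]_d) :
  finite_set [set v | lattice_adj u v].
Proof.
pose c (f : {ffun 'I_d -> 'I_3}) : 'rV[int]_d :=
  \row_i (u ord0 i + (f i)%:Z - 1).
apply: (@sub_finite_set _ _ (c @` setT)); last exact/finite_image/finite_finset.
move=> v /= /eqP uv.
have h i : `|u ord0 i - v ord0 i| <= 1.
  by rewrite -uv (bigD1 i) //= lerDl sumr_ge0.
exists [ffun i => inord (absz (v ord0 i - u ord0 i + 1))] => //.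
apply/rowP => i; rewrite !mxE ffunE.
have := h i; rewrite (_ : v 0 i = v ord0 i) //.
move: (u ord0 i) (v ord0 i) => a b; rewrite ler_norml => /andP[? ?].
by rewrite inordK; lia.
Qed.

Lemma self_avoiding_path_finite (d : nat) (n : nat) (v : 'rV[int]_d) :
  finite_set [set p | self_avoiding_path v n p].
Proof.
elim: n v => [|n IH] v.
  by apply: (sub_finite_set _ (finite_set1 [::])) => p /= /and4P[/nilP ->].
have fin : finite_set ([set [::]] `|`
    \bigcup_(w in [set w | lattice_adj v w]) [set p | self_avoiding_path w n p]).
  rewrite finite_setU; split; first exact: finite_set1.
  apply: bigcup_finite => [|w _]; [exact: lattice_adj_finite | exact: IH].
apply: (sub_finite_set _ (finite_image (cons v) fin)).
move=> [//|v' p] /= /and4P[/= szp /eqP[->] /andP[_ up] pp]; exists p => //.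
case: p szp up pp => [|w p] szp up /=; first by left.
move=> /andP[vw wp]; right; exists w => //=.
by apply/and4P; split.
Qed.

Lemma self_avoiding_path_exists (d : nat) (n : nat) :
  (1 <= d)%N -> (1 <= n)%N ->
  exists p : seq 'rV[int]_d, self_avoiding_path 0 n p.
Proof.
case: d => // d _; case: n => // n _.
pose f (k : nat) : 'rV[int]_d.+1 := \row_i (if i == ord0 then k%:Z else 0).
exists (map f (iota 0 n.+1)); apply/and4P; split.
- by rewrite size_map size_iota.
- by rewrite /=; apply/eqP; congr Some; apply/rowP => i; rewrite !mxE if_same.
- rewrite map_inj_uniq ?iota_uniq // => a b /rowP/(_ ord0).
  by rewrite !mxE eqxx => -[].
- rewrite sorted_map; apply: (@sub_sorted _ (fun a b => b == a.+1)).
    move=> a b /eqP ->; rewrite /= /lattice_adj big_ord_recl big1 => [|i _].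
      by rewrite !mxE eqxx addr0; lia.
    by rewrite !mxE /= subrr normr0.
  by rewrite /=; elim: n 0%N => //= n IH k; rewrite eqxx IH.
Qed.

Lemma greedy_path_max_attained (d : nat) (R : realType)
    (x : 'rV[int]_d -> R) (n : nat) :
  (1 <= d)%N -> (1 <= n)%N ->
  (exists2 p, self_avoiding_path 0 n p & greedy_path_max x n = path_sum x p) /\
  (forall p, self_avoiding_path 0 n p -> path_sum x p <= greedy_path_max x n).
Proof.
move=> d1 n1; have [p0 hp0] := self_avoiding_path_exists d1 n1.
have [s /seteqP[s1 s2]] := (finite_seqP _).1 (@self_avoiding_path_finite d n 0).
have [q hq qmax] : exists2 q, self_avoiding_path 0 n q &
    forall p, self_avoiding_path 0 n p -> path_sum x p <= path_sum x q.
  have : p0 \in s by exact: s1.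
  move=> p0s; pose F (i : seq_sub s) := path_sum x (val i).
  case: (@Order.TotalTheory.arg_maxP _ _ _ (SeqSub p0s) xpredT F erefl).
  move=> [q qs] _ hmax; exists q; first exact: s2.
  by move=> p hp; exact: (hmax (SeqSub (s1 _ hp))).
have E : greedy_path_max x n = path_sum x q.
  apply/eqP; rewrite eq_le; apply/andP; split.
    apply: ge_sup; first by exists (path_sum x p0), p0.
    by move=> _ [p hp <-]; exact: qmax.
  apply: ub_le_sup; last by exists q.
  by exists (path_sum x q) => _ [p hp <-]; exact: qmax.
by split=> [|p hp]; [exists q | rewrite E; exact: qmax].
Qed.

(* Main.v *)
(* Proof idea.  Truncate and discretise X into finitely many labels (cut at
   -2^(r+1), mesh 2^-r).  For labels the maximum M_n is a function of finitely
   many independent coordinates; Efron-Stein gives Var M_n = O(n) and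
   exponential concentration at scale sqrt n.  Since a path of length n + m is a
   path of length n followed by one of length m started at a site of a box of
   polynomial size, a union bound yields E M_(n+m) <= E M_n + E M_m +
   O((n+m)^(3/4)), so E M_n / n converges.

   Large values are controlled by a maximal inequality at each level t = 2^i:
   at all scales simultaneously the number of sites with X > t on a path of
   length n is at most n U_i, and the logarithmic moment makes the sum of
   2^i E U_i finite.  Very negative values cost little because a maximiser
   chosen from the labels visits lowest-label sites less often than a set of
   sites chosen independently of the labels would.  Both errors vanish as r
   grows, which gives convergence in L^1.

   For almost sure convergence the variance bound gives convergence along the
   squares k^2 and M_(n+m) <= M_n + m 2^(r+1) interpolates.  In the lower
   bound the lowest label gets the conditional mean of X there, so that the
   error along the label maximiser is centred with second moment O(n). *)
Require Import Defs.
From mathcomp Require Import all_boot all_order all_algebra.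
From mathcomp Require Import finmap ring lra zify.
From mathcomp Require Import all_classical all_reals all_analysis measurable_realfun.
Import Order.TTheory GRing.Theory Num.Theory.
Import numFieldNormedType.Exports.
Set Implicit Arguments.
Unset Strict Implicit.
Unset Printing Implicit Defensive.
Local Open Scope classical_set_scope.
Local Open Scope ring_scope.

(** * Variance and exponential moments on finite products *)

(** The obstacle is that the maximiser depends on the whole field. Labels hide the exact values
    below the cut, so given the labels these values are independent of the label maximiser; what
    remains is to decouple the maximiser from the lowest labels themselves. Large values may attract
    the true maximiser, so they need a bound uniform over all paths and lengths. The lowest label is
    also the reset value in the Efron-Stein bound: resetting a site changes the maximum only if the
    site lies on the maximiser, so at most n differences are nonzero. The variance alone would not
    survive a union over about n^d starting sites; the exponential moment costs sqrt n log n, which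
    is below n^(3/4). Self-avoiding paths can be neither concatenated nor prolonged at will, so
    every inequality between two lengths comes from cutting a longer path. The lowest label receives
    two values: -cut gives a one-sided error, handled by its mean; the conditional mean gives a
    centred error, handled along squares by its second moment. *)

(** Bound exp(-t) = exp(-t/2)^2 below by (1 - t/2)^2 and check that the product of this square with
    the right-hand side is at least 1. *)
Lemma expR_le_quadratic (R : realType) (t : R) :
  `|t| <= 1 -> expR t <= 1 + t + 2 * t ^+ 2.
Proof.
rewrite ler_norml => /andP[t1 t2].
have Et : expR t * expR (- t) = 1 by rewrite expRxMexpNx_1.
have E0 := expR_gt0 t.
have S : (1 - t / 2) ^+ 2 <= expR (- t).
  have -> : expR (- t) = expR (- t / 2) ^+ 2.
    by rewrite -expRM_natl; congr expR; field.
  rewrite ler_sqr ?nnegrE ?expR_ge0 //; last lra.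
  by have := expR_ge1Dx (- t / 2); lra.
have S1 : 1 <= (1 + t + 2 * t ^+ 2) * (1 - t / 2) ^+ 2.
  have -> : (1 + t + 2 * t ^+ 2) * (1 - t / 2) ^+ 2 =
      1 + t ^+ 2 * ((1 - t) * (5 / 2 - t) / 2) by field.
  by rewrite lerDl mulr_ge0 ?sqr_ge0 // divr_ge0 // mulr_ge0 //; lra.
have A0 : 0 <= 1 + t + 2 * t ^+ 2 by have := sqr_ge0 t; lra.
by have := ler_wpM2l (ltW E0) (le_trans S1 (ler_wpM2l A0 S)); rewrite mulr1 mulrCA Et mulr1.
Qed.

Section FiniteProduct.
Variables (R : realType) (I C : finType) (q : C -> R).
Hypotheses (q_ge0 : forall c, 0 <= q c) (q_sum1 : \sum_c q c = 1).
Implicit Types (x : {ffun I -> C}) (f g : {ffun I -> C} -> R).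

Definition prod_weight x : R := \prod_i q (x i).

Definition prod_mean f : R := \sum_x prod_weight x * f x.

Definition upd x (v : I) (c : C) : {ffun I -> C} :=
  [ffun i => if i == v then c else x i].

Definition avg (v : I) f x : R := \sum_c q c * f (upd x v c).

Lemma prod_weight_ge0 x : 0 <= prod_weight x.
Proof. exact: prodr_ge0. Qed.

Lemma prod_weight_sum1 : \sum_x prod_weight x = 1.
Proof.
rewrite /prod_weight -(bigA_distr_bigA (fun (_ : I) c => q c)) /=.
by rewrite big1 // => i _; rewrite q_sum1.
Qed.

Lemma prod_mean_cst (c : R) : prod_mean (fun=> c) = c.
Proof. by rewrite /prod_mean -mulr_suml prod_weight_sum1 mul1r. Qed.

Lemma prod_meanD f g :
  prod_mean (fun x => f x + g x) = prod_mean f + prod_mean g.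
Proof. by rewrite /prod_mean -big_split /=; apply: eq_bigr => x _; rewrite mulrDr. Qed.

Lemma prod_meanZ (a : R) f : prod_mean (fun x => a * f x) = a * prod_mean f.
Proof. by rewrite /prod_mean mulr_sumr; apply: eq_bigr => x _; rewrite mulrCA. Qed.

Lemma prod_meanB f g :
  prod_mean (fun x => f x - g x) = prod_mean f - prod_mean g.
Proof.
rewrite -[- prod_mean g]mulN1r -prod_meanZ -prod_meanD.
by apply: eq_bigr => x _; rewrite mulN1r.
Qed.

Lemma prod_mean_sum (J : Type) (s : seq J) (F : J -> {ffun I -> C} -> R) :
  prod_mean (fun x => \sum_(j <- s) F j x) = \sum_(j <- s) prod_mean (F j).
Proof.
by rewrite /prod_mean exchange_big /=; apply: eq_bigr => x _; rewrite mulr_sumr.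
Qed.

Lemma ler_prod_mean f g : (forall x, f x <= g x) -> prod_mean f <= prod_mean g.
Proof.
by move=> fg; apply: ler_sum => x _; apply: ler_wpM2l; rewrite ?prod_weight_ge0.
Qed.

Lemma prod_mean_ge0 f : (forall x, 0 <= f x) -> 0 <= prod_mean f.
Proof. by move=> f0; apply: sumr_ge0 => x _; rewrite mulr_ge0 ?prod_weight_ge0. Qed.

Lemma eq_prod_mean f g : f =1 g -> prod_mean f = prod_mean g.
Proof. by move=> fg; apply: eq_bigr => x _; rewrite fg. Qed.

Lemma upd_same x v c : upd x v c v = c.
Proof. by rewrite ffunE eqxx. Qed.

Lemma upd_upd x v c c' : upd (upd x v c) v c' = upd x v c'.
Proof. by apply/ffunP => i; rewrite !ffunE; case: eqP. Qed.

Lemma upd_id x v : upd x v (x v) = x.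
Proof. by apply/ffunP => i; rewrite !ffunE; case: eqP => // ->. Qed.

Lemma upd_comm x u v c c' : u != v ->
  upd (upd x u c) v c' = upd (upd x v c') u c.
Proof.
move=> uv; apply/ffunP => i; rewrite !ffunE.
by case: (eqVneq i v) => [->|//]; rewrite eq_sym (negbTE uv).
Qed.

Lemma prod_weight_upd x v c :
  prod_weight x * q c = prod_weight (upd x v c) * q (x v).
Proof.
rewrite /prod_weight (bigD1 v) //= [in RHS](bigD1 v) //= upd_same.
rewrite [in RHS](eq_bigr (fun i => q (x i))); first by ring.
by move=> i /negbTE iv; rewrite ffunE iv.
Qed.

(** The map [h] exchanges the coordinate [x v] with an independent fresh label; it is an involution
    that preserves the joint weight. *)
Lemma prod_mean_avg v f : prod_mean (avg v f) = prod_mean f.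
Proof.
pose h (z : {ffun I -> C} * C) := (upd z.1 v z.2, z.1 v).
have hK : involutive h.
  by move=> [x c]; rewrite /h /= upd_upd upd_same upd_id.
rewrite /prod_mean; under eq_bigr do rewrite mulr_sumr.
rewrite pair_bigA /= (reindex_inj (inv_inj hK)) /=.
under eq_bigr => z _.
  rewrite mulrA -(prod_weight_upd z.1 v z.2) upd_upd upd_id mulrAC.
  over.
rewrite -(pair_bigA _ (fun x c => prod_weight x * f x * q c)) /=.
by apply: eq_bigr => x _; rewrite -mulr_sumr q_sum1 mulr1.
Qed.

Definition indep_coord (v : I) g := forall x c, g (upd x v c) = g x.

Lemma avg_indep_coord v f : indep_coord v (avg v f).
Proof. by move=> x c; apply: eq_bigr => c' _; rewrite upd_upd. Qed.

Lemma indep_coord_avg u v f : indep_coord u f -> indep_coord u (avg v f).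
Proof.
move=> uf x c; case: (eqVneq u v) => [->|uv]; first exact: avg_indep_coord.
by apply: eq_bigr => c' _; rewrite upd_comm // uf.
Qed.

Lemma avgM v f g x : indep_coord v g ->
  avg v (fun x => g x * f x) x = g x * avg v f x.
Proof.
by move=> vg; rewrite /avg mulr_sumr; apply: eq_bigr => c _; rewrite vg mulrCA.
Qed.

Lemma avg_comm u v f x : avg u (avg v f) x = avg v (avg u f) x.
Proof.
case: (eqVneq u v) => [->//|uv]; rewrite /avg.
under eq_bigr do rewrite mulr_sumr.
rewrite exchange_big /=; apply: eq_bigr => c _; rewrite mulr_sumr.
by apply: eq_bigr => c' _; rewrite upd_comm // mulrCA.
Qed.

Lemma avgB v f g x : avg v (fun x => f x - g x) x = avg v f x - avg v g x.
Proof. by rewrite /avg -sumrB; apply: eq_bigr => c _; rewrite mulrBr. Qed.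

Lemma eq_avg v f g : f =1 g -> avg v f =1 avg v g.
Proof. by move=> fg x; apply: eq_bigr => c _; rewrite fg. Qed.

Lemma prod_mean_proj v f g : indep_coord v g ->
  prod_mean (fun x => g x * f x) = prod_mean (fun x => g x * avg v f x).
Proof.
move=> vg; rewrite -(prod_mean_avg v); apply: eq_prod_mean => x.
by rewrite avgM.
Qed.

(** The averaging [avg v] is the orthogonal projection on functions that ignore coordinate [v]. The
    cross term vanishes because [avg v f - g] ignores [v] and [f - avg v f] averages to 0 over
    [v]. *)
Lemma prod_mean_pythagoras v f g : indep_coord v g ->
  prod_mean (fun x => (f x - g x) ^+ 2) =
  prod_mean (fun x => (f x - avg v f x) ^+ 2) +
  prod_mean (fun x => (avg v f x - g x) ^+ 2).
Proof.
move=> vg; pose h x := avg v f x - g x.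
have vh : indep_coord v h by move=> x c; rewrite /h vg avg_indep_coord.
have E0 : prod_mean (fun x => h x * (f x - avg v f x)) = 0.
  rewrite (prod_mean_proj (fun x => f x - avg v f x) vh) -[RHS](prod_mean_cst 0).
  apply: eq_prod_mean => x; rewrite avgB.
  suff -> : avg v (avg v f) x = avg v f x by rewrite subrr mulr0.
  rewrite [LHS]/avg; under eq_bigr do rewrite avg_indep_coord.
  by rewrite -mulr_suml q_sum1 mul1r.
rewrite -prod_meanD -[RHS]addr0 -(mulr0 2) -E0 -prod_meanZ -prod_meanD.
by apply: eq_prod_mean => x; rewrite /h; ring.
Qed.

Lemma prod_mean_avg_sqr v f :
  prod_mean (fun x => avg v f x ^+ 2) <= prod_mean (fun x => f x ^+ 2).
Proof.
have := @prod_mean_pythagoras v f (fun=> 0) (fun _ _ => erefl).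
under [prod_mean _ in LHS]eq_prod_mean do rewrite subr0.
move=> ->.
under [X in _ <= _ + X]eq_prod_mean do rewrite subr0.
by rewrite lerDr; apply: prod_mean_ge0 => x; exact: sqr_ge0.
Qed.

Definition avgs (s : seq I) f := foldr avg f s.

Lemma avgs_avg s v f x : avgs s (avg v f) x = avg v (avgs s f) x.
Proof.
elim: s x => [|u s IH] x //=; rewrite avg_comm.
by rewrite (eq_avg u IH).
Qed.

Lemma avgsB s f g x : avgs s (fun x => f x - g x) x = avgs s f x - avgs s g x.
Proof. by elim: s x => [|u s IH] x //=; rewrite (eq_avg u IH) avgB. Qed.

Lemma prod_mean_avgs_sqr s f :
  prod_mean (fun x => avgs s f x ^+ 2) <= prod_mean (fun x => f x ^+ 2).
Proof.
by elim: s => [|u s IH] //=; apply: le_trans IH; exact: prod_mean_avg_sqr.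
Qed.

Lemma prod_mean_avgs s f : prod_mean (avgs s f) = prod_mean f.
Proof. by elim: s => //= u s IH; rewrite prod_mean_avg. Qed.

Lemma avgs_indep_coord s f v : v \in s -> indep_coord v (avgs s f).
Proof.
elim: s => //= u s IH; rewrite inE => /orP[/eqP ->|/IH vs].
  exact: avg_indep_coord.
exact: indep_coord_avg.
Qed.

Lemma indep_all_cst f : (forall v, indep_coord v f) -> forall x y, f x = f y.
Proof.
move=> fi x y.
pose z (s : seq I) := foldr (fun v z => upd z v (y v)) x s.
have fz s : f (z s) = f x by elim: s => //= u s IH; rewrite fi.
rewrite -(fz (enum I)); congr f; apply/ffunP => i.
have zi (s : seq I) : i \in s -> z s i = y i.
  elim: s => //= u s IH; rewrite inE ffunE.
  by case: (eqVneq i u) => [->|_] //= /IH.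
by rewrite zi // mem_enum.
Qed.

(** Once every coordinate is averaged out nothing is left to depend on, so the result is a constant
    and equals its own mean. *)
Lemma avgs_enum f x : avgs (enum I) f x = prod_mean f.
Proof.
rewrite -(prod_mean_avgs (enum I)) -[LHS]prod_mean_cst.
apply: eq_prod_mean => y; apply: indep_all_cst => v.
by apply: avgs_indep_coord; rewrite mem_enum.
Qed.

(** Coordinates are averaged out one at a time. By orthogonality each step loses the squared norm of
    [avgs s (f - avg v f)], and averaging is a contraction. *)
Lemma variance_avg_le f :
  prod_mean (fun x => f x ^+ 2) - prod_mean f ^+ 2 <=
  \sum_v prod_mean (fun x => (f x - avg v f x) ^+ 2).
Proof.
suff H (s : seq I) : prod_mean (fun x => f x ^+ 2) -
    prod_mean (fun x => avgs s f x ^+ 2) <=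
    \sum_(v <- s) prod_mean (fun x => (f x - avg v f x) ^+ 2).
  have := H (enum I); rewrite big_enum /=.
  under [X in _ - X]eq_prod_mean do rewrite avgs_enum.
  by rewrite prod_mean_cst.
elim: s => [|v s IH] /=; first by rewrite subrr big_nil.
rewrite big_cons.
have P := @prod_mean_pythagoras v (avgs s f) (fun=> 0) (fun _ _ => erefl).
have [P1 P2] : prod_mean (fun x => (avgs s f x - 0) ^+ 2) =
    prod_mean (fun x => avgs s f x ^+ 2) /\
   prod_mean (fun x => (avg v (avgs s f) x - 0) ^+ 2) =
    prod_mean (fun x => avg v (avgs s f) x ^+ 2).
  by split; apply: eq_prod_mean => x; rewrite subr0.
have Q : prod_mean (fun x => (avgs s f x - avg v (avgs s f) x) ^+ 2) <=
    prod_mean (fun x => (f x - avg v f x) ^+ 2).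
  apply: le_trans (prod_mean_avgs_sqr s (fun x => f x - avg v f x)).
  rewrite le_eqVlt; apply/orP; left; apply/eqP; apply: eq_prod_mean => x.
  by rewrite avgsB avgs_avg.
rewrite P1 P2 in P; lra.
Qed.

(* Efron-Stein: given the other coordinates, [avg v f] is the best
   approximation of [f], so [g v] can only do worse. *)
Lemma efron_stein f (g : I -> {ffun I -> C} -> R) :
  (forall v, indep_coord v (g v)) ->
  prod_mean (fun x => f x ^+ 2) - prod_mean f ^+ 2 <=
  prod_mean (fun x => \sum_v (f x - g v x) ^+ 2).
Proof.
move=> gi; apply: (le_trans (variance_avg_le f)).
rewrite prod_mean_sum; apply: ler_sum => v _.
rewrite (prod_mean_pythagoras f (gi v)) lerDl.
by apply: prod_mean_ge0 => x; exact: sqr_ge0.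
Qed.

Lemma prod_mean_sqr_dev f :
  prod_mean (fun x => (f x - prod_mean f) ^+ 2) =
  prod_mean (fun x => f x ^+ 2) - prod_mean f ^+ 2.
Proof.
have -> : prod_mean (fun x => (f x - prod_mean f) ^+ 2) =
    prod_mean (fun x => f x ^+ 2 - (2 * prod_mean f * f x - prod_mean f ^+ 2)).
  by apply: eq_prod_mean => x; ring.
rewrite prod_meanB prod_meanB prod_meanZ prod_mean_cst; ring.
Qed.

(** * Concentration from one-sided differences *)

Section LowerDifferences.
Variables (f : {ffun I -> C} -> R) (g : I -> {ffun I -> C} -> R) (V : R).
Hypotheses (g_indep : forall v, indep_coord v (g v))
  (g_le : forall v x, g v x <= f x)
  (V_ge : forall x, \sum_v (f x - g v x) ^+ 2 <= V).

Lemma variance_le : prod_mean (fun x => (f x - prod_mean f) ^+ 2) <= V.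
Proof.
rewrite prod_mean_sqr_dev; apply: (le_trans (efron_stein f g_indep)).
by rewrite -[leRHS]prod_mean_cst; exact: ler_prod_mean.
Qed.

Let F (l : R) := prod_mean (fun x => expR (l * (f x - prod_mean f))).

Let F_ge0 l : 0 <= F l.
Proof. by apply: prod_mean_ge0 => x; exact: expR_ge0. Qed.

(** Efron-Stein is applied to exp(l/2 (f - mean)). Since [g v] lies below [f], the inequality 1 -
    exp(-s) <= s keeps the factor exp(l (f - mean)) at [f], so F(l) - F(l/2)^2 <= u F(l) with u =
    l^2 V / 4. As u <= 1/4, this is solved through 1 <= (1 - u) exp(2u). *)
Lemma exp_moment_halving l : 0 <= l -> l ^+ 2 * V <= 1 ->
  F l <= expR (l ^+ 2 * V / 2) * F (l / 2) ^+ 2.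
Proof.
move=> l0 lV.
pose e := prod_mean f.
have := @efron_stein (fun x => expR (l / 2 * (f x - e)))
  (fun v x => expR (l / 2 * (g v x - e)))
  (fun v x c => congr1 (fun t => expR (l / 2 * (t - e))) (g_indep v x c)).
have -> : prod_mean (fun x => expR (l / 2 * (f x - e)) ^+ 2) = F l.
  by apply: eq_prod_mean => x; rewrite -expRM_natl; congr expR; rewrite /e; field.
rewrite -/(F (l / 2)) => /le_trans ES.
have {ES} : F l - F (l / 2) ^+ 2 <= (l ^+ 2 * V / 4) * F l.
  apply: ES.
  rewrite -prod_meanZ; apply: ler_prod_mean => x.
  apply: (@le_trans _ _ (\sum_v (l / 2) ^+ 2 * expR (l * (f x - e)) *
      (f x - g v x) ^+ 2)).
    apply: ler_sum => v _.
    set a := l / 2 * (f x - e); set b := l / 2 * (g v x - e).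
    have ba : b <= a by rewrite ler_wpM2l ?divr_ge0 // lerB.
    have -> : expR (l * (f x - e)) = expR a ^+ 2.
      by rewrite -expRM_natl; congr expR; rewrite /a; field.
    have -> : (l / 2) ^+ 2 * expR a ^+ 2 * (f x - g v x) ^+ 2 =
        ((a - b) * expR a) ^+ 2 by rewrite /a /b; ring.
    have H : expR a - expR b <= (a - b) * expR a.
      have := expR_ge1Dx (b - a).
      rewrite expRD expRN -(ler_pM2r (expR_gt0 a)) => H.
      have E : expR b / expR a * expR a = expR b by rewrite divfK // gt_eqF ?expR_gt0.
      by rewrite E in H; nra.
    rewrite ler_sqr ?nnegrE //; last by rewrite mulr_ge0 ?subr_ge0 ?expR_ge0.
    by rewrite subr_ge0 ler_expR.
  rewrite -mulr_sumr.
  have -> : l ^+ 2 * V / 4 * expR (l * (f x - prod_mean f)) =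
      (l / 2) ^+ 2 * expR (l * (f x - e)) * V by rewrite /e; field.
  by apply: ler_wpM2l (V_ge x); rewrite mulr_ge0 ?sqr_ge0 ?expR_ge0.
move=> H.
set u := l ^+ 2 * V / 4 in H.
have [u1 u0] : u <= 1 / 4 /\ 0 <= u.
  split; rewrite /u; first lra.
  rewrite divr_ge0 // mulr_ge0 ?sqr_ge0 //.
  case: (pickP (fun _ : {ffun I -> C} => true)) => [x _|no].
    by apply: le_trans (V_ge x); apply: sumr_ge0 => v _; exact: sqr_ge0.
  by have := prod_weight_sum1; rewrite big_pred0 // => /eqP; rewrite eq_sym oner_eq0.
have -> : l ^+ 2 * V / 2 = 2 * u by rewrite /u; field.
have H2 : 1 <= (1 - u) * expR (2 * u).
  by have := expR_ge1Dx (2 * u); nra.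
have := F_ge0 l; have := expR_gt0 (2 * u); nra.
Qed.

(** Halving [l] repeatedly costs a geometric series of total exponent at most l^2 V <= 1. The
    remaining factor, the 2^k-th power of F(l / 2^k), has exponent of order 2^-k because the linear
    term has mean 0; for large k it is at most 1, whence [expR 2]. *)
Lemma exp_moment_le (l : R) : 0 <= l -> l ^+ 2 * V <= 1 ->
  prod_mean (fun x => expR (l * (f x - prod_mean f))) <= expR 2.
Proof.
move=> l0 lV; rewrite -/(F l).
have H k : F l <= expR (l ^+ 2 * V * (1 - (2 ^+ k)^-1)) * F (l / 2 ^+ k) ^+ (2 ^ k).
  elim: k => [|k IH].
    by rewrite expr0 invr1 subrr mulr0 expR0 mul1r mulr1 expn0 expr1.
  apply: (le_trans IH).
  have k2 : (1 : R) <= 2 ^+ k by apply: exprn_ege1; lra.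
  have := @exp_moment_halving (l / 2 ^+ k).
  have -> : l / 2 ^+ k / 2 = l / 2 ^+ k.+1 by rewrite exprS; field; lra.
  move=> H; apply: (@le_trans _ _ (expR (l ^+ 2 * V * (1 - (2 ^+ k)^-1)) *
    (expR ((l / 2 ^+ k) ^+ 2 * V / 2) * F (l / 2 ^+ k.+1) ^+ 2) ^+ (2 ^ k))).
    apply: ler_wpM2l; first exact: expR_ge0.
    rewrite lerXn2r ?nnegrE ?F_ge0 ?mulr_ge0 ?expR_ge0 ?sqr_ge0 //.
    apply: H; first by rewrite divr_ge0 // exprn_ge0.
    have : (2 ^+ k)^-1 <= 1 :> R by rewrite invf_le1 //; lra.
    have : 0 < (2 ^+ k)^-1 :> R by rewrite invr_gt0; lra.
    rewrite exprMn; set z := _^-1; set t := l ^+ 2 * V in lV *.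
    move=> z0 z1; have -> : l ^+ 2 * z ^+ 2 * V = t * z ^+ 2 by rewrite /t; ring.
    have : z ^+ 2 <= 1 by nra.
    have := sqr_ge0 z; nra.
  rewrite exprMn -exprM mulrA -expnS -expRM_natl -expRD.
  rewrite le_eqVlt; apply/orP; left; apply/eqP; congr (expR _ * _).
  rewrite natrX (exprS 2 k).
  by move: k2; set p := 2 ^+ k => k2; field; lra.
(* A crude bound on the deviation of [f]. It determines how large [k] must be but does not enter the
   final estimate. *)
pose B := \sum_x `|f x - prod_mean f|.
have B0 : 0 <= B by apply: sumr_ge0.
have HB x : `|f x - prod_mean f| <= B.
  by rewrite /B (bigD1 x) //= lerDl sumr_ge0.
have [k kb] : exists k, l * B + 2 * (l ^+ 2 * B ^+ 2) <= 2 ^+ k.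
  exists (Num.bound (l * B + 2 * (l ^+ 2 * B ^+ 2))); set k := Num.bound _.
  apply: (@le_trans _ _ k%:R).
    by apply: ltW; have := archi_boundP (_ : 0 <= l * B + 2 * (l ^+ 2 * B ^+ 2));
      apply; rewrite addr_ge0 ?mulr_ge0 ?sqr_ge0.
  by rewrite -natrX ler_nat ltnW // ltn_expl.
have k2 : (1 : R) <= 2 ^+ k by apply: exprn_ege1; lra.
set m := l / 2 ^+ k.
have m0 : 0 <= m by rewrite divr_ge0 // exprn_ge0.
have lB0 : 0 <= l * B by rewrite mulr_ge0.
have mB : m * B <= 1.
  by rewrite /m mulrAC ler_pdivrMr ?mul1r; [have := sqr_ge0 (l * B); rewrite exprMn; lra | lra].
have Fm : F m <= expR (2 * (m ^+ 2 * B ^+ 2)).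
  apply: (@le_trans _ _ (prod_mean (fun x => 1 + 2 * (m ^+ 2 * B ^+ 2) +
      m * (f x - prod_mean f)))).
    apply: ler_prod_mean => x.
    have := HB x; set t := f x - _ => tB.
    have mt : `|m * t| <= m * B by rewrite normrM (ger0_norm m0) ler_wpM2l.
    have := expR_le_quadratic (le_trans mt mB).
    have : (m * t) ^+ 2 <= (m * B) ^+ 2.
      by rewrite -real_normK ?num_real // ler_sqr ?nnegrE ?mulr_ge0.
    by rewrite !exprMn; lra.
  rewrite prod_meanD prod_mean_cst prod_meanZ prod_meanB prod_mean_cst subrr.
  by rewrite mulr0 addr0 expR_ge1Dx.
apply: (le_trans (H k)); rewrite -/m.
apply: (@le_trans _ _ (expR 1 * expR (2 * (m ^+ 2 * B ^+ 2)) ^+ (2 ^ k))).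
  apply: ler_pM; rewrite ?expR_ge0 ?exprn_ge0 //.
    rewrite ler_expR; have : 0 < (2 ^+ k)^-1 :> R by rewrite invr_gt0; lra.
    have : (2 ^+ k)^-1 <= 1 :> R by rewrite invf_le1 //; lra.
    by set z := _^-1; nra.
  by rewrite lerXn2r ?nnegrE ?F_ge0 ?expR_ge0.
rewrite -expRM_natl -expRD ler_expR natrX /m.
have -> : 2 ^+ k * (2 * ((l / 2 ^+ k) ^+ 2 * B ^+ 2)) = 2 * (l ^+ 2 * B ^+ 2) / 2 ^+ k.
  by field; lra.
have : 2 * (l ^+ 2 * B ^+ 2) / 2 ^+ k <= 1 by rewrite ler_pdivrMr ?mul1r; [nra|lra].
lra.
Qed.

End LowerDifferences.

(** * Maxima of sums over a selected set of coordinates *)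

Section MaxOfSums.
Variables (y : C -> R) (A : {ffun I -> C} -> {set I}) (n : nat) (c0 : C) (D : R).

Definition sel_sum (A : {set I}) x : R := \sum_(i in A) y (x i).

Hypotheses (A_opt : forall x x', sel_sum (A x') x <= sel_sum (A x) x)
  (A_card : forall x, (#|A x| <= n)%N)
  (A_val : forall x x', (forall i, y (x i) = y (x' i)) -> A x = A x')
  (c0_min : forall c, y c0 <= y c)
  (D_ge : forall c, y c - y c0 <= D).

Let f x := sel_sum (A x) x.
Let g v x := f (upd x v c0).

Lemma sel_sum_upd (B : {set I}) x v :
  sel_sum B (upd x v c0) = sel_sum B x - (v \in B)%:R * (y (x v) - y c0).
Proof.
rewrite /sel_sum; case: (boolP (v \in B)) => vB; last first.
  rewrite mul0r subr0; apply: eq_bigr => i iB; rewrite ffunE.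
  by case: eqP => // iv; rewrite iv (negbTE vB) in iB.
rewrite (bigD1 v) //= [in RHS](bigD1 v) //= upd_same mul1r.
rewrite (eq_bigr (fun i => y (x i))); first by ring.
by move=> i /andP[_ /negbTE iv]; rewrite ffunE iv.
Qed.

Lemma max_drop_ge0 v x : g v x <= f x.
Proof.
rewrite /g; apply: le_trans (A_opt x (upd x v c0)).
by rewrite /f sel_sum_upd gerBl mulr_ge0 // subr_ge0.
Qed.

Lemma max_drop_le v x : f x - g v x <= (v \in A x)%:R * D.
Proof.
have := A_opt (upd x v c0) x; rewrite sel_sum_upd -/(f x) -/(f _) -/(g v x).
have : (v \in A x)%:R * (y (x v) - y c0) <= (v \in A x)%:R * D.
  exact: ler_wpM2l.
lra.
Qed.

(** Resetting a coordinate outside the optimal set leaves the maximum unchanged, and resetting one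
    inside lowers it by at most [D]; only [n] terms can contribute. *)
Lemma max_drop_sqr_sum x : \sum_v (f x - g v x) ^+ 2 <= D ^+ 2 * n%:R.
Proof.
apply: (@le_trans _ _ (\sum_v D ^+ 2 * (v \in A x)%:R)).
  apply: ler_sum => v _.
  have := max_drop_ge0 v x; have := max_drop_le v x.
  by case: (v \in A x); rewrite ?mul1r ?mul0r ?mulr1 ?mulr0; nra.
rewrite -mulr_sumr ler_wpM2l ?sqr_ge0 // -natr_sum -big_mkcond /= sum1_card.
by rewrite ler_nat.
Qed.

Lemma max_drop_indep v : indep_coord v (g v).
Proof. by move=> x c; rewrite /g upd_upd. Qed.

Lemma max_variance_le :
  prod_mean (fun x => (f x - prod_mean f) ^+ 2) <= D ^+ 2 * n%:R.
Proof. exact: (variance_le max_drop_indep max_drop_sqr_sum). Qed.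

Lemma max_exp_moment_le (l : R) : 0 <= l -> l ^+ 2 * (D ^+ 2 * n%:R) <= 1 ->
  prod_mean (fun x => expR (l * (f x - prod_mean f))) <= expR 2.
Proof.
exact: (exp_moment_le max_drop_indep max_drop_ge0 max_drop_sqr_sum).
Qed.

(* Raising the value at a site of the optimal set keeps that site in it; for
   the minimal label this makes membership and label negatively associated. *)
Lemma sel_mem_upd_min v x :
  ((v \in A (upd x v c0))%:R <= (v \in A x)%:R :> R).
Proof.
case: (boolP (v \in A (upd x v c0))) => // vA0.
case: (boolP (v \in A x)) => // vA; exfalso.
have h1 := A_opt x (upd x v c0).
have h2 := A_opt (upd x v c0) x.
have h3 := sel_sum_upd (A x) x v.
have h4 := sel_sum_upd (A (upd x v c0)) x v.
rewrite vA0 mul1r in h4; rewrite (negbTE vA) mul0r in h3.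
have h5 := c0_min (x v).
(* The two optimality inequalities force [y (x v) = y c0]. The configurations then carry the same
   values, and the selection depends on values only, which settles the case of ties. *)
have E : A (upd x v c0) = A x.
  apply: A_val => i; rewrite ffunE; case: eqP => // ->; lra.
by rewrite E (negbTE vA) in vA0.
Qed.

Lemma sel_size_sum : \sum_v prod_mean (fun x => (v \in A x)%:R) <= n%:R.
Proof.
rewrite -prod_mean_sum -[leRHS]prod_mean_cst; apply: ler_prod_mean => x.
by rewrite -natr_sum -big_mkcond /= sum1_card ler_nat.
Qed.

End MaxOfSums.

End FiniteProduct.

(** * Self-avoiding paths *)

Section Lattice.
Variable d : nat.
Implicit Types (u v w : 'rV[int]_d) (p : seq 'rV[int]_d).

Definition near_site (N : nat) u v : bool :=
  [forall j, `|v ord0 j - u ord0 j| <= N%:Z].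

Lemma near_siteP N u v :
  reflect (forall j, `|v ord0 j - u ord0 j| <= N%:Z) (near_site N u v).
Proof. exact: forallP. Qed.

Lemma near_site_refl N u : near_site N u u.
Proof. by apply/near_siteP => j; rewrite subrr normr0. Qed.

Lemma near_site_trans N N' u v w :
  near_site N u v -> near_site N' v w -> near_site (N + N') u w.
Proof.
move=> /near_siteP uv /near_siteP vw; apply/near_siteP => j.
move: (uv j) (vw j); move: (u _ j) (v _ j) (w _ j) => a b c; lia.
Qed.

Lemma near_site_le N N' u v : (N <= N')%N -> near_site N u v -> near_site N' u v.
Proof.
move=> NN /near_siteP uv; apply/near_siteP => j; apply: le_trans (uv j) _.
by rewrite lez_nat.
Qed.

Lemma lattice_adj_near u v : lattice_adj u v -> near_site 1 u v.
Proof.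
move=> /eqP uv; apply/near_siteP => j; rewrite distrC -[X in _ <= X]/(1 : int) -uv (bigD1 j) //= lerDl.
by apply: sumr_ge0.
Qed.

Lemma sorted_near v p (n : nat) : sorted (@lattice_adj d) (v :: p) ->
  (size p <= n)%N -> forall w, w \in v :: p -> near_site n v w.
Proof.
elim: p v n => [|v' p IH] v n /=.
  by move=> _ _ w; rewrite inE => /eqP ->; exact: near_site_refl.
case: n => // n /andP[vv' vp] sz w.
rewrite inE => /orP[/eqP ->|wp]; first exact: near_site_refl.
by have := near_site_trans (lattice_adj_near vv') (IH v' n vp sz w wp).
Qed.

Lemma self_avoiding_path_near u n p : self_avoiding_path u n p ->
  forall v, v \in p -> near_site n u v.
Proof.
case: p => [//|u' p] /and4P[/eqP <- /= /eqP[->] _ sp] v vp.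
exact: (@sorted_near u p).
Qed.

Lemma self_avoiding_path_take u n m p : (0 < n)%N ->
  self_avoiding_path u (n + m) p -> self_avoiding_path u n (take n p).
Proof.
move=> n0 /and4P[/eqP sz hd up sp]; apply/and4P; split.
- by rewrite size_takel // sz leq_addr.
- by case: n n0 p sz hd {up sp} => // n _ [].
- exact: take_uniq.
- exact: take_sorted.
Qed.

Lemma self_avoiding_path_drop u n m p : (0 < m)%N ->
  self_avoiding_path u (n + m) p ->
  exists2 w, near_site n u w & self_avoiding_path w m (drop n p).
Proof.
move=> m0 /and4P[/eqP sz hd up sp].
have szn : (n < size p)%N by rewrite sz -[ltnLHS]addn0 ltn_add2l.
exists (nth u p n).
  case: p hd sp {up} sz szn => [//|u' p] /= /eqP[->] sp sz szn.
  case: n sz szn => [|n] sz szn /=; first exact: near_site_refl.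
  have : sorted (@lattice_adj d) (take n.+2 (u :: p)) by exact: take_sorted.
  move=> /= st; apply: (sorted_near st); rewrite ?size_takel //.
  by rewrite inE -(@nth_take n.+1) ?mem_nth ?orbT // size_takel.
apply/and4P; split.
- by rewrite size_drop sz addKn.
- by rewrite (drop_nth u).
- exact: drop_uniq.
- exact: drop_sorted.
Qed.

Lemma self_avoiding_path_shift u n p : self_avoiding_path u n p ->
  self_avoiding_path 0 n [seq v - u | v <- p].
Proof.
move=> /and4P[sz hd up sp]; apply/and4P; split.
- by rewrite size_map.
- by case: p hd {sz up sp} => //= a p /eqP[->]; rewrite subrr.
- by rewrite map_inj_uniq // => a b /addIr.
- rewrite sorted_map; apply: sub_sorted sp => a b; rewrite /lattice_adj.
  move=> /eqP <-; apply/eqP/eq_bigr => i _; rewrite !mxE.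
  by congr `|_|; ring.
Qed.

(** Coordinates are shifted by [N], so that the cube of radius [N] around the origin becomes a
    finite type able to index the finite products above. *)
Definition box (N : nat) := {ffun 'I_d -> 'I_(N.*2.+1)}.

Definition pos N (i : box N) : 'rV[int]_d := \row_j ((i j)%:Z - N%:Z).

Lemma pos_inj N : injective (@pos N).
Proof.
move=> a b /rowP ab; apply/ffunP => j; apply: val_inj.
by have := ab j; rewrite !mxE => /addIr [].
Qed.

Lemma near_pos N v : near_site N 0 v -> exists i : box N, pos i = v.
Proof.
move=> /near_siteP v0; exists [ffun j => inord (absz (v ord0 j + N%:Z))].
apply/rowP => j; rewrite !mxE ffunE.
have := v0 j; rewrite mxE subr0 (_ : v 0 j = v ord0 j) //.
by move: (v ord0 j) => a ?; rewrite inordK; lia.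
Qed.

Lemma card_box N : #|{: box N}| = (N.*2.+1 ^ d)%N.
Proof. by rewrite card_ffun !card_ord. Qed.

Definition site_set N p : {set box N} := [set i | pos i \in p].

Lemma site_set_sum (R : realType) N (z : 'rV[int]_d -> R) p :
  uniq p -> (forall v, v \in p -> near_site N 0 v) ->
  \sum_(i in site_set N p) z (pos i) = path_sum z p.
Proof.
move=> up pn; rewrite /path_sum.
have [s sp us] : exists2 s : seq (box N), p = map (@pos N) s & uniq s.
  elim: p up pn => [|v p IH] /=; first by exists [::].
  move=> /andP[vp up] pn; have [|s sp us] := IH up.
    by move=> w wp; apply: pn; rewrite inE wp orbT.
  have [i iv] := near_pos (pn v (mem_head _ _)).
  exists (i :: s); first by rewrite /= iv sp.
  by rewrite /= us andbT; move: vp; rewrite sp -iv mem_map //; exact: pos_inj.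
rewrite sp big_map [RHS]big_uniq //=; apply: eq_bigl => i.
by rewrite inE mem_map //; exact: pos_inj.
Qed.

Lemma site_set_card N p :
  uniq p -> (forall v, v \in p -> near_site N 0 v) ->
  (#|site_set N p| <= size p)%N.
Proof.
move=> up pn.
rewrite cardE -(size_map (@pos N)) uniq_leq_size //.
  by rewrite map_inj_uniq ?enum_uniq //; exact: pos_inj.
by move=> v /mapP[i]; rewrite mem_enum inE => ? ->.
Qed.

Section PathMax.
Variable R : realType.
Implicit Types z : 'rV[int]_d -> R.
Hypothesis d1 : (1 <= d)%N.

Lemma path_sum_le_max z n p : (1 <= n)%N ->
  self_avoiding_path 0 n p -> path_sum z p <= greedy_path_max z n.
Proof. by move=> n1; exact: (greedy_path_max_attained z d1 n1).2. Qed.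

(** The choice is a function of the field alone: equal fields yield the same path even when several
    paths are optimal. Negative association needs this. *)
Definition opt_path z n : seq 'rV[int]_d :=
  xget [::] [set p | self_avoiding_path 0 n p /\ greedy_path_max z n = path_sum z p]%classic.

Lemma opt_pathP z n : (1 <= n)%N ->
  self_avoiding_path 0 n (opt_path z n) /\
  greedy_path_max z n = path_sum z (opt_path z n).
Proof.
move=> n1; have [[p hp pE] _] := greedy_path_max_attained z d1 n1.
have [//|/(_ p)[]] := xgetP [::] [set p | self_avoiding_path 0 n p /\
  greedy_path_max z n = path_sum z p]%classic.
by move=> q -> [].
by split.
Qed.

Lemma greedy_path_max_ge z n p u : (1 <= n)%N ->
  self_avoiding_path u n p ->
  path_sum z p <= greedy_path_max (fun v => z (u + v)) n.
Proof.
move=> n1 /self_avoiding_path_shift /(path_sum_le_max (fun v => z (u + v)) n1).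
by rewrite /path_sum big_map; under eq_bigr do rewrite addrC subrK.
Qed.

Lemma greedy_path_max_add z n m : (1 <= n)%N -> (1 <= m)%N ->
  exists2 u, near_site n 0 u & greedy_path_max z (n + m) <=
    greedy_path_max z n + greedy_path_max (fun v => z (u + v)) m.
Proof.
move=> n1 m1; have nm1 : (1 <= n + m)%N by rewrite addn_gt0 n1.
have [hp ->] := opt_pathP z nm1; set p := opt_path _ _ in hp *.
have hn := self_avoiding_path_take n1 hp.
have [u nu hm] := self_avoiding_path_drop m1 hp.
exists u => //; rewrite -(cat_take_drop n p) {1}/path_sum big_cat /=.
exact: lerD (path_sum_le_max _ n1 hn) (greedy_path_max_ge _ m1 hm).
Qed.

Lemma greedy_path_max_extend z n m (K : R) : (1 <= n)%N -> (forall v, z v <= K) ->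
  greedy_path_max z (n + m) <= greedy_path_max z n + K * m%:R.
Proof.
move=> n1 zK; have nm1 : (1 <= n + m)%N by rewrite addn_gt0 n1.
have [hp ->] := opt_pathP z nm1; set p := opt_path _ _ in hp *.
have hn := self_avoiding_path_take n1 hp.
rewrite -(cat_take_drop n p) {1}/path_sum big_cat /=.
apply: lerD; first exact: path_sum_le_max.
have -> : m = size (drop n p).
  by move/and4P : hp => [/eqP sz _ _ _]; rewrite size_drop sz addKn.
rewrite mulr_natr -sum1_size; elim: (drop n p) => [|v s IH].
  by rewrite !big_nil mulr0n.
by rewrite !big_cons mulrnDr lerD.
Qed.

Lemma greedy_path_max_le z z' n : (1 <= n)%N ->
  (forall v, near_site n 0 v -> z v <= z' v) ->
  greedy_path_max z n <= greedy_path_max z' n.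
Proof.
move=> n1 zz; have [hp ->] := opt_pathP z n1.
apply: le_trans (path_sum_le_max z' n1 hp).
rewrite /path_sum !big_seq; apply: ler_sum => v vp; apply: zz.
exact: (self_avoiding_path_near hp).
Qed.

Lemma greedy_path_max_eq z z' n : (1 <= n)%N ->
  (forall v, near_site n 0 v -> z v = z' v) ->
  greedy_path_max z n = greedy_path_max z' n.
Proof.
move=> n1 zz; apply/eqP; rewrite eq_le.
by apply/andP; split; apply: greedy_path_max_le => // v nv; rewrite zz.
Qed.

(** The value 0 outside the box is a default that no path of length [N] from the origin reaches. *)
Definition extend_box N (g : box N -> R) : 'rV[int]_d -> R :=
  fun v => if [pick i | pos i == v] is Some i then g i else 0.

Lemma extend_box_pos N (g : box N -> R) i : extend_box g (pos i) = g i.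
Proof.
rewrite /extend_box; case: pickP => [j /eqP/pos_inj -> //|/(_ i)].
by rewrite eqxx.
Qed.

Section FiniteField.
Variables (C : finType) (y : C -> R) (n : nat).
Hypothesis n1 : (1 <= n)%N.
Implicit Type x : {ffun box n -> C}.

Definition opt_sites x : {set box n} :=
  site_set n (opt_path (extend_box (fun i => y (x i))) n).

Lemma opt_sites_sum x (z : 'rV[int]_d -> R) :
  \sum_(i in opt_sites x) z (pos i) =
  path_sum z (opt_path (extend_box (fun i => y (x i))) n).
Proof.
have [hp _] := opt_pathP (extend_box (fun i => y (x i))) n1.
apply: site_set_sum; first by case/and4P : hp.
exact: self_avoiding_path_near hp.
Qed.

Lemma opt_sites_card x : (#|opt_sites x| <= n)%N.
Proof.
have [hp _] := opt_pathP (extend_box (fun i => y (x i))) n1.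
have /and4P[/eqP sz _ up _] := hp.
by rewrite -[leqRHS]sz site_set_card //; exact: self_avoiding_path_near hp.
Qed.

Lemma sel_sum_opt_sites x x' : sel_sum y (opt_sites x') x =
  path_sum (extend_box (fun i => y (x i)))
    (opt_path (extend_box (fun i => y (x' i))) n).
Proof.
by rewrite -opt_sites_sum; apply: eq_bigr => i _; rewrite extend_box_pos.
Qed.

Lemma sel_sum_opt_sites_max x : sel_sum y (opt_sites x) x =
  greedy_path_max (extend_box (fun i => y (x i))) n.
Proof. by rewrite sel_sum_opt_sites -(opt_pathP _ n1).2. Qed.

Lemma opt_sites_opt x x' :
  sel_sum y (opt_sites x') x <= sel_sum y (opt_sites x) x.
Proof.
rewrite sel_sum_opt_sites sel_sum_opt_sites_max.
by apply: path_sum_le_max => //; exact: (opt_pathP _ n1).1.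
Qed.

Lemma opt_sites_val x x' : (forall i, y (x i) = y (x' i)) ->
  opt_sites x = opt_sites x'.
Proof. by move=> xx; rewrite /opt_sites; congr (site_set n (opt_path (extend_box _) n)); apply/funext. Qed.

End FiniteField.
End PathMax.
End Lattice.

(** * Independent labels *)

Section IndependentIntegral.
Local Open Scope ereal_scope.
Context disp (T : measurableType disp) (R : realType) (P : probability T R).
Variables (Y : T -> R) (Z : {RV P >-> R}) (m : R).
Hypotheses (mY : measurable_fun [set: T] Y) (Y0 : forall w, (0 <= Y w)%R)
  (m0 : (0 <= m)%R)
  (YZ : forall B, measurable B ->
    \int[P]_w ((Y w)%:E * (\1_B (Z w))%:E) = m%:E * P (Z @^-1` B)).

Import HBNNSimple.

(** Independence of [Y] and [Z] is encoded by [YZ], the product formula against indicators of [Z];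
    linearity extends it to simple functions and monotone convergence then to nonnegative measurable
    ones. *)
Lemma indep_integral_nnsfun (s : {nnsfun R >-> R}) :
  \int[P]_w ((Y w)%:E * (s (Z w))%:E) = m%:E * \int[P]_w (s (Z w))%:E.
Proof.
have mZ : measurable_fun [set: T] (Z : T -> R) by exact: measurable_funPT.
pose c i := (fset_set (s @` setT))`_i; pose B i := s @^-1` [set c i].
have c0 (i : 'I_(#|` fset_set (s @` setT)|)) : (0 <= c i)%R.
  have : c i \in fset_set (s @` setT) by exact: mem_nth.
  by rewrite in_fset_set // inE => -[x _ <-].
have i0 i t : (0 <= \1_(B i) t :> R)%R by rewrite indicE ler0n.
have mB i : measurable (B i) by exact: measurable_sfunP.
have m1 i : measurable_fun [set: T] (EFin \o (fun w => (\1_(B i) : R -> R) (Z w))).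
  apply/measurable_EFinP; apply: (measurableT_comp _ mZ).
  exact: measurable_indic.
have mYB i : measurable_fun [set: T] (fun w => (Y w)%:E * (\1_(B i) (Z w))%:E).
  by apply: emeasurable_funM; [exact/measurable_EFinP | exact: m1].
have L : \int[P]_w ((Y w)%:E * (s (Z w))%:E) =
    \sum_(i < #|` fset_set (s @` setT)|) (c i)%:E *
      \int[P]_w ((Y w)%:E * (\1_(B i) (Z w))%:E).
  rewrite (eq_integral (fun w => \sum_(i < #|` fset_set (s @` setT)|)
      (c i)%:E * ((Y w)%:E * (\1_(B i) (Z w))%:E))); last first.
    move=> w _; rewrite fimfunEord -sumEFin ge0_sume_distrr //.
      by apply: eq_bigr => i _; rewrite EFinM muleCA.
    by move=> i _; rewrite lee_fin mulr_ge0 ?i0 //; exact: c0.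
  rewrite ge0_integral_sum //; last 2 first.
  - by move=> i; exact: emeasurable_funM.
  - by move=> i w _; do 2?apply: mule_ge0; rewrite lee_fin ?c0 ?i0.
  apply: eq_bigr => i _; rewrite ge0_integralZl_EFin ?c0 //.
  by move=> w _; apply: mule_ge0; rewrite lee_fin ?i0.
have L' : \int[P]_w (s (Z w))%:E =
    \sum_(i < #|` fset_set (s @` setT)|) (c i)%:E * P (Z @^-1` B i).
  rewrite (eq_integral (fun w => \sum_(i < #|` fset_set (s @` setT)|)
      (c i)%:E * (\1_(B i) (Z w))%:E)); last first.
    by move=> w _; rewrite fimfunEord -sumEFin.
  rewrite ge0_integral_sum //; last 2 first.
  - by move=> i; apply: emeasurable_funM => //; exact: m1.
  - by move=> i w _; rewrite mule_ge0 ?lee_fin ?c0 ?i0.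
  apply: eq_bigr => i _; rewrite ge0_integralZl_EFin ?c0 //; last exact: m1.
  rewrite (eq_integral (fun w => (\1_(Z @^-1` B i) w)%:E)) //.
  rewrite integral_indic ?setIT //.
  by rewrite -[X in measurable X]setTI; exact: mZ.
rewrite L L' ge0_sume_distrr; last first.
  by move=> i _; rewrite mule_ge0 ?lee_fin ?c0 ?i0.
by apply: eq_bigr => i _; rewrite YZ // muleCA.
Qed.

Lemma indep_integral (f : R -> R) : measurable_fun [set: R] f ->
  (forall t, (0 <= f t)%R) ->
  \int[P]_w ((Y w)%:E * (f (Z w))%:E) = m%:E * \int[P]_w (f (Z w))%:E.
Proof.
move=> mf f0.
have mZ : measurable_fun [set: T] (Z : T -> R) by exact: measurable_funPT.
have mEf : measurable_fun [set: R] (EFin \o f) by exact/measurable_EFinP.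
pose h := nnsfun_approx measurableT mEf.
have hc t : (h n t)%:E @[n --> \oo] --> (f t)%:E.
  by apply: (cvg_nnsfun_approx measurableT mEf) => // x _; rewrite lee_fin.
have nd t a b : (a <= b)%N -> (h a t)%:E <= (h b t)%:E.
  by move=> ab; rewrite lee_fin; exact/lefP/nd_nnsfun_approx.
have mh n : measurable_fun [set: T] (EFin \o (fun w => h n (Z w))).
  by apply/measurable_EFinP; apply: (measurableT_comp _ mZ).
have L1 : \int[P]_w ((Y w)%:E * (h n (Z w))%:E) @[n --> \oo] -->
    \int[P]_w ((Y w)%:E * (f (Z w))%:E).
  rewrite (eq_integral (fun w => limn (fun n => (Y w)%:E * (h n (Z w))%:E))); last first.
    by move=> w _; apply/esym/cvg_lim => //; exact: cvgeZl.
  apply: cvg_monotone_convergence => //.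
  - move=> n; apply: emeasurable_funM; first exact/measurable_EFinP.
    exact: mh.
  - by move=> n w _; rewrite mule_ge0 ?lee_fin ?i0.
  - by move=> w _ a b ab; apply: lee_wpmul2l; rewrite ?lee_fin // -lee_fin nd.
have L2 : \int[P]_w (h n (Z w))%:E @[n --> \oo] --> \int[P]_w (f (Z w))%:E.
  rewrite (eq_integral (fun w => limn (fun n => (h n (Z w))%:E))); last first.
    by move=> w _; apply/esym/cvg_lim.
  apply: cvg_monotone_convergence => //.
  - by move=> n w _; rewrite lee_fin.
  - by move=> w _ a b ab; exact: nd.
have L3 : \int[P]_w ((Y w)%:E * (h n (Z w))%:E) @[n --> \oo] -->
    m%:E * \int[P]_w (f (Z w))%:E.
  by under eq_cvg do rewrite indep_integral_nnsfun; exact: cvgeZl.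
by apply: (cvg_unique _ L1 L3); exact: ereal_hausdorff.
Qed.

End IndependentIntegral.

Section Labels.
Context disp (T : measurableType disp) (R : realType) (P : probability T R).
Variables (J : choiceType) (X : J -> {RV P >-> R}) (j0 : J).
Hypotheses (Xind : mutually_independent X) (Xid : identically_distributed X).

Lemma prob_site j (B : set R) : measurable B ->
  P (X j @^-1` B) = P (X j0 @^-1` B).
Proof. exact: Xid. Qed.

Lemma integral_site j (f : R -> \bar R) : measurable_fun [set: R] f ->
  (forall t, 0 <= f t)%E ->
  (\int[P]_w f (X j w) = \int[P]_w f (X j0 w))%E.
Proof.
move=> mf f0.
rewrite -[LHS](ge0_integral_distribution _ mf f0) -[RHS](ge0_integral_distribution _ mf f0).
by apply: eq_measure_integral => B mB _; exact: Xid.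
Qed.

Lemma indep_fin (I : finType) (iota : I -> J) (B : I -> set R) :
  injective iota -> (forall i, measurable (B i)) ->
  P (\bigcap_(i in [set: I]) (X (iota i) @^-1` B i)) =
  (\prod_i P (X (iota i) @^-1` B i))%E.
Proof.
move=> inj mB.
pose s := [seq iota i | i <- enum I].
have us : uniq s by rewrite map_inj_uniq ?enum_uniq.
pose B' j := if [pick i | iota i == j] is Some i then B i else setT.
have B'E i : B' (iota i) = B i.
  by rewrite /B'; case: pickP => [k /eqP/inj -> //|/(_ i)]; rewrite eqxx.
have mB' j : measurable (B' j) by rewrite /B'; case: pickP.
have [S SE Sp] : exists2 S : {fset J}, S =i s & perm_eq S s.
  exists (seq_fset tt s); first exact: seq_fsetE.
  by have := seq_fset_perm tt s; rewrite undup_id.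
have := Xind S mB'.
have -> : \bigcap_(j in [set` S]) X j @^-1` B' j =
    \bigcap_(i in [set: I]) X (iota i) @^-1` B i.
  apply/seteqP; split=> w /= H.
    move=> i _ /=; rewrite -B'E; apply: H => /=.
    by rewrite SE map_f // mem_enum.
  by move=> j /=; rewrite SE => /mapP[i _ ->]; rewrite /= B'E; exact: H.
move=> ->; rewrite (perm_big _ Sp) /= big_map big_enum /=.
by apply: eq_bigr => i _; rewrite B'E.
Qed.

Section Classifier.
Variables (C : finType) (cl : R -> C).
Hypothesis mcl : forall c, measurable (cl @^-1` [set c]).

Definition label_prob c : R := fine (P (X j0 @^-1` (cl @^-1` [set c]))).

Lemma measurable_site_preimage j (B : set R) : measurable B ->
  measurable (X j @^-1` B).
Proof.
move=> mB; rewrite -[X in measurable X]setTI.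
by have : measurable_fun setT (X j) by []; apply.
Qed.

Lemma label_probE j c : P (X j @^-1` (cl @^-1` [set c])) = (label_prob c)%:E.
Proof.
rewrite prob_site // /label_prob fineK //.
by apply: fin_num_measure; exact: measurable_site_preimage.
Qed.

Lemma label_prob_ge0 c : 0 <= label_prob c.
Proof. by rewrite /label_prob fine_ge0. Qed.

Section Sites.
Variables (I : finType) (iota : I -> J).
Hypothesis iota_inj : injective iota.

Definition labels w : {ffun I -> C} := [ffun i => cl (X (iota i) w)].

Lemma labels_preimageE (x : {ffun I -> C}) : labels @^-1` [set x] =
  \bigcap_(i in [set: I]) (X (iota i) @^-1` (cl @^-1` [set x i])).
Proof.
apply/seteqP; split=> w /=.
  by move=> <- i _ /=; rewrite ffunE.
by move=> H; apply/ffunP => i; rewrite ffunE; exact: H.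
Qed.

Lemma measurable_labels (x : {ffun I -> C}) : measurable (labels @^-1` [set x]).
Proof.
rewrite labels_preimageE; apply: fin_bigcap_measurable => // i _.
exact: measurable_site_preimage.
Qed.

Lemma prob_labels (x : {ffun I -> C}) :
  P (labels @^-1` [set x]) = (prod_weight label_prob x)%:E.
Proof.
rewrite labels_preimageE indep_fin // /prod_weight -prodEFin.
by apply: eq_bigr => i _; rewrite label_probE.
Qed.

Lemma measurable_fun_labels (g : {ffun I -> C} -> R) :
  measurable_fun [set: T] (fun w => g (labels w)).
Proof.
have -> : (fun w => g (labels w)) =
    (fun w => \sum_x g x * \1_(labels @^-1` [set x]) w).
  apply/funext => w; rewrite (bigD1 (labels w)) //= big1.
    by rewrite indicE mem_set // mulr1 addr0.
  move=> x xw; rewrite indicE memNset ?mulr0 // => /= E.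
  by rewrite E eqxx in xw.
apply: measurable_sum => x; apply: measurable_funM => //.
by apply: measurable_indic; exact: measurable_labels.
Qed.

Lemma integrable_labels (g : {ffun I -> C} -> R) :
  P.-integrable setT (fun w => (g (labels w))%:E).
Proof.
apply: (@measurable_bounded_integrable _ _ _ P (fun w => g (labels w))) => //.
- exact: le_lt_trans (probability_le1 P measurableT) (ltry _).
- exact: measurable_fun_labels.
- exists (\sum_x `|g x|); split; first exact: num_real.
  move=> M hM w _ /=; apply: le_trans (ltW hM).
  by rewrite (bigD1 (labels w)) //= lerDl sumr_ge0.
Qed.

(** The bridge to the finite product: every expectation of a function of finitely many labels
    becomes a finite weighted sum. *)
Lemma integral_labels (g : {ffun I -> C} -> R) :
  (\int[P]_w (g (labels w))%:E = (prod_mean label_prob g)%:E)%E.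
Proof.
rewrite (eq_integral (fun w => \sum_x
    ((g x)%:E * (\1_(labels @^-1` [set x]) w)%:E))%E); last first.
  move=> w _; rewrite (bigD1 (labels w)) //= big1.
    by rewrite indicE mem_set // mule1 adde0.
  move=> x xw; rewrite indicE memNset ?mule0 // => /= E.
  by rewrite E eqxx in xw.
rewrite integral_sum //; last first.
  move=> x; apply: integrableZl => //; apply: integrable_indic => //.
  exact: measurable_labels.
rewrite /prod_mean -sumEFin; apply: eq_bigr => x _.
rewrite integralZl //; last first.
  by apply: integrable_indic => //; exact: measurable_labels.
rewrite integral_indic //; last exact: measurable_labels.
by rewrite setIT [X in (_ * X)%E](prob_labels x) -EFinM mulrC.
Qed.

End Sites.

Lemma label_prob_sum1 : \sum_c label_prob c = 1.
Proof.
pose iota (_ : 'I_1) := j0.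
have inj : injective iota by move=> a b _; rewrite !ord1.
have := integral_labels inj (fun=> 1 : R).
rewrite integral_cst // [X in (_ * X)%E](@probability_setT _ _ _ P) mule1 => -[].
rewrite /prod_mean; under eq_bigr do rewrite mulr1.
rewrite /prod_weight -(bigA_distr_bigA (fun (_ : 'I_1) c => label_prob c)) /=.
by rewrite big_ord1 => <-.
Qed.

End Classifier.

Lemma measurable_site_comp (f : R -> R) j : measurable_fun [set: R] f ->
  measurable_fun [set: T] (fun w => f (X j w)).
Proof. by move=> mf; apply: (measurableT_comp mf); exact: measurable_funPT. Qed.

Section IndependentSites.
Variables (C : finType) (cl : R -> C) (I : finType) (iota : I -> J).
Hypotheses (mcl : forall c, measurable (cl @^-1` [set c]))
  (iota_inj : injective iota).
Variable g : {ffun I -> C} -> R.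
Hypothesis g0 : forall x, 0 <= g x.

(* The events [X_i \in B i] are encoded by refining the labels, which turns the
   claim into one about the finite product. *)
Lemma integral_labels_indic (s : seq I) (B : I -> set R) : uniq s ->
  (forall i, i \in s -> indep_coord i g) -> (forall i, measurable (B i)) ->
  (\int[P]_w (g (labels cl iota w) * \prod_(i <- s) \1_(B i) (X (iota i) w))%:E =
   (prod_mean (label_prob cl) g)%:E * \prod_(i <- s) P (X j0 @^-1` B i))%E.
Proof.
move=> us gs mB.
pose cl2 t : C * {ffun I -> bool} := (cl t, [ffun i => `[< B i t >]]).
have mcl2 c : measurable (cl2 @^-1` [set c]).
  have -> : cl2 @^-1` [set c] = (cl @^-1` [set c.1]) `&`
      \bigcap_(i in [set: I]) (if c.2 i then B i else ~` B i).
    case: c => c b; apply/seteqP; split=> t /=.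
      by case=> <- <-; split=> // i _; rewrite ffunE; case: asboolP.
    move=> [<- H]; rewrite /cl2; congr (_, _); apply/ffunP => i; rewrite ffunE.
    by have := H i Logic.I; case: (b i) => H'; [exact: asboolT | exact: asboolF].
  apply: measurableI => //; apply: fin_bigcap_measurable => // i _.
  by case: ifP => // _; exact: measurableC.
pose q2 := label_prob cl2.
have q20 c : 0 <= q2 c by exact: label_prob_ge0.
have q21 : \sum_c q2 c = 1 by exact: label_prob_sum1.
pose fst2 (x : {ffun I -> C * {ffun I -> bool}}) : {ffun I -> C} := [ffun i => (x i).1].
have fst2E w : fst2 (labels cl2 iota w) = labels cl iota w.
  by apply/ffunP => i; rewrite !ffunE.
pose b i (c : C * {ffun I -> bool}) : R := (c.2 i)%:R.
have bE i t : \1_(B i) t = b i (cl2 t) by rewrite /b /= ffunE.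
have PB i : P (X j0 @^-1` B i) = (\sum_c q2 c * b i c)%:E.
  pose i1 (_ : 'I_1) := j0.
  have inj : injective i1 by move=> a b' _; rewrite !ord1.
  have := integral_labels mcl2 inj (fun x => b i (x ord0)).
  rewrite (eq_integral (fun w => (\1_(X j0 @^-1` B i) w)%:E)); last first.
    by move=> w _; rewrite ffunE -bE.
  rewrite integral_indic ?setIT //; last exact: measurable_site_preimage.
  move=> ->; congr EFin.
  rewrite -(prod_mean_avg q21 ord0) -[RHS](prod_mean_cst 'I_1 q21).
  apply: eq_prod_mean => x; rewrite /avg; apply: eq_bigr => c _.
  by rewrite upd_same.
have gE : prod_mean (label_prob cl) g = prod_mean q2 (g \o fst2).
  apply: EFin_inj; rewrite -(integral_labels mcl iota_inj) -(integral_labels mcl2 iota_inj).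
  by apply: eq_integral => w _; rewrite /= fst2E.
rewrite (eq_bigr _ (fun i _ => PB i)) gE prodEFin -EFinM.
rewrite (eq_integral (fun w => (g (fst2 (labels cl2 iota w)) *
    \prod_(i <- s) b i (labels cl2 iota w i))%:E)); last first.
  move=> w _; rewrite fst2E; congr (_ * _)%:E; apply: eq_bigr => i _.
  by rewrite bE !ffunE.
rewrite (integral_labels mcl2 iota_inj
  (fun x => g (fst2 x) * \prod_(i <- s) b i (x i))); congr EFin.
have fst2_upd x i c : fst2 (upd x i c) = upd (fst2 x) i c.1.
  by apply/ffunP => k; rewrite !ffunE; case: eqP.
have avg_coord i x : avg q2 i (fun x => b i (x i)) x = \sum_c q2 c * b i c.
  by apply: eq_bigr => c _; rewrite upd_same.
(* The indicator attached to [u] is the only factor that involves coordinate [u], so averaging over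
   that coordinate splits off its mean. *)
elim: s us gs => [_ _|u s IH /= /andP[us uniqs] gs].
  rewrite big_nil mulr1; apply: eq_prod_mean => x.
  by rewrite big_nil mulr1.
rewrite big_cons mulrCA -IH //; last first.
  by move=> i si; apply: gs; rewrite inE si orbT.
have gu : indep_coord u (fun x => g (fst2 x) * \prod_(i <- s) b i (x i)).
  move=> x c; rewrite fst2_upd gs ?mem_head //; congr (_ * _).
  rewrite !big_seq; apply: eq_bigr => i si; rewrite ffunE.
  by case: eqP => // iu; rewrite iu (negbTE us) in si.
transitivity (prod_mean q2
    (fun x => (g (fst2 x) * \prod_(i <- s) b i (x i)) * b u (x u))).
  by apply: eq_prod_mean => x; rewrite big_cons mulrCA mulrC.
rewrite (prod_mean_proj q21 (fun x => b u (x u)) gu).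
under eq_prod_mean => x do rewrite avg_coord mulrC.
by rewrite prod_meanZ.
Qed.

Let mg : measurable_fun [set: T] (fun w => g (labels cl iota w)).
Proof. exact: measurable_fun_labels. Qed.

Lemma integral_labels_site u (f : R -> R) : indep_coord u g ->
  measurable_fun [set: R] f -> (forall t, 0 <= f t) ->
  (\int[P]_w (g (labels cl iota w) * f (X (iota u) w))%:E =
   (prod_mean (label_prob cl) g)%:E * \int[P]_w (f (X j0 w))%:E)%E.
Proof.
move=> gu mf f0.
rewrite -(integral_site (iota u) (f := EFin \o f)); last 2 first.
- exact/measurable_EFinP.
- by move=> t; rewrite lee_fin.
rewrite -(@indep_integral _ _ _ P (fun w => g (labels cl iota w))) //.
move=> B mB.
have := @integral_labels_indic [:: u] (fun=> B) isT _ (fun=> mB).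
rewrite big_seq1 prob_site // => <- //; last first.
  by move=> i; rewrite inE => /eqP ->.
by apply: eq_integral => w _; rewrite big_seq1 EFinM.
Qed.

(** The one-variable product formula is used twice: with [X (iota v)] as the independent variable,
    its premise against an indicator of [B] is the same formula for [X (iota u)], the indicator
    being absorbed into the other factor. The mean [e] has to be finite since it becomes part of the
    constant [m]. *)
Lemma integral_labels_site2 u v (f h : R -> R) (e : R) : u != v ->
  indep_coord u g -> indep_coord v g ->
  measurable_fun [set: R] f -> (forall t, 0 <= f t) ->
  measurable_fun [set: R] h -> (forall t, 0 <= h t) ->
  (\int[P]_w (f (X j0 w))%:E)%E = e%:E ->
  (\int[P]_w (g (labels cl iota w) * f (X (iota u) w) * h (X (iota v) w))%:E =
   (prod_mean (label_prob cl) g * e)%:E * \int[P]_w (h (X j0 w))%:E)%E.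
Proof.
move=> uv gu gv mf f0 mh h0 fe.
have mgf : measurable_fun [set: T]
    (fun w => g (labels cl iota w) * f (X (iota u) w)).
  by apply: measurable_funM => //; exact: measurable_site_comp.
have e0 : 0 <= e by rewrite -lee_fin -fe integral_ge0 // => w _; rewrite lee_fin.
rewrite -(integral_site (iota v) (f := EFin \o h)); last 2 first.
- exact/measurable_EFinP.
- by move=> t; rewrite lee_fin.
rewrite -(@indep_integral _ _ _ P
    (fun w => g (labels cl iota w) * f (X (iota u) w))) //.
  by move=> w; rewrite mulr_ge0.
move=> B mB.
rewrite (eq_integral (fun w => (g (labels cl iota w) *
   \1_B (X (iota v) w))%:E * (f (X (iota u) w))%:E)%E); last first.
  by move=> w _; rewrite -!EFinM mulrAC.
rewrite (@indep_integral _ _ _ P (fun w => g (labels cl iota w) *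
   \1_B (X (iota v) w)) (X (iota u))
   (prod_mean (label_prob cl) g * fine (P (X j0 @^-1` B)))) //.
- rewrite (integral_site (iota u) (f := EFin \o f)); last 2 first.
  + exact/measurable_EFinP.
  + by move=> t; rewrite lee_fin.
  rewrite /= fe !EFinM fineK; last first.
    by apply: fin_num_measure; exact: measurable_site_preimage.
  by rewrite (prob_site (iota v) mB) muleAC.
- apply: measurable_funM => //.
  by apply: measurable_site_comp; exact: measurable_indic.
- by move=> w; rewrite mulr_ge0 // indicE.
move=> B' mB'.
pose BB i := if i == u then B' else B.
have := @integral_labels_indic [:: u; v] BB _ _ _.
rewrite !big_cons !big_nil !mule1 /BB eqxx [v == u]eq_sym (negbTE uv) => H.
rewrite EFinM fineK; last first.
  by apply: fin_num_measure; exact: measurable_site_preimage.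
rewrite (prob_site (iota u) mB') -muleA [X in (_ * X)%E]muleC -H.
- apply: eq_integral => w _; rewrite !big_cons !big_nil mulr1 eqxx eq_sym (negbTE uv).
  by rewrite -EFinM mulrAC mulrA.
- by rewrite /= inE uv.
- by move=> i; rewrite !inE => /orP[] /eqP ->.
- by move=> i; case: ifP.
Qed.

End IndependentSites.
End Labels.

(** * Almost subadditive sequences *)

Section FourthRoot.
Variable R : realType.
Implicit Types n m q r : nat.

Definition root4 n : R := Num.sqrt (Num.sqrt n%:R).

Lemma root4_ge0 n : 0 <= root4 n. Proof. exact: sqrtr_ge0. Qed.

Lemma root4X4 n : root4 n ^+ 4 = n%:R.
Proof. by rewrite (exprM _ 2 2) !sqr_sqrtr ?sqrtr_ge0. Qed.

Lemma root4_le n m (c : R) : 0 <= c -> n%:R <= c ^+ 4 * m%:R -> root4 n <= c * root4 m.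
Proof.
move=> c0 nm; rewrite -(@ler_pXn2r _ 4) ?nnegrE ?mulr_ge0 ?root4_ge0 //.
by rewrite exprMn !root4X4.
Qed.

Lemma root4M n m : root4 (n * m) = root4 n * root4 m.
Proof. by rewrite /root4 natrM !sqrtrM ?sqrtr_ge0. Qed.

Lemma root4_1 : root4 1 = 1. Proof. by rewrite /root4 !sqrtr1. Qed.

Lemma root4_gt0 n : (0 < n)%N -> 0 < root4 n.
Proof. by move=> n0; rewrite !sqrtr_gt0 ltr0n. Qed.

(** Each part is at most 2/3 of the whole, and (10/11)^4 > 2/3, so the fourth root of each part is
    at most 10/11 of that of the whole. Write r + t as a sum of fourth powers and pull out one
    factor. *)
Lemma root4_cube_split r t : (0 < r)%N -> (r <= t <= r.+1)%N ->
  11 / 10 * root4 (r + t) ^+ 3 <= root4 r ^+ 3 + root4 t ^+ 3.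
Proof.
move=> r0 /andP[rt tr].
have q0 : 0 < root4 (r + t) by rewrite root4_gt0 // addn_gt0 r0.
have H k : (3 * k <= 2 * (r + t))%N ->
    k%:R <= root4 k ^+ 3 * (10 / 11 * root4 (r + t)).
  move=> kq; rewrite -(root4X4 k) exprSr ler_wpM2l ?exprn_ge0 ?root4_ge0 //.
  apply: root4_le; first lra.
  have : (3 * k)%:R <= (2 * (r + t))%:R :> R by rewrite ler_nat.
  rewrite !natrM; have : 0 <= (r + t)%:R :> R by []; lra.
have Hr := H r; have Ht := H t.
have : (r + t)%:R <= (root4 r ^+ 3 + root4 t ^+ 3) * (10 / 11 * root4 (r + t)).
  by rewrite mulrDl natrD lerD // ?Hr ?Ht //; lia.
rewrite -root4X4; set z := root4 (r + t) in q0 *.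
set s := _ + _ => h.
have : z ^+ 3 * z <= (10 / 11 * s) * z by rewrite -exprSr; nra.
rewrite ler_pM2r //; lra.
Qed.

Lemma ln_le_root4 n : (0 < n)%N -> ln (n%:R : R) <= 4 * root4 n.
Proof.
move=> n0; rewrite -(root4X4 n) lnXn ?root4_gt0 // -[_ *+ 4]mulr_natl ler_pM2l //.
have h : -1 < root4 n - 1 by have := root4_gt0 n0; lra.
have := le_ln1Dx h; rewrite (_ : 1 + (root4 n - 1) = root4 n); [lra|ring].
Qed.

Lemma root4_cvg : (root4 n)^-1 @[n --> \oo] --> 0.
Proof.
apply/cvgrPdist_le => e e0.
pose N := (Num.bound ((e^-1) ^+ 4)).+1.
exists N => // n /= Nn; rewrite sub0r normrN ger0_norm ?invr_ge0 ?root4_ge0 //.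
have n0 : (0 < n)%N by exact: leq_trans Nn.
rewrite -[leRHS]invrK lef_pV2 ?posrE ?root4_gt0 ?invr_gt0 //.
rewrite -(@ler_pXn2r _ 4) ?nnegrE ?root4_ge0 ?invr_ge0 ?(ltW e0) // root4X4.
apply: (@le_trans _ _ (Num.bound ((e^-1) ^+ 4))%:R).
  by apply/ltW/archi_boundP; rewrite exprn_ge0 ?invr_ge0 ?(ltW e0).
by rewrite ler_nat; apply: leq_trans Nn.
Qed.

(* The error term [n^(3/4)] is strictly superadditive up to a factor 11/10 on
   balanced splittings, so it can be absorbed along halvings. *)
Lemma almost_subadditive_cvg (a : nat -> R) (c K : R) : 0 <= c ->
  (forall n m, (0 < n)%N -> (0 < m)%N ->
    a (n + m)%N <= a n + a m + c * root4 (n + m) ^+ 3) ->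
  (forall n m, (0 < n)%N -> a (n + m)%N <= a n + K * m%:R) ->
  (forall n, (0 < n)%N -> `|a n| <= K * n%:R) ->
  exists L : R, a n / n%:R @[n --> \oo] --> L.
Proof.
move=> c0 sub ext bnd.
have K0 : 0 <= K by have := bnd 1%N isT; rewrite mulr1; apply: le_trans.
(* A balanced splitting gains a tenth of [root4 q ^+ 3], and a tenth of [B] is exactly the error [c]
   to be absorbed. *)
pose B := 10 * c.
have step1 q m : (0 < q)%N -> (0 < m)%N ->
    a (q * m)%N <= q%:R * a m + B * root4 m ^+ 3 * (q%:R - root4 q ^+ 3).
  move=> + m0; elim/ltn_ind: q => q IH q0.
  have [q1|q1] := leqP q 1.
    have -> : q = 1%N by apply/eqP; rewrite eqn_leq q1.
    by rewrite mul1n root4_1 expr1n subrr mulr0 addr0 mul1r.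
  pose r := q./2; pose t := (q - r)%N.
  have rt : (r + t = q)%N by rewrite /t /r; lia.
  have [r0 t0] : (0 < r)%N /\ (0 < t)%N by rewrite /t /r; lia.
  have rtq : (r <= t <= r.+1)%N by rewrite /t /r; lia.
  have IHr : a (r * m)%N <= r%:R * a m + B * root4 m ^+ 3 * (r%:R - root4 r ^+ 3).
    by apply: IH => //; lia.
  have IHt : a (t * m)%N <= t%:R * a m + B * root4 m ^+ 3 * (t%:R - root4 t ^+ 3).
    by apply: IH => //; lia.
  have := @sub (r * m)%N (t * m)%N; rewrite !muln_gt0 r0 t0 m0 => /(_ isT isT).
  rewrite -mulnDl rt root4M exprMn => H.
  have S := root4_cube_split r0 rtq; rewrite rt in S.
  have qE : q%:R = r%:R + t%:R :> R by rewrite -natrD rt.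
  have m3 : 0 <= c * root4 m ^+ 3 by rewrite mulr_ge0 // exprn_ge0 // root4_ge0.
  have := ler_wpM2l m3 S.
  rewrite qE; rewrite /B in IHr IHt *.
  move: IHr IHt H; set w := root4 m ^+ 3; set s1 := root4 r ^+ 3.
  set s2 := root4 t ^+ 3; set s3 := root4 q ^+ 3; lra.
(* Euclidean division of n by m: the quotient is handled by [step1], the remainder by the extension
   inequality, at a cost of order m / n. *)
have step2 n m : (0 < m)%N -> (m <= n)%N ->
    a n / n%:R <= a m / m%:R + B / root4 m + 2 * K * m%:R / n%:R.
  move=> m0 mn; have n0 : (0 < n)%N by exact: leq_trans mn.
  pose q := (n %/ m)%N; pose r := (n %% m)%N.
  have q0 : (0 < q)%N by rewrite divn_gt0.
  have nE : n = (q * m + r)%N by rewrite -divn_eq.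
  have rm : (r < m)%N by rewrite ltn_pmod.
  have h1 := step1 q m q0 m0.
  have h2 : a n <= a (q * m)%N + K * r%:R by rewrite nE ext // muln_gt0 q0.
  have h3 := bnd m m0.
  have mR : 0 < m%:R :> R by rewrite ltr0n.
  have nR : 0 < n%:R :> R by rewrite ltr0n.
  have rR : r%:R <= m%:R :> R by rewrite ler_nat ltnW.
  have r0 : 0 <= r%:R :> R by [].
  have nER : n%:R = q%:R * m%:R + r%:R :> R by rewrite {1}nE natrD natrM.
  have S0 := root4_gt0 m0; have S4 := root4X4 m.
  have Sq0 : 0 <= root4 q ^+ 3 by rewrite exprn_ge0 ?root4_ge0.
  have B0 : 0 <= B by rewrite mulr_ge0.
  rewrite ler_pdivrMr // !mulrDl divfK ?gt_eqF //.
  have E1 : a m / m%:R * n%:R = q%:R * a m + a m * (r%:R / m%:R).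
    by rewrite nER; field; rewrite gt_eqF.
  have E2 : B / root4 m * n%:R >= B * root4 m ^+ 3 * q%:R.
    rewrite nER -S4.
    have -> : B / root4 m * (q%:R * root4 m ^+ 4 + r%:R) =
      B * root4 m ^+ 3 * q%:R + B / root4 m * r%:R by field; rewrite gt_eqF.
    by rewrite lerDl mulr_ge0 // divr_ge0 // ltW.
  have rm1 : 0 <= (r%:R / m%:R : R) <= 1.
    by rewrite divr_ge0 //= ler_pdivrMr // mul1r.
  have E3 : - (K * m%:R) <= a m * (r%:R / m%:R).
    have : `|a m * (r%:R / m%:R)| <= K * m%:R.
      rewrite normrM (ger0_norm (andP rm1).1) -[leRHS]mulr1.
      by apply: ler_pM => //; case/andP: rm1.
    by rewrite ler_norml => /andP[].
  have E4 : K * r%:R <= K * m%:R by rewrite ler_wpM2l.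
  have E5 : B * root4 m ^+ 3 * (q%:R - root4 q ^+ 3) <= B * root4 m ^+ 3 * q%:R.
    rewrite ler_wpM2l ?mulr_ge0 ?exprn_ge0 ?root4_ge0 //.
    by rewrite gerBl.
  rewrite E1; lra.
pose v m := a m.+1 / m.+1%:R + B / root4 m.+1.
have B0 : 0 <= B by rewrite mulr_ge0.
have vlb m : - K <= v m.
  have := bnd m.+1 isT; rewrite ler_norml => /andP[h _].
  rewrite /v -[- K]addr0 lerD //; first by rewrite ler_pdivlMr ?ltr0n // mulNr.
  by rewrite divr_ge0 ?root4_ge0.
(* Taking a near-minimiser m of [v] in [step2] bounds the limit from above; from below, [a n / n] is
   at least [L - B / root4 n]. The index of [v] is shifted by one to avoid length 0. *)
pose L := inf (range v).
have Lhi : has_inf (range v).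
  by split; [exists (v 0%N), 0%N | exists (- K) => _ [m _ <-]].
exists L; apply/cvgrPdist_le => e e0.
have [_ [m _ <-] vm] := @inf_adherent _ _ (e / 2) (ltac:(lra)) Lhi.
have T1 : 2 * K * m.+1%:R / n%:R @[n --> \oo] --> (0 : R).
  rewrite -[X in _ --> X](mulr0 (2 * K * m.+1%:R)).
  apply: cvgM; first exact: cvg_cst.
  by apply/gtr0_cvgV0; [near=> n; rewrite ltr0n; near: n; exists 1%N | exact: cvgr_idn].
have T2 : B / root4 n @[n --> \oo] --> (0 : R).
  rewrite -[X in _ --> X](mulr0 B).
  by apply: cvgM; [exact: cvg_cst | exact: root4_cvg].
have e2 : 0 < e / 2 by lra.
move/cvgrPdist_le : T1 => /(_ _ e2) T1; move/cvgrPdist_le : T2 => /(_ _ e2) T2.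
near=> n.
have n0 : (0 < n)%N by near: n; exists 1%N.
have mn : (m.+1 <= n)%N by near: n; exists m.+1.
have t1 : `|0 - 2 * K * m.+1%:R / n%:R| <= e / 2 by near: n.
have t2 : `|0 - B / root4 n| <= e / 2 by near: n.
rewrite !sub0r !normrN in t1 t2.
have {}t1 := le_trans (ler_norm _) t1; have {}t2 := le_trans (ler_norm _) t2.
have up := step2 n m.+1 isT mn.
have lo : L <= v n.-1 by apply: ge_inf; [exact: Lhi.2 | exists n.-1].
rewrite ler_distl; rewrite /v prednK // in lo.
have vm' : a m.+1 / m.+1%:R + B / root4 m.+1 < L + e / 2 := vm.
move: up lo vm' t1 t2; set x1 := a n / _; set x2 := a m.+1 / _.
set x3 := B / _; set x4 := B / _; set x5 := _ / n%:R => up lo vm' t1 t2.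
by apply/andP; split; lra.
Unshelve. all: by end_near.
Qed.

End FourthRoot.

(** * The maximum over paths of a finitely valued field *)

Lemma ler_sum_term (R : realType) (I : finType) (F : I -> R) :
  (forall i, 0 <= F i) -> forall i, F i <= \sum_k F k.
Proof. by move=> F0 i; rewrite (bigD1 i) //= lerDl sumr_ge0. Qed.

Lemma integral_prob_cst disp (T : measurableType disp) (R : realType)
  (P : probability T R) (a : R) : (\int[P]_w a%:E = a%:E)%E.
Proof. by rewrite integral_cst // [X in (_ * X)%E](@probability_setT _ _ _ P) mule1. Qed.

Section LabelledField.
Context disp (T : measurableType disp) (R : realType) (P : probability T R).
Variables (d : nat) (X : 'rV[int]_d -> {RV P >-> R}).
Hypotheses (d1 : (1 <= d)%N)
  (Xind : mutually_independent X) (Xid : identically_distributed X).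
Variables (C : finType) (cl : R -> C).
Hypothesis mcl : forall c, measurable (cl @^-1` [set c]).

Let q := label_prob X 0 cl.

Lemma site_prob_ge0 c : 0 <= q c. Proof. exact: label_prob_ge0. Qed.

Lemma site_prob_sum1 : \sum_c q c = 1. Proof. exact: label_prob_sum1. Qed.

Definition box_labels (n : nat) (u : 'rV[int]_d) : T -> {ffun box d n -> C} :=
  labels X cl (fun i => u + pos i).

Lemma shift_pos_inj n (u : 'rV[int]_d) : injective (fun i : box d n => u + pos i).
Proof. by move=> i k /addrI /pos_inj. Qed.

Section Values.
Variables (y : C -> R) (c0 : C) (D : R).
Hypotheses (y_min : forall c, y c0 <= y c) (D_ge : forall c, y c - y c0 <= D).

Definition box_max n (x : {ffun box d n -> C}) : R :=
  greedy_path_max (extend_box (fun i => y (x i))) n.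

Definition mean_max n : R := prod_mean q (@box_max n).

Definition label_max n (u : 'rV[int]_d) (w : T) : R :=
  greedy_path_max (fun v => y (cl (X (u + v) w))) n.

Lemma label_maxE n u w : (0 < n)%N -> label_max n u w = box_max (box_labels n u w).
Proof.
move=> n0; apply: greedy_path_max_eq => // v /near_pos[i <-].
by rewrite extend_box_pos ffunE.
Qed.

Lemma label_max_measurable n u : (0 < n)%N -> measurable_fun setT (label_max n u).
Proof.
move=> n0; rewrite (_ : label_max n u = fun w => @box_max n (box_labels n u w)).
  exact: (measurable_fun_labels X mcl _ (@box_max n)).
by apply/funext => w; rewrite label_maxE.
Qed.

Lemma integral_label_max (h : R -> R) n u : (0 < n)%N ->
  (\int[P]_w (h (label_max n u w))%:E =
   (prod_mean q (fun x => h (@box_max n x)))%:E)%E.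
Proof.
move=> n0; rewrite -(integral_labels 0 Xind Xid mcl (@shift_pos_inj n u)).
by apply: eq_integral => w _; rewrite label_maxE.
Qed.

Lemma integrable_label_max (h : R -> R) n u : (0 < n)%N ->
  P.-integrable setT (fun w => (h (label_max n u w))%:E).
Proof.
move=> n0; rewrite (_ : (fun _ => _) = (fun w => (h (@box_max n (box_labels n u w)))%:E)).
  exact: (integrable_labels X mcl _ (fun x => h (@box_max n x))).
by apply/funext => w; rewrite label_maxE.
Qed.

Let D0 : 0 <= D. Proof. by have := D_ge c0; rewrite subrr. Qed.

Section FixedLength.
Variable n : nat.
Hypothesis n0 : (0 < n)%N.

Let A := @opt_sites d R C y n.

Let box_maxE : @box_max n = fun x => sel_sum y (A x) x.
Proof. by apply/funext => x; rewrite /A sel_sum_opt_sites_max. Qed.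

Let A_opt x x' : sel_sum y (A x') x <= sel_sum y (A x) x.
Proof. exact: opt_sites_opt. Qed.

Let A_card x : (#|A x| <= n)%N.
Proof. exact: opt_sites_card. Qed.

Let A_val (x x' : {ffun box d n -> C}) : (forall i, y (x i) = y (x' i)) -> A x = A x'.
Proof. exact: opt_sites_val. Qed.

Lemma box_max_variance :
  prod_mean q (fun x => (@box_max n x - mean_max n) ^+ 2) <= D ^+ 2 * n%:R.
Proof.
rewrite /mean_max box_maxE.
exact: (max_variance_le site_prob_ge0 site_prob_sum1 A_opt A_card y_min D_ge).
Qed.

Lemma box_max_exp_moment (l : R) : 0 <= l -> l ^+ 2 * (D ^+ 2 * n%:R) <= 1 ->
  prod_mean q (fun x => expR (l * (@box_max n x - mean_max n))) <= expR 2.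
Proof.
rewrite /mean_max box_maxE.
exact: (max_exp_moment_le site_prob_ge0 site_prob_sum1 A_opt A_card y_min D_ge).
Qed.

Lemma opt_sites_mem_upd_min v (x : {ffun box d n -> C}) :
  ((v \in A (upd x v c0))%:R <= (v \in A x)%:R :> R).
Proof. exact: (sel_mem_upd_min A_opt A_val y_min). Qed.

Lemma opt_sites_size_sum :
  \sum_v prod_mean q (fun x => (v \in A x)%:R) <= n%:R.
Proof. exact: (sel_size_sum site_prob_ge0 site_prob_sum1 A_card). Qed.

End FixedLength.

Lemma label_max_variance n u : (0 < n)%N ->
  (\int[P]_w ((label_max n u w - mean_max n) ^+ 2)%:E <= (D ^+ 2 * n%:R)%:E)%E.
Proof.
move=> n0; rewrite (integral_label_max (fun t => (t - mean_max n) ^+ 2)) //.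
by rewrite lee_fin box_max_variance.
Qed.

(** Strictly positive even if [y] is constant and [D] is 0, so that the scale [l] below is well
    defined. *)
Let Dp : R := D + 1.
Let Dp_gt0 : 0 < Dp. Proof. by rewrite /Dp; have := D0; lra. Qed.

(** The maximum over the N possible starting sites is bounded in mean through x - ln N <= exp(x) / N
    with x = l (M_i - mean): summing the right-hand side over all sites yields at most [expR 2].
    Dividing by [l], taken of the largest order allowed by the exponential moment, gives the
    error. *)
Lemma mean_max_add n m : (0 < n)%N -> (0 < m)%N ->
  mean_max (n + m) <= mean_max n + mean_max m +
    Dp * Num.sqrt m%:R * (ln (n.*2.+1 ^ d)%:R + expR 2).
Proof.
move=> n0 m0; have nm0 : (0 < n + m)%N by rewrite addn_gt0 n0.
pose l := (Dp * Num.sqrt m%:R)^-1.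
have sm0 : 0 < Num.sqrt m%:R :> R by rewrite sqrtr_gt0 ltr0n.
have l0 : 0 < l by rewrite invr_gt0 mulr_gt0.
have lV : l ^+ 2 * (D ^+ 2 * m%:R) <= 1.
  rewrite /l exprVn exprMn sqr_sqrtr // mulrC ler_pdivrMr; last first.
    by rewrite mulr_gt0 ?exprn_gt0 ?ltr0n.
  rewrite mul1r ler_wpM2r // ler_sqr ?nnegrE ?D0 ?(ltW Dp_gt0) //.
  by rewrite /Dp lerDl.
pose N : R := (n.*2.+1 ^ d)%:R.
have N0 : 0 < N by rewrite ltr0n expn_gt0.
pose M (i : box d n) w := label_max m (pos i) w.
pose H w := label_max n 0 w + (mean_max m + ln N / l) +
   \sum_i (l * N)^-1 * expR (l * (M i w - mean_max m)).
have leH w : label_max (n + m) 0 w <= H w.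
  have [u /near_pos[i iu]] :=
    greedy_path_max_add d1 (fun v => y (cl (X (0 + v) w))) n0 m0.
  rewrite -/(label_max (n + m) 0 w) -/(label_max n 0 w).
  rewrite (_ : greedy_path_max (fun v => y (cl (X (0 + (u + v)) w))) m = M i w);
    last by rewrite /M /label_max iu; congr greedy_path_max; apply/funext => v; rewrite add0r.
  move=> h; apply: (le_trans h); rewrite /H -!addrA lerD2l.
  have key : l * (M i w - mean_max m) - ln N <= N^-1 * expR (l * (M i w - mean_max m)).
    have := expR_ge1Dx (l * (M i w - mean_max m) - ln N).
    by rewrite expRD expRN lnK ?posrE // [expR _ / N]mulrC; lra.
  apply: (@le_trans _ _ (mean_max m + (ln N / l + (l * N)^-1 * expR (l * (M i w - mean_max m))))).
    have -> : (l * N)^-1 * expR (l * (M i w - mean_max m)) =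
       l^-1 * (N^-1 * expR (l * (M i w - mean_max m))) by rewrite invfM mulrA.
    have := ler_wpM2l (ltW (_ : 0 < l^-1)) key.
    rewrite invr_gt0 l0 => /(_ isT).
    rewrite mulrBr mulKf ?gt_eqF // [ln N / l]mulrC; lra.
  have F0 k : 0 <= (l * N)^-1 * expR (l * (M k w - mean_max m)).
    by rewrite mulr_ge0 ?expR_ge0 // invr_ge0 mulr_ge0 // ltW.
  apply: lerD; first exact: lexx.
  apply: lerD; first exact: lexx.
  exact: (ler_sum_term F0 i).
have i1 : P.-integrable setT (fun w => (label_max n 0 w)%:E).
  exact: (integrable_label_max id).
have i2 : P.-integrable setT (fun w => (mean_max m + ln N / l)%:E).
  exact: finite_measure_integrable_cst.
have i3 (i : box d n) : P.-integrable setT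
    (fun w => ((l * N)^-1 * expR (l * (M i w - mean_max m)))%:E).
  exact: (integrable_label_max (fun t => (l * N)^-1 * expR (l * (t - mean_max m)))).
have i3s : P.-integrable setT
    (fun w => \sum_(i : box d n) ((l * N)^-1 * expR (l * (M i w - mean_max m)))%:E)%E.
  by apply: integrable_sum => // i _; exact: i3.
have HE : (EFin \o H) = (fun w => ((label_max n 0 w)%:E + (mean_max m + ln N / l)%:E) +
    \sum_(i : box d n) ((l * N)^-1 * expR (l * (M i w - mean_max m)))%:E)%E.
  by apply/funext => w; rewrite /= /H !EFinD sumEFin.
have i12 := integrableD measurableT i1 i2.
have iH : P.-integrable setT (EFin \o H).
  by rewrite HE; exact: (integrableD measurableT i12 i3s).
have : (\int[P]_w (label_max (n + m) 0 w)%:E <= \int[P]_w (EFin \o H) w)%E.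
  apply: le_integral => //; first exact: (integrable_label_max id).
  by move=> w _; rewrite lee_fin.
rewrite (integral_label_max id) // HE (integralD measurableT i12 i3s).
rewrite (integralD measurableT i1 i2) (integral_label_max id) // integral_prob_cst integral_sum //.
under eq_bigr => i _ do rewrite
  (integral_label_max (fun t => (l * N)^-1 * expR (l * (t - mean_max m)))) // prod_meanZ.
rewrite sumEFin -!EFinD lee_fin => h.
have {}h : mean_max (n + m) <= mean_max n + (mean_max m + ln N / l) +
    \sum_(i : box d n) (l * N)^-1 *
      prod_mean q (fun x => expR (l * (@box_max m x - mean_max m))) := h.
apply: (le_trans h).
have -> : Dp * Num.sqrt m%:R = l^-1 by rewrite invrK.
rewrite -mulr_sumr sumr_const card_box -[_ *+ _]mulr_natl -/N.
rewrite [_ * (N * _)]mulrA invfM mulfVK ?gt_eqF // mulrDr [ln N / l]mulrC !addrA lerD2l.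
by apply: ler_wpM2l; [rewrite invr_ge0 ltW | exact: box_max_exp_moment (ltW l0) lV].
Qed.

Let K := \sum_c `|y c|.

Let K_ge c : `|y c| <= K.
Proof. exact: (@ler_sum_term _ _ (fun c => `|y c|)). Qed.

Lemma box_max_norm n (x : {ffun box d n -> C}) : (0 < n)%N ->
  `|@box_max n x| <= K * n%:R.
Proof.
move=> n0; have [hp] := opt_pathP d1 (extend_box (fun i => y (x i))) n0.
rewrite /box_max => ->; set p := opt_path _ _ in hp *.
have /and4P[/eqP sz _ _ _] := hp; rewrite -[in leRHS]sz /path_sum.
have zK v : `|extend_box (fun i => y (x i)) v| <= K.
  rewrite /extend_box; case: pickP => // _.
  by rewrite normr0 (le_trans _ (K_ge c0)).
elim: p {hp sz} => [|v p IH]; first by rewrite big_nil normr0 mulr0.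
rewrite big_cons (le_trans (ler_normD _ _)) //= -natr1 mulrDr mulr1 addrC.
exact: lerD.
Qed.

Lemma mean_max_norm n : (0 < n)%N -> `|mean_max n| <= K * n%:R.
Proof.
move=> n0; have H x := @box_max_norm n x n0.
rewrite ler_norml; apply/andP; split.
  rewrite -[leLHS](prod_mean_cst (box d n) site_prob_sum1).
  apply: (ler_prod_mean site_prob_ge0) => x.
  by have := H x; rewrite ler_norml => /andP[].
rewrite -[leRHS](prod_mean_cst (box d n) site_prob_sum1).
apply: (ler_prod_mean site_prob_ge0) => x.
by have := H x; rewrite ler_norml => /andP[].
Qed.

Lemma mean_max_extend n m : (0 < n)%N ->
  mean_max (n + m) <= mean_max n + K * m%:R.
Proof.
move=> n0; have nm0 : (0 < n + m)%N by rewrite addn_gt0 n0.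
have i1 := integrable_label_max id 0 n0.
have i2 : P.-integrable setT (fun w => (K * m%:R)%:E).
  exact: finite_measure_integrable_cst.
have : (\int[P]_w (label_max (n + m) 0 w)%:E <=
    \int[P]_w ((label_max n 0 w)%:E + (K * m%:R)%:E))%E.
  apply: le_integral => //; first exact: (integrable_label_max id).
    exact: (integrableD measurableT i1 i2).
  move=> w _; rewrite -EFinD lee_fin; apply: greedy_path_max_extend => // v.
  exact: le_trans (ler_norm _) (K_ge _).
rewrite (integralD measurableT i1 i2) (integral_label_max id) //.
by rewrite (integral_label_max id) // integral_prob_cst -EFinD lee_fin.
Qed.

Lemma mean_max_cvg : exists L : R, mean_max n / n%:R @[n --> \oo] --> L.
Proof.
(* With r = [root4 (n + m)], the factor sqrt m is at most r^2 and the logarithm of the box size at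
   most 8 d r; this is the origin of the power 3/4. *)
apply: (@almost_subadditive_cvg R mean_max (Dp * (8 * d%:R + expR 2)) K).
- by rewrite mulr_ge0 ?(ltW Dp_gt0) // addr_ge0 ?expR_ge0 // mulr_ge0.
- move=> n m n0 m0; apply: (le_trans (mean_max_add n0 m0)); rewrite lerD2l.
  rewrite -!mulrA ler_wpM2l ?(ltW Dp_gt0) //.
  set r := root4 R (n + m).
  have nm0 : (0 < n + m)%N by rewrite addn_gt0 n0.
  have r1 : 1 <= r.
    have := @root4_le R 1 (n + m) 1 ler01; rewrite root4_1 mul1r; apply.
    by rewrite expr1n mul1r ler_nat.
  have h1 : Num.sqrt m%:R <= r ^+ 2.
    rewrite sqr_sqrtr ?sqrtr_ge0 // ler_sqrt //.
    by rewrite ler_nat leq_addl.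
  have h2 : ln ((n.*2.+1 ^ d)%:R : R) <= 8 * d%:R * r.
    rewrite natrX lnXn ?ltr0n // -[_ *+ d]mulr_natl.
    have : ln (n.*2.+1%:R : R) <= 8 * r.
      apply: (le_trans (ln_le_root4 R (_ : 0 < n.*2.+1)%N)) => //.
      have : root4 R n.*2.+1 <= 2 * r; last lra.
      apply: root4_le => //; rewrite -natrX -natrM ler_nat; lia.
    by move/(ler_wpM2l (ler0n R d)); rewrite mulrA [d%:R * 8]mulrC.
  have h3 : expR 2 <= expR 2 * r by rewrite ler_peMr ?expR_ge0.
  rewrite exprSr mulrCA; apply: ler_pM; rewrite ?sqrtr_ge0 //.
    by rewrite addr_ge0 ?expR_ge0 // ln_ge0 // ler1n expn_gt0.
  by rewrite mulrDl lerD.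
- by move=> n m n0; exact: mean_max_extend.
- by move=> n n0; exact: mean_max_norm.
Qed.

End Values.
End LabelledField.

(** * Almost sure convergence along squares *)

Section AlmostSure.
Context disp (T : measurableType disp) (R : realType) (P : probability T R).

(** The series of squares has finite expectation, so it is almost surely finite and its terms tend
    to 0. *)
Lemma ae_cvg0_of_sum_sqr (Y : nat -> T -> R) (b : nat -> R) (B : R) :
  (forall k, measurable_fun setT (Y k)) ->
  (forall k, \int[P]_w (Y k w ^+ 2)%:E <= (b k)%:E)%E ->
  (forall n, \sum_(k < n) b k <= B) ->
  {ae P, forall w, Y k w @[k --> \oo] --> 0}.
Proof.
move=> mY Yb bB.
pose f k w := (Y k w ^+ 2)%:E : \bar R.
have mf k : measurable_fun setT (f k).
  by apply/measurable_EFinP; exact: measurable_funX.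
have f0 k w : (0 <= f k w)%E by rewrite lee_fin sqr_ge0.
pose S w := (\sum_(k <oo) f k w)%E.
have mS : measurable_fun setT S by exact: ge0_emeasurable_sum.
have S0 w : (0 <= S w)%E by exact: nneseries_ge0.
have IS : (\int[P]_w S w <= B%:E)%E.
  rewrite integral_nneseries //.
  apply: lime_le.
    by apply: is_cvg_nneseries => k _ _; exact: integral_ge0.
  apply: nearW => n; apply: (@le_trans _ _ (\sum_(0 <= k < n) (b k)%:E)%E).
    by apply: lee_sum => k _; exact: Yb.
  by rewrite sumEFin lee_fin big_mkord.
have iS : P.-integrable setT S.
  apply/integrableP; split => //.
  under eq_integral do rewrite gee0_abs //.
  exact: le_lt_trans IS (ltry _).
have := integrable_ae measurableT iS.
apply: filterS => w /(_ Logic.I) Sfin.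
have Sb n : \sum_(k < n) Y k w ^+ 2 <= fine (S w).
  rewrite -lee_fin fineK // -sumEFin -(big_mkord xpredT (fun k => f k w)).
  exact: nneseries_lim_ge.
have cs : cvgn (series (fun k => Y k w ^+ 2)).
  apply: nondecreasing_is_cvgn.
    by apply/nondecreasing_seqP => n; rewrite !seriesEord /= big_ord_recr /= lerDl sqr_ge0.
  by exists (fine (S w)) => _ [n _ <-]; rewrite seriesEord; exact: Sb.
have /cvgrPdist_le c0 := cvg_series_cvg_0 cs.
apply/cvgrPdist_le => e e0.
have := c0 (e ^+ 2); rewrite exprn_gt0 // => /(_ isT).
apply: filterS => k; rewrite !sub0r !normrN ger0_norm ?sqr_ge0 // => h.
by rewrite -(@ler_pXn2r _ 2) ?nnegrE ?(ltW e0) // real_normK ?num_real.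
Qed.

End AlmostSure.

(** The induction carries the telescoping remainder: n + 1 terms sum to at most 2 - 1/(n+1). *)
Lemma sum_inv_sqr_le (R : realType) n : \sum_(k < n) (k.+1%:R ^- 2 : R) <= 2.
Proof.
suff H : \sum_(k < n.+1) (k.+1%:R ^- 2 : R) <= 2 - n.+1%:R^-1.
  apply: (@le_trans _ _ (\sum_(k < n.+1) (k.+1%:R ^- 2 : R))).
    by rewrite big_ord_recr /= lerDl invr_ge0 exprn_ge0.
  by apply: (le_trans H); rewrite gerBl invr_ge0.
elim: n => [|n IH]; first by rewrite big_ord1 expr1n invr1; lra.
rewrite big_ord_recr /=; apply: le_trans (lerD IH (lexx _)) _.
set a : R := n.+1%:R; have a0 : 0 < a by rewrite ltr0n.
rewrite -[n.+2%:R]natr1 -/a -subr_ge0.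
have -> : 2 - (a + 1)^-1 - (2 - a^-1 + (a + 1) ^- 2) = a^-1 * (a + 1) ^- 2.
  by field; rewrite !gt_eqF // ltr_wpDr.
by rewrite mulr_ge0 // invr_ge0 ?exprn_ge0 // ltW // ltr_wpDr.
Qed.

Section SquareInterpolation.
Variable R : realType.

Lemma square_sandwich n : (0 < n)%N ->
  exists k, (k.+1 ^ 2 <= n <= k.+2 ^ 2)%N.
Proof.
elim: n => // n IH _; case: n IH => [|n] IH; first by exists 0%N.
have [k /andP[h1 h2]] := IH isT.
have [e|ne] := eqVneq n.+1 (k.+2 ^ 2)%N.
  by exists k.+1; apply/andP; split; rewrite ?e; nia.
by exists k; apply/andP; split; lia.
Qed.

(** Consecutive squares differ by 2k + 3 <= 3 (k + 1), which is negligible against n >= (k + 1)^2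
    once k + 1 exceeds 3 |c| / e. *)
Lemma near_square (c e : R) (Q : nat -> Prop) : 0 < e ->
  (\forall k \near \oo, Q k) ->
  \forall n \near \oo, exists k, [/\ Q k, Q k.+1, (k.+1 ^ 2 <= n <= k.+2 ^ 2)%N &
    c * (2 * k + 3)%:R <= e * n%:R].
Proof.
move=> e0 [N0 _ HQ]; pose m := (N0 + Num.bound (3 * `|c| / e))%N.
exists (m.+2 ^ 2).+1%N => // n /= mn.
have n0 : (0 < n)%N by exact: leq_trans mn.
have [k /andP[h1 h2]] := square_sandwich n0.
have mk : (m < k.+1)%N.
  rewrite ltnNge; apply/negP => km; have : (k.+2 ^ 2 <= m.+2 ^ 2)%N by rewrite leq_exp2r //; lia.
  by rewrite -ltnS in mn; lia.
exists k; split; rewrite ?h1 //.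
- by apply: HQ; rewrite /=; lia.
- by apply: HQ; rewrite /=; lia.
have b : 3 * `|c| <= e * k.+1%:R.
  rewrite [leRHS]mulrC -ler_pdivrMr //.
  apply: (@le_trans _ _ (Num.bound (3 * `|c| / e))%:R).
    by apply/ltW/archi_boundP; apply: divr_ge0; [exact: mulr_ge0 | exact: ltW].
  by rewrite ler_nat; lia.
apply: (@le_trans _ _ (`|c| * (3 * k.+1%:R))).
  apply: (@le_trans _ _ (`|c| * (2 * k + 3)%:R)).
    by rewrite ler_wpM2r // ler_norm.
  by rewrite ler_wpM2l // -natrM ler_nat; lia.
rewrite mulrA [_ * 3]mulrC; apply: (@le_trans _ _ (e * k.+1%:R * k.+1%:R)).
  by rewrite ler_wpM2r.
by rewrite -mulrA ler_wpM2l ?(ltW e0) // -natrM ler_nat; lia.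
Qed.

(* A path can be truncated but not always extended: the same inequality bounds
   [u n] from above by its value at the preceding square and from below by its
   value at the following one. *)
Section Interpolate.
Variables (u : nat -> R) (K L : R).
Hypotheses (K0 : 0 <= K)
  (u_ext : forall n m, (0 < n)%N -> u (n + m)%N <= u n + K * m%:R).

Lemma square_interpolation_le :
  (forall e, 0 < e -> \forall k \near \oo, u (k.+1 ^ 2)%N / (k.+1 ^ 2)%:R <= L + e) ->
  forall e, 0 < e -> \forall n \near \oo, u n / n%:R <= L + e.
Proof.
move=> H e e0; have e2 : 0 < e / 2 by lra.
have := near_square (K + `|L + e / 2|) e2 (H _ e2).
apply: filterS2 (nbhs_infty_gt 0) => n n0 [k [Hk _ /andP[h1 h2] hc]].
have nR : 0 < n%:R :> R by rewrite ltr0n.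
rewrite ler_pdivrMr //; rewrite ler_pdivrMr ?ltr0n ?expn_gt0 // in Hk.
have nE : n = (k.+1 ^ 2 + (n - k.+1 ^ 2))%N by rewrite subnKC.
have := u_ext (n - k.+1 ^ 2) (_ : 0 < k.+1 ^ 2)%N.
rewrite expn_gt0 -nE => /(_ isT) h.
have nER : n%:R = (k.+1 ^ 2)%:R + (n - k.+1 ^ 2)%:R :> R by rewrite -natrD -nE.
have rk : (n - k.+1 ^ 2)%:R <= (2 * k + 3)%:R :> R by rewrite ler_nat; lia.
move: Hk h nER rk hc; set a := (k.+1 ^ 2)%:R; set r := (n - _)%:R.
set s := (2 * k + 3)%:R => Hk h nER rk hc.
have r0 : 0 <= r by [].
have h1' : - (L + e / 2) * r <= `|L + e / 2| * s.
  rewrite -normrN; apply: (@le_trans _ _ (`|- (L + e / 2)| * r)).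
    by rewrite ler_wpM2r // ler_norm.
  by rewrite ler_wpM2l.
have h2' : K * r <= K * s by rewrite ler_wpM2l.
rewrite nER in hc *; lra.
Qed.

Lemma square_interpolation_ge :
  (forall e, 0 < e -> \forall k \near \oo, L - e <= u (k.+1 ^ 2)%N / (k.+1 ^ 2)%:R) ->
  forall e, 0 < e -> \forall n \near \oo, L - e <= u n / n%:R.
Proof.
move=> H e e0; have e2 : 0 < e / 2 by lra.
have := near_square (K + `|L - e / 2|) e2 (H _ e2).
apply: filterS2 (nbhs_infty_gt 0) => n n0 [k [_ Hk /andP[h1 h2] hc]].
have nR : 0 < n%:R :> R by rewrite ltr0n.
rewrite ler_pdivlMr //; rewrite ler_pdivlMr ?ltr0n ?expn_gt0 // in Hk.
have nE : (k.+2 ^ 2 = n + (k.+2 ^ 2 - n))%N by rewrite subnKC.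
have := u_ext (k.+2 ^ 2 - n) n0; rewrite -nE => h.
have nER : (k.+2 ^ 2)%:R = n%:R + (k.+2 ^ 2 - n)%:R :> R by rewrite -natrD -nE.
have rk : (k.+2 ^ 2 - n)%:R <= (2 * k + 3)%:R :> R by rewrite ler_nat; lia.
move: Hk h nER rk hc; set a := (k.+2 ^ 2)%:R; set r := (_ - n)%:R.
set s := (2 * k + 3)%:R => Hk h nER rk hc.
have r0 : 0 <= r by [].
have h1' : - (L - e / 2) * r <= `|L - e / 2| * s.
  rewrite -normrN; apply: (@le_trans _ _ (`|- (L - e / 2)| * r)).
    by rewrite ler_wpM2r // ler_norm.
  by rewrite ler_wpM2l.
have h2' : K * r <= K * s by rewrite ler_wpM2l.
rewrite nER in Hk; lra.
Qed.

End Interpolate.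
End SquareInterpolation.

(** * Errors summed along the label maximiser *)

Section OptimalSites.
Context disp (T : measurableType disp) (R : realType) (P : probability T R).
Variables (d : nat) (X : 'rV[int]_d -> {RV P >-> R}).
Hypotheses (d1 : (1 <= d)%N)
  (Xind : mutually_independent X) (Xid : identically_distributed X).
Variables (C : finType) (cl : R -> C).
Hypothesis mcl : forall c, measurable (cl @^-1` [set c]).
Variables (y : C -> R) (c0 : C).
Hypothesis y_min : forall c, y c0 <= y c.
Variable n : nat.
Hypothesis n0 : (0 < n)%N.

Let q := label_prob X 0 cl.

Definition field_opt_sites (w : T) : {set box d n} :=
  opt_sites y (box_labels X cl n 0 w).

Definition opt_sum (h : R -> R) (w : T) : R :=
  \sum_(i in field_opt_sites w) h (X (0 + pos i) w).

(** The label maximiser is a competitor for the field [f], and at each of its sites the loss is at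
    most [h]. *)
Lemma greedy_path_max_ge_opt_sum (f h : R -> R) w :
  (forall t, y (cl t) - h t <= f t) ->
  label_max X cl y n 0 w - opt_sum h w <=
  greedy_path_max (fun v => f (X v w)) n.
Proof.
move=> fh.
have [hp _] := opt_pathP d1 (extend_box (fun i => y (box_labels X cl n 0 w i))) n0.
apply: le_trans (path_sum_le_max d1 (fun v => f (X v w)) n0 hp).
rewrite -(opt_sites_sum d1 y n0) label_maxE //.
rewrite /box_max -(sel_sum_opt_sites_max d1 y n0) /opt_sum -sumrB.
apply: ler_sum => i _; rewrite ffunE add0r; exact: fh.
Qed.

Lemma opt_sumE (h : R -> R) w : opt_sum h w =
  \sum_i (i \in opt_sites y (box_labels X cl n 0 w))%:R * h (X (0 + pos i) w).
Proof.
rewrite /opt_sum big_mkcond /=; apply: eq_bigr => i _.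
by rewrite /field_opt_sites; case: ifP; rewrite ?mul1r ?mul0r.
Qed.

Let memA i (x : {ffun box d n -> C}) : R := (i \in opt_sites y x)%:R.

Let measurable_memA i : measurable_fun setT (fun w => memA i (box_labels X cl n 0 w)).
Proof. exact: (measurable_fun_labels X mcl _ (memA i)). Qed.

Lemma measurable_opt_sum (h : R -> R) : measurable_fun setT h ->
  measurable_fun setT (opt_sum h).
Proof.
move=> mh; rewrite (_ : opt_sum h = fun w => \sum_i
    memA i (box_labels X cl n 0 w) * h (X (0 + pos i) w)).
  apply: measurable_sum => i; apply: measurable_funM.
    exact: measurable_memA.
  exact: (measurable_site_comp X).
by apply/funext => w; rewrite opt_sumE.
Qed.

Section LowestCell.
Variable h : R -> R.
Hypotheses (mh : measurable_fun setT h) (h_supp : forall t, cl t != c0 -> h t = 0).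

(* On the support of [h] the label at [i] is already the lowest one. *)
Lemma memA_support i w (k : R -> R) : (forall t, cl t != c0 -> k t = 0) ->
  memA i (box_labels X cl n 0 w) * k (X (0 + pos i) w) =
  memA i (upd (box_labels X cl n 0 w) i c0) * k (X (0 + pos i) w).
Proof.
move=> k0; have [e|ne] := eqVneq (cl (X (0 + pos i) w)) c0; last first.
  by rewrite k0 // !mulr0.
by rewrite -[X in upd _ _ X]e -[cl _](ffunE (fun i => cl (X (0 + pos i) w))) upd_id.
Qed.

(** Where [k] does not vanish the label at [i] is the lowest one, so membership may be evaluated
    with that label forced to [c0]. It then no longer depends on the value at [i] and the integral
    factorises; forcing the minimum can only make membership rarer. *)
Lemma integral_opt_site i (k : R -> R) : measurable_fun setT k ->
  (forall t, 0 <= k t) -> (forall t, cl t != c0 -> k t = 0) ->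
  (\int[P]_w (memA i (box_labels X cl n 0 w) * k (X (0 + pos i) w))%:E <=
   (prod_mean q (memA i))%:E * \int[P]_w (k (X 0 w))%:E)%E.
Proof.
move=> mk k0 ks.
have E : (\int[P]_w (memA i (box_labels X cl n 0 w) * k (X (0 + pos i) w))%:E =
  (prod_mean q (fun x => memA i (upd x i c0)))%:E * \int[P]_w (k (X 0 w))%:E)%E.
  rewrite (eq_integral (fun w => (memA i (upd (box_labels X cl n 0 w) i c0) *
    k (X (0 + pos i) w))%:E)); last by move=> w _; rewrite memA_support.
  apply: (integral_labels_site 0 Xind Xid mcl (@shift_pos_inj d n 0)
    (g := fun x => memA i (upd x i c0))) => //.
  by move=> x c; rewrite /memA upd_upd.
rewrite E; apply: lee_wpmul2r; first by apply: integral_ge0 => w _; rewrite lee_fin.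
rewrite lee_fin; apply: ler_prod_mean; first exact: site_prob_ge0.
by move=> x; apply: (opt_sites_mem_upd_min d1 y_min n0).
Qed.

Let sum_memA : \sum_i prod_mean q (memA i) <= n%:R.
Proof. exact: (opt_sites_size_sum d1 Xind Xid mcl y n0). Qed.

Lemma integral_opt_sum_le (e : R) : (forall t, 0 <= h t) ->
  (\int[P]_w (h (X 0 w))%:E <= e%:E)%E ->
  (\int[P]_w (opt_sum h w)%:E <= (n%:R * e)%:E)%E.
Proof.
move=> h0 he.
have e0 : 0 <= e.
  by rewrite -lee_fin; apply: le_trans he; apply: integral_ge0 => w _; rewrite lee_fin.
rewrite (eq_integral (fun w => \sum_i
    (memA i (box_labels X cl n 0 w) * h (X (0 + pos i) w))%:E)%E); last first.
  by move=> w _; rewrite opt_sumE sumEFin.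
rewrite ge0_integral_sum //; last 2 first.
- move=> i; apply/measurable_EFinP; apply: measurable_funM.
    exact: measurable_memA.
  exact: (measurable_site_comp X).
- by move=> i w _; rewrite lee_fin mulr_ge0.
apply: (@le_trans _ _ (\sum_i (prod_mean q (memA i) * e)%:E)%E).
  apply: lee_sum => i _; apply: (le_trans (integral_opt_site i mh h0 h_supp)).
  rewrite EFinM; apply: lee_wpmul2l => //; rewrite lee_fin.
  by apply: prod_mean_ge0 => //; exact: site_prob_ge0.
by rewrite sumEFin -mulr_suml lee_fin ler_wpM2r.
Qed.

End LowestCell.

Section SecondMoment.
Variable h : R -> R.
Hypotheses (mh : measurable_fun setT h) (h_supp : forall t, cl t != c0 -> h t = 0).

Let offdiag (f g : R -> R) (w : T) : R := \sum_(p : box d n * box d n)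
  (p.1 != p.2)%:R * (memA p.1 (box_labels X cl n 0 w) *
    memA p.2 (box_labels X cl n 0 w) *
    f (X (0 + pos p.1) w) * g (X (0 + pos p.2) w)).

Let upd2 (i j : box d n) (x : {ffun box d n -> C}) := upd (upd x i c0) j c0.

Let offdiag_mean : R := \sum_(p : box d n * box d n) (p.1 != p.2)%:R *
  prod_mean q (fun x => memA p.1 (upd2 p.1 p.2 x) * memA p.2 (upd2 p.1 p.2 x)).

Let offdiag_term_measurable (f g : R -> R) (p : box d n * box d n) :
  measurable_fun setT f -> measurable_fun setT g ->
  measurable_fun setT (fun w => (p.1 != p.2)%:R *
    (memA p.1 (box_labels X cl n 0 w) * memA p.2 (box_labels X cl n 0 w) *
    f (X (0 + pos p.1) w) * g (X (0 + pos p.2) w))).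
Proof.
move=> mf mg; apply: measurable_funM => //.
apply: measurable_funM; last exact: (measurable_site_comp X).
apply: measurable_funM; last exact: (measurable_site_comp X).
by apply: measurable_funM; exact: measurable_memA.
Qed.

(** On the supports of [f] and [g] both labels may be forced to [c0], which frees the selection from
    both values. The result depends on [f] and [g] through their common mean [e] only. *)
Let integral_offdiag (f g : R -> R) (e : R) :
  measurable_fun setT f -> measurable_fun setT g ->
  (forall t, 0 <= f t) -> (forall t, 0 <= g t) ->
  (forall t, cl t != c0 -> f t = 0) -> (forall t, cl t != c0 -> g t = 0) ->
  (\int[P]_w (f (X 0 w))%:E = e%:E)%E -> (\int[P]_w (g (X 0 w))%:E = e%:E)%E ->
  (\int[P]_w (offdiag f g w)%:E = (offdiag_mean * (e * e))%:E)%E.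
Proof.
move=> mf mg f0 g0 fs gs fe ge.
under eq_integral do rewrite /offdiag -sumEFin.
rewrite ge0_integral_sum //; last 2 first.
- by move=> p; apply/measurable_EFinP; exact: offdiag_term_measurable.
- by move=> p w _; rewrite lee_fin !mulr_ge0.
rewrite /offdiag_mean mulr_suml -sumEFin; apply: eq_bigr => -[i j] _ /=.
have [->|ij] := eqVneq i j.
  rewrite !mul0r; under eq_integral do rewrite mul0r.
  exact: integral0.
pose G x := memA i (upd2 i j x) * memA j (upd2 i j x).
have Gi : indep_coord i G by move=> x c; rewrite /G /upd2 upd_upd.
have Gj : indep_coord j G.
  by move=> x c; rewrite /G /upd2 (upd_comm _ _ _ ij) upd_upd -(upd_comm _ _ _ ij).
rewrite (eq_integral (fun w => (G (box_labels X cl n 0 w) *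
    f (X (0 + pos i) w) * g (X (0 + pos j) w))%:E)); last first.
  move=> w _; rewrite mul1r; congr EFin.
  have [ei|/fs->] := eqVneq (cl (X (0 + pos i) w)) c0; last by rewrite !mulr0 !mul0r.
  have [ej|/gs->] := eqVneq (cl (X (0 + pos j) w)) c0; last by rewrite !mulr0.
  rewrite /G /upd2; suff -> : upd (upd (box_labels X cl n 0 w) i c0) j c0 =
    box_labels X cl n 0 w by [].
  apply/ffunP => k; rewrite !ffunE.
  by case: eqP => [->|_]; [rewrite ej | case: eqP => // ->; rewrite ei].
rewrite (integral_labels_site2 Xind Xid mcl (@shift_pos_inj d n 0)
  (fun x => mulr_ge0 (ler0n _ _) (ler0n _ _)) ij Gi Gj mf f0 mg g0 fe) ge.
by rewrite -EFinM mul1r mulrA.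
Qed.

(* The off-diagonal terms of the square are centred given the labels; splitting
   [h] into positive and negative parts keeps every integrand nonnegative. *)
Lemma integral_opt_sum_sqr_le (e s : R) :
  (\int[P]_w (Num.max (h (X 0 w)) 0)%:E = e%:E)%E ->
  (\int[P]_w (Num.max (- h (X 0 w)) 0)%:E = e%:E)%E ->
  (\int[P]_w (h (X 0 w) ^+ 2)%:E <= s%:E)%E ->
  (\int[P]_w (opt_sum h w ^+ 2)%:E <= (n%:R * s)%:E)%E.
Proof.
move=> pe ne se.
pose hp t := Num.max (h t) 0; pose hn t := Num.max (- h t) 0.
have mhp : measurable_fun setT hp by exact: measurable_maxr.
have mhn : measurable_fun setT hn.
  by apply: measurable_maxr => //; exact: measurableT_comp.
have hp0 t : 0 <= hp t by rewrite /hp le_max lexx orbT.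
have hn0 t : 0 <= hn t by rewrite /hn le_max lexx orbT.
have hps t : cl t != c0 -> hp t = 0 by move=> /h_supp e0; rewrite /hp e0 maxxx.
have hns t : cl t != c0 -> hn t = 0.
  by move=> /h_supp e0; rewrite /hn e0 oppr0 maxxx.
have hE t : h t = hp t - hn t.
  rewrite /hp /hn; case/orP: (le_total 0 (h t)) => ht.
    by rewrite max_l // max_r ?subr0 // oppr_le0.
  by rewrite max_r // max_l ?sub0r ?opprK // oppr_ge0.
pose h2 t := h t ^+ 2.
have mh2 : measurable_fun setT h2 by exact: measurable_funX.
have h2s t : cl t != c0 -> h2 t = 0.
  by move=> /h_supp e0; rewrite /h2 e0 expr0n.
have h20 t : 0 <= h2 t by exact: sqr_ge0.
(* The mixed products of positive and negative parts are moved to the left, so that both sides are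
   sums of nonnegative terms. *)
have key w : opt_sum h w ^+ 2 + (offdiag hp hn w + offdiag hn hp w) =
    opt_sum h2 w + (offdiag hp hp w + offdiag hn hn w).
  rewrite !opt_sumE expr2 big_distrlr /= pair_bigA /= /offdiag -!big_split /=.
  rewrite [X in _ = X + _](_ : _ = \sum_(p : box d n * box d n)
     (p.1 == p.2)%:R * (memA p.1 (box_labels X cl n 0 w) * h2 (X (0 + pos p.1) w))); last first.
    rewrite -(pair_bigA _ (fun i j => (i == j)%:R *
      (memA i (box_labels X cl n 0 w) * h2 (X (0 + pos i) w)))) /=.
    apply: eq_bigr => i _; rewrite (bigD1 i) //= eqxx mul1r big1 ?addr0 // => j /negbTE ji.
    by rewrite eq_sym ji mul0r.
  rewrite -big_split /=; apply: eq_bigr => -[i j] _ /=.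
  have [->|ij] := eqVneq i j.
    rewrite !mul0r !addr0 mul1r /h2 /memA; case: (_ \in _); rewrite ?mul1r ?mul0r //.
  by rewrite !mul1r mul0r add0r !hE /memA; ring.
have mQ : measurable_fun setT (fun w => opt_sum h w ^+ 2).
  by apply: measurable_funX; exact: measurable_opt_sum.
have mO (f g : R -> R) : measurable_fun setT f -> measurable_fun setT g ->
    measurable_fun setT (offdiag f g).
  by move=> mf mg; apply: measurable_sum => p; exact: offdiag_term_measurable.
have O0 (f g : R -> R) w : (forall t, 0 <= f t) -> (forall t, 0 <= g t) ->
    0 <= offdiag f g w.
  by move=> f0 g0; apply: sumr_ge0 => p _; rewrite !mulr_ge0.
have I2 (f1 g1 f2 g2 : R -> R) : measurable_fun setT f1 -> measurable_fun setT g1 ->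
    measurable_fun setT f2 -> measurable_fun setT g2 ->
    (forall t, 0 <= f1 t) -> (forall t, 0 <= g1 t) ->
    (forall t, 0 <= f2 t) -> (forall t, 0 <= g2 t) ->
    (\int[P]_w (offdiag f1 g1 w + offdiag f2 g2 w)%:E =
     \int[P]_w (offdiag f1 g1 w)%:E + \int[P]_w (offdiag f2 g2 w)%:E)%E.
  move=> mf1 mg1 mf2 mg2 f10 g10 f20 g20.
  under eq_integral do rewrite EFinD.
  rewrite ge0_integralD //.
  - by move=> w _; rewrite lee_fin O0.
  - by apply/measurable_EFinP; exact: mO.
  - by move=> w _; rewrite lee_fin O0.
  - by apply/measurable_EFinP; exact: mO.
have : (\int[P]_w (opt_sum h w ^+ 2 + (offdiag hp hn w + offdiag hn hp w))%:E =
    \int[P]_w (opt_sum h2 w + (offdiag hp hp w + offdiag hn hn w))%:E)%E.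
  by apply: eq_integral => w _; rewrite key.
under eq_integral do rewrite EFinD.
rewrite ge0_integralD //; last 4 first.
- by move=> w _; rewrite lee_fin sqr_ge0.
- exact/measurable_EFinP.
- by move=> w _; rewrite lee_fin addr_ge0 // O0.
- by apply/measurable_EFinP; apply: measurable_funD; exact: mO.
under [X in _ = X -> _]eq_integral do rewrite EFinD.
rewrite ge0_integralD //; last 4 first.
- move=> w _; rewrite lee_fin /opt_sum; exact: sumr_ge0.
- by apply/measurable_EFinP; exact: measurable_opt_sum.
- by move=> w _; rewrite lee_fin addr_ge0 // O0.
- by apply/measurable_EFinP; apply: measurable_funD; exact: mO.
(* All four off-diagonal integrals equal [offdiag_mean * (e * e)]; this finite quantity cancels and
   the diagonal remains. *)
rewrite !I2 // !(@integral_offdiag _ _ e) // -EFinD => E.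
rewrite -(@leeD2rE _ (offdiag_mean * (e * e) + offdiag_mean * (e * e))%:E) // E.
apply: leeD2r; exact: (@integral_opt_sum_le h2 mh2 h2s s h20 se).
Qed.

End SecondMoment.
End OptimalSites.

(** * Large values along a path *)

(* Coarse-graining: a path of length [K * L] visits cells of side [L] that all
   lie near a walk of [K] steps in the rescaled lattice. *)
Section Skeletons.
Variables (d : nat) (L : nat).
Hypothesis L0 : (0 < L)%N.
Implicit Types (u v x : 'rV[int]_d) (p : seq 'rV[int]_d).

Fixpoint skeletons (K : nat) u : seq (seq 'rV[int]_d) :=
  if K is K'.+1 then
    flatten [seq [seq u :: s | s <- skeletons K' (u + pos f)] | f <- enum {: box d 1}]
  else [:: [::]].

Lemma size_skeletons K u : size (skeletons K u) = ((3 ^ d) ^ K)%N.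
Proof.
elim: K u => [|K IH] u //=.
rewrite size_flatten /shape -map_comp (eq_map (g := fun=> ((3 ^ d) ^ K)%N)); last first.
  by move=> f /=; rewrite size_map IH.
rewrite sumnE big_map big_enum /= sum_nat_const.
by rewrite card_box expnS.
Qed.

Lemma skeletons_size K u s : s \in skeletons K u -> size s = K.
Proof.
elim: K u s => [|K IH] u s /=; first by rewrite inE => /eqP ->.
by move=> /flattenP[_ /mapP[f _ ->] /mapP[s' /IH s'K ->]] /=; rewrite s'K.
Qed.

Definition in_cell u v : bool :=
  [forall j, (L%:Z * u ord0 j <= v ord0 j) && (v ord0 j < L%:Z * (u ord0 j + 1))].

Definition cell v : 'rV[int]_d := \row_j (v ord0 j %/ L%:Z)%Z.

Lemma in_cell_cell v : in_cell (cell v) v.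
Proof.
apply/forallP => j; rewrite mxE.
have L0Z : 0 < L%:Z by [].
have := divz_eq (v ord0 j) L%:Z.
have := modz_ge0 (v ord0 j) (lt0r_neq0 L0Z).
have := ltz_pmod (v ord0 j) L0Z.
set q := (_ %/ _)%Z; set r := (_ %% _)%Z; move: (v ord0 j) => a h1 h2 ->.
by apply/andP; split; lia.
Qed.

Lemma in_cell_near u v : in_cell u v -> near_site L (L%:Z *: u) v.
Proof.
move=> /forallP uv; apply/near_siteP => j; rewrite mxE.
have /andP[] := uv j; move: (u ord0 j) (v ord0 j) => a b; lia.
Qed.

Lemma in_cell_step u v v' : in_cell u v -> near_site L v v' ->
  exists f : box d 1, in_cell (u + pos f) v'.
Proof.
move=> /forallP uv /near_siteP vv'.
have /forallP cv' := in_cell_cell v'.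
have [|f fE] := @near_pos d 1 (cell v' - u).
  apply/near_siteP => j; rewrite !mxE subr0.
  have /andP[] := uv j; have := vv' j; have /andP[] := cv' j.
  rewrite mxE; move: (v' ord0 j %/ _)%Z => q.
  move: (u ord0 j) (v ord0 j) (v' ord0 j) => a b c h1 h2 h3 h4 h5.
  have h6 : - L%:Z <= c - b <= L%:Z by rewrite -ler_norml.
  rewrite ler_norml; apply/andP; split.
    by rewrite leNgt; apply/negP => h; nia.
  by rewrite leNgt; apply/negP => h; nia.
by exists f; rewrite fE addrC subrK in_cell_cell.
Qed.

Lemma sorted_nth_near v p i : head v p = v -> sorted (@lattice_adj d) p ->
  (i < size p)%N -> near_site i v (nth v p i).
Proof.
case: p => // v' p /= -> sp ip.
have st : sorted (@lattice_adj d) (take i.+1 (v :: p)) by exact: take_sorted.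
apply: (sorted_near st); first by rewrite size_take_min geq_minl.
rewrite -[X in X \in _](_ : nth v (take i.+1 (v :: p)) i = _); last by rewrite nth_take.
by apply: mem_nth; rewrite size_takel.
Qed.

(** During [L] steps a path moves by at most [L] per coordinate, so its cell changes to one of the
    3^d neighbouring cells, itself included. Sites of a block are within [L] of its first vertex,
    which is within [L] of the corner of its cell: hence the radius [L + L]. *)
Lemma skeletons_cover K u v p : in_cell u v -> head v p = v ->
  sorted (@lattice_adj d) p -> (size p <= K * L)%N ->
  exists2 s, s \in skeletons K u & forall x, x \in p ->
    exists2 u', u' \in s & near_site (L + L) (L%:Z *: u') x.
Proof.
elim: K u v p => [|K IH] u v p uv hp sp szp.
  exists [::]; first by rewrite /= inE.
  by case: p hp sp szp.
pose v' := head v (drop L p).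
have vv' : near_site L v v'.
  rewrite /v' -nth0 nth_drop addn0.
  have [Lp|pL] := ltnP L (size p); first exact: sorted_nth_near.
  by rewrite nth_default //; exact: near_site_refl.
have [f fv'] := in_cell_step uv vv'.
have [||| s sK sP] := IH (u + pos f) v' (drop L p) fv'.
- by rewrite /v'; case: (drop L p).
- exact: drop_sorted.
- by rewrite size_drop; lia.
exists (u :: s).
  apply/flattenP; exists [seq u :: s | s <- skeletons K (u + pos f)].
    by apply/mapP; exists f => //; rewrite mem_enum.
  by apply/mapP; exists s.
move=> x; rewrite -{1}(cat_take_drop L p) mem_cat => /orP[xp|/sP[u' u's u'x]].
  exists u; first exact: mem_head.
  apply: near_site_trans (in_cell_near uv) _.
  have [i ip <-] := nthP v xp.
  have iL : (i < L)%N by move: ip; rewrite size_take_min leq_min => /andP[].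
  rewrite nth_take //; apply: (@near_site_le _ i); first exact: ltnW.
  apply: sorted_nth_near => //.
  by move: ip; rewrite size_take_min leq_min => /andP[].
by exists u' => //; rewrite inE u's orbT.
Qed.

(** The boxes overlap; repetitions are removed because the exponential moment of the count requires
    distinct, hence independent, sites. *)
Definition skeleton_sites (s : seq 'rV[int]_d) : seq 'rV[int]_d :=
  undup (flatten [seq [seq L%:Z *: u + pos i | i <- enum {: box d (L + L)}] | u <- s]).

(** A box of radius 2 L has side 4 L + 1 <= 5 L. *)
Lemma size_skeleton_sites s : (size (skeleton_sites s) <= size s * (5 * L) ^ d)%N.
Proof.
apply: (leq_trans (size_undup _)); rewrite size_flatten /shape -map_comp.
rewrite (eq_map (g := fun=> ((L + L).*2.+1 ^ d)%N)); last first.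
  by move=> u /=; rewrite size_map -cardE card_box.
rewrite sumnE big_map big_const_seq count_predT iter_addn_0 mulnC leq_mul //.
have h : ((L + L).*2.+1 <= 5 * L)%N by lia.
by case: (d) => // d'; rewrite leq_exp2r.
Qed.

Lemma skeleton_sites_mem s u x : u \in s -> near_site (L + L) (L%:Z *: u) x ->
  x \in skeleton_sites s.
Proof.
move=> us /near_siteP ux; rewrite mem_undup; apply/flattenP.
exists [seq L%:Z *: u + pos i | i <- enum {: box d (L + L)}].
  by apply/mapP; exists u.
have [|i iE] := @near_pos d (L + L) (x - L%:Z *: u).
  by apply/near_siteP => j; have := ux j; rewrite !mxE subr0.
by apply/mapP; exists i; rewrite ?mem_enum // iE addrC subrK.
Qed.

End Skeletons.

Lemma count_le_subset (A : eqType) (a : pred A) (s1 s2 : seq A) :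
  uniq s1 -> {subset s1 <= s2} -> (count a s1 <= count a s2)%N.
Proof.
move=> us sub; rewrite -!size_filter; apply: uniq_leq_size; first exact: filter_uniq.
by move=> x; rewrite !mem_filter => /andP[-> /sub].
Qed.

Section Counting.
Context disp (T : measurableType disp) (R : realType) (P : probability T R).
Variables (d : nat) (X : 'rV[int]_d -> {RV P >-> R}).
Hypotheses (d1 : (1 <= d)%N)
  (Xind : mutually_independent X) (Xid : identically_distributed X).

Definition tail_prob (t : R) : R := fine (P (X 0 @^-1` [set s | t < s])).

Definition exceed_count (t : R) (S : seq 'rV[int]_d) (w : T) : nat :=
  count (fun v => t < X v w) S.

Let measurable_gt (t : R) : measurable [set s : R | t < s].
Proof. by rewrite -set_itvoy; exact: measurable_itv. Qed.

Lemma tail_prob_ge0 t : 0 <= tail_prob t.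
Proof. by rewrite /tail_prob fine_ge0. Qed.

Lemma tail_probE t v : P (X v @^-1` [set s | t < s]) = (tail_prob t)%:E.
Proof.
rewrite (prob_site 0 Xid v (measurable_gt t)) /tail_prob fineK //.
by apply: fin_num_measure; exact: measurable_site_preimage.
Qed.

Lemma exceed_countE t S w :
  (exceed_count t S w)%:R = \sum_(v <- S) \1_(X v @^-1` [set s | t < s]) w :> R.
Proof.
rewrite /exceed_count; elim: S => [|v S IH]; first by rewrite big_nil.
rewrite big_cons /= natrD IH; congr (_ + _).
rewrite indicE; congr (nat_of_bool _)%:R.
by apply/idP/idP => [h|/set_mem //]; exact/mem_set.
Qed.

Let measurable_exceed t v : measurable (X v @^-1` [set s | t < s]).
Proof. exact: measurable_site_preimage. Qed.

Let over t (s : R) : bool := t < s.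

Let measurable_over t b : measurable (over t @^-1` [set b]).
Proof.
case: b; first exact: measurable_gt.
rewrite (_ : _ @^-1` _ = ~` [set s | t < s]); first exact: measurableC.
by apply/seteqP; split=> s /=; rewrite /over => h; [rewrite h | exact/negbTE/negP].
Qed.

Definition label_count (I : finType) (x : {ffun I -> bool}) : nat := \sum_i x i.

Lemma exceed_count_labels t S w : exceed_count t S w =
  label_count (labels X (over t) (tnth (in_tuple S)) w).
Proof.
rewrite /label_count (eq_bigr (fun i => nat_of_bool (t < X (tnth (in_tuple S) i) w)%R)); last first.
  by move=> i _; rewrite ffunE.
rewrite -(big_tnth _ _ S xpredT (fun v => nat_of_bool (t < X v w)%R)) /exceed_count.
by elim: S => [|v S IH]; rewrite ?big_nil // big_cons /= IH.
Qed.

Lemma measurable_exceed_count (h : nat -> R) t S :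
  measurable_fun setT (fun w => h (exceed_count t S w)).
Proof.
rewrite (_ : (fun _ => _) = fun w =>
    (h \o @label_count _) (labels X (over t) (tnth (in_tuple S)) w)).
  exact: (measurable_fun_labels X (measurable_over t)).
by apply/funext => w; rewrite exceed_count_labels.
Qed.

Lemma integral_exceed_count t S :
  (\int[P]_w ((exceed_count t S w)%:R)%:E = ((size S)%:R * tail_prob t)%:E)%E.
Proof.
rewrite (eq_integral (fun w => \sum_(v <- S) (\1_(X v @^-1` [set s | t < s]) w)%:E)%E); last first.
  by move=> w _; rewrite exceed_countE sumEFin.
rewrite ge0_integral_sum //; last first.
  by move=> v; apply/measurable_EFinP; exact: measurable_indic.
rewrite (eq_bigr (fun=> (tail_prob t)%:E)); last first.
  move=> v _; rewrite integral_indic // setIT; exact: tail_probE.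
rewrite sumEFin; congr EFin.
by rewrite big_const_seq count_predT iter_addr_0 mulr_natl.
Qed.

(** The power 2^N is a product of independent factors over the sites, each of mean 1 + p <=
    exp(p). *)
Lemma integral_pow2_exceed_count t S : uniq S ->
  (\int[P]_w (2 ^+ exceed_count t S w)%:E <=
   (expR (tail_prob t * (size S)%:R))%:E)%E.
Proof.
move=> uS.
have inj : injective (tnth (in_tuple S)) by apply/tuple_uniqP.
pose q := label_prob X 0 (over t).
have qT : q true = tail_prob t by [].
have q1 : q true + q false = 1.
  by have := label_prob_sum1 0 Xind Xid (measurable_over t); rewrite big_bool.
rewrite (eq_integral (fun w =>
    (2 ^+ label_count (labels X (over t) (tnth (in_tuple S)) w))%:E)); last first.
  by move=> w _; rewrite exceed_count_labels.
rewrite (integral_labels 0 Xind Xid (measurable_over t) inj (fun x => 2 ^+ label_count x)).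
rewrite lee_fin /prod_mean.
rewrite (eq_bigr (fun x : {ffun 'I_(size S) -> bool} =>
    \prod_i (q (x i) * 2 ^+ x i))); last first.
  by move=> x _; rewrite /label_count -prodrXr big_split.
rewrite -(bigA_distr_bigA (fun (_ : 'I_(size S)) (b : bool) => q b * 2 ^+ b)) /=.
rewrite prodr_const card_ord big_bool /= expr1 mulr1.
have -> : q true * 2 + q false = 1 + tail_prob t by rewrite -qT; lra.
rewrite mulrC expRM_natl; apply: lerXn2r; rewrite ?nnegrE ?expR_ge0 //.
  by rewrite addr_ge0 // tail_prob_ge0.
exact: expR_ge1Dx.
Qed.

(* Up to scale [2 ^ m] the path is replaced by the whole box that contains it.
   Beyond, [N <= c K + 2 ^ (N - c K)] and [2 ^ N] is summed over all skeletons: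
   [2 ^ c] beats both the number [3 ^ d] of steps and the exponential moment. *)
Section Maximal.
Variables (t S0 : R) (m : nat).
Hypothesis pS0 : tail_prob t * (2 ^ m)%:R ^+ d <= S0.

Let p := tail_prob t.
Let L := (2 ^ m)%N.
(** The cost of one skeleton step: 3^d choices, times the exponential moment of the count in one box
    of at most (5 L)^d sites, where p L^d <= S0. *)
Let B : R := (3 ^ d)%:R * expR (5 ^+ d * S0).
Let c : nat := Num.bound B.

Let B_le : B <= 2 ^+ c.
Proof.
apply: (@le_trans _ _ c%:R).
  by apply/ltW/archi_boundP; rewrite mulr_ge0 ?expR_ge0.
by rewrite -natrX ler_nat ltnW // ltn_expl.
Qed.

Let short_bound (k : nat) (w : T) : R :=
  (exceed_count t [seq pos i | i <- enum {: box d (2 ^ k)}] w)%:R.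

Let long_bound (K : nat) (w : T) : R :=
  (2 ^+ (c * K))^-1 *
  \sum_(s <- skeletons K (0 : 'rV[int]_d)) 2 ^+ exceed_count t (skeleton_sites L s) w.

Let term (k : nat) (w : T) : R :=
  (2 ^+ k)^-1 * if (k < m)%N then short_bound k w else long_bound (2 ^ (k - m)) w.

Let term_ge0 k w : 0 <= term k w.
Proof.
rewrite mulr_ge0 ?invr_ge0 //; case: ifP => // _.
by rewrite mulr_ge0 ?invr_ge0 // sumr_ge0.
Qed.

Let measurable_term k : measurable_fun setT (term k).
Proof.
rewrite /term; case: (k < m)%N; apply: measurable_funM => //.
  exact: (measurable_exceed_count (fun n => n%:R)).
apply: measurable_funM => //; apply: measurable_sum => s.
exact: (measurable_exceed_count (fun n => 2 ^+ n)).
Qed.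

Let integral_long K : (\int[P]_w (long_bound K w)%:E <= 1)%E.
Proof.
under eq_integral do rewrite EFinM -sumEFin.
rewrite ge0_integralZl_EFin ?invr_ge0 //; last 2 first.
- by move=> w _; apply: sume_ge0 => s _; rewrite lee_fin.
- apply: emeasurable_sum => s; apply/measurable_EFinP.
  exact: (measurable_exceed_count (fun n => 2 ^+ n)).
rewrite ge0_integral_sum //; last first.
  move=> s; apply/measurable_EFinP; exact: (measurable_exceed_count (fun n => 2 ^+ n)).
apply: (@le_trans _ _ ((2 ^+ (c * K))^-1%:E *
   \sum_(s <- skeletons K (0 : 'rV[int]_d)) (expR (5 ^+ d * S0) ^+ K)%:E)%E).
  apply: lee_wpmul2l; first by rewrite lee_fin invr_ge0.
  rewrite big_seq [leRHS]big_seq; apply: lee_sum => s sK.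
  apply: le_trans (integral_pow2_exceed_count _ (undup_uniq _)) _.
  rewrite lee_fin -expRM_natl ler_expR.
  apply: (@le_trans _ _ (p * (K * (5 * L) ^ d)%:R)).
    apply: ler_wpM2l; first exact: tail_prob_ge0.
    rewrite ler_nat -(skeletons_size sK).
    by apply: size_skeleton_sites; rewrite /L expn_gt0.
  rewrite natrM natrX natrM exprMn mulrA [p * _]mulrC -!mulrA ler_wpM2l //.
  by rewrite mulrCA ler_wpM2l // exprn_ge0.
rewrite sumEFin big_const_seq count_predT iter_addr_0 size_skeletons.
rewrite -EFinM lee_fin -[_ *+ ((3 ^ d) ^ K)%N]mulr_natl natrX -exprMn -/B exprM.
by rewrite mulrC ler_pdivrMr ?exprn_gt0 // mul1r lerXn2r ?nnegrE // mulr_ge0 ?expR_ge0.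
Qed.

Let integral_short k : (\int[P]_w (short_bound k w)%:E <= (3 ^+ d * (2 ^+ k) ^+ d * p)%:E)%E.
Proof.
rewrite integral_exceed_count lee_fin ler_wpM2r ?tail_prob_ge0 //.
rewrite size_map -cardE card_box -exprMn -natrX -natrM -natrX ler_nat.
case: d d1 => // d' _; rewrite leq_exp2r //.
have : (0 < 2 ^ k)%N by rewrite expn_gt0.
lia.
Qed.

(** Below scale [m] the box count divided by 2^k has mean at most 3^d 2^(k (d-1)) p, bounded by its
    value at [m]: there is no geometric decay to exploit when d = 1, whence the factor [m] in the
    sum. *)
Let term_mean (k : nat) : R :=
  if (k < m)%N then 3 ^+ d * (2 ^+ m) ^+ d.-1 * p else (2 ^+ k)^-1.

Let integral_term k : (\int[P]_w (term k w)%:E <= (term_mean k)%:E)%E.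
Proof.
under eq_integral do rewrite EFinM.
rewrite ge0_integralZl_EFin ?invr_ge0 //; last 2 first.
- move=> w _; have := term_ge0 k w; rewrite /term pmulr_rge0 ?invr_gt0 ?exprn_gt0 //.
- apply/measurable_EFinP; case: (k < m)%N.
    exact: (measurable_exceed_count (fun n => n%:R)).
  apply: measurable_funM => //; apply: measurable_sum => s.
  exact: (measurable_exceed_count (fun n => 2 ^+ n)).
rewrite /term_mean; case: ifP => km; last first.
  rewrite -[leRHS]mule1; apply: lee_wpmul2l; first by rewrite lee_fin invr_ge0.
  exact: integral_long.
apply: (le_trans (lee_wpmul2l _ (integral_short k))); first by rewrite lee_fin invr_ge0.
rewrite -EFinM lee_fin.
have -> : (2 ^+ k)^-1 * (3 ^+ d * (2 ^+ k) ^+ d * p) = 3 ^+ d * (2 ^+ k) ^+ d.-1 * p.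
  by rewrite -{2}(prednK d1) [(2 ^+ k) ^+ _.+1]exprS; field; rewrite gt_eqF ?exprn_gt0.
rewrite ler_wpM2r ?tail_prob_ge0 // ler_wpM2l ?exprn_ge0 //.
rewrite lerXn2r ?nnegrE ?exprn_ge0 // ler_eXn2l //; last lra.
exact: ltnW.
Qed.

Let term_mean_sum n : \sum_(k < n) term_mean k <=
  m%:R * (3 ^+ d * (2 ^+ m) ^+ d.-1 * p) + 2 / 2 ^+ m.
Proof.
set b := 3 ^+ d * _ * p.
have b0 : 0 <= b by rewrite !mulr_ge0 ?exprn_ge0 ?tail_prob_ge0.
suff H : \sum_(k < n) term_mean k <= (minn n m)%:R * b +
    (if (n <= m)%N then 0 else 2 / 2 ^+ m - 2 / 2 ^+ n).
  apply: (le_trans H); apply: lerD.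
    by rewrite ler_wpM2r // ler_nat geq_minr.
  by case: ifP => _; rewrite ?gerBl divr_ge0 ?exprn_ge0.
elim: n => [|n IH]; first by rewrite big_ord0 min0n mul0r addr0.
rewrite big_ord_recr /= {2}/term_mean; case: ifP => nm.
  rewrite ltnW // in IH.
  rewrite (minn_idPl (ltnW nm)) addr0 in IH.
  by rewrite (minn_idPl nm) addr0 -[n.+1%:R]natr1 mulrDl mul1r lerD.
have mn : (m <= n)%N by rewrite leqNgt nm.
rewrite (minn_idPr (leqW mn)); rewrite (minn_idPr mn) in IH.
apply: (le_trans (lerD IH (lexx _))).
have E : 2 / 2 ^+ n.+1 = (2 ^+ n)^-1 :> R.
  by rewrite exprS invfM mulrA divff ?mul1r.
rewrite -addrA lerD2l E.
case: (leqP n m) => nm'.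
  have -> : n = m by apply/eqP; rewrite eqn_leq nm' mn.
  lra.
lra.
Qed.

(** One [U] serves all lengths because it sums the normalised bounds over all scales; for a path
    with n <= 2^k the term of index k alone is used. The summand c / 2^m accounts for the part c K
    of the count. *)
Lemma exceed_count_maximal : exists U : T -> \bar R,
  [/\ measurable_fun setT U, (forall w, 0 <= U w)%E,
    (\int[P]_w U w <= ((c%:R + 2) / 2 ^+ m +
       3 ^+ d * (p * (m%:R * (2 ^+ m) ^+ d.-1)))%:E)%E &
    forall w n k pi, self_avoiding_path 0 n pi -> (n <= 2 ^ k)%N ->
      (((exceed_count t pi w)%:R)%:E <= (2 ^+ k)%:E * U w)%E].
Proof.
pose V w := (\sum_(k <oo) (term k w)%:E)%E.
pose U w := ((c%:R / 2 ^+ m)%:E + V w)%E.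
have V0 w : (0 <= V w)%E by apply: nneseries_ge0 => k _ _; rewrite lee_fin.
have mV : measurable_fun setT V.
  apply: ge0_emeasurable_sum => [k w _|k _]; first by rewrite lee_fin.
  exact/measurable_EFinP.
have c0 : 0 <= (c%:R / 2 ^+ m : R) by rewrite divr_ge0 ?exprn_ge0.
exists U; split.
- exact: emeasurable_funD.
- by move=> w; rewrite adde_ge0 ?lee_fin.
- rewrite ge0_integralD //.
  rewrite integral_prob_cst.
  apply: (@le_trans _ _ ((c%:R / 2 ^+ m)%:E +
     (m%:R * (3 ^+ d * (2 ^+ m) ^+ d.-1 * p) + 2 / 2 ^+ m)%:E)%E).
    apply: leeD2l; rewrite integral_nneseries //; last first.
    + by move=> k w _; rewrite lee_fin.
    + by move=> k; exact/measurable_EFinP.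
    apply: lime_le.
      by apply: is_cvg_nneseries => k _ _; apply: integral_ge0 => w _; rewrite lee_fin.
    apply: nearW => n.
    apply: (@le_trans _ _ (\sum_(0 <= k < n) (term_mean k)%:E)%E).
      by apply: lee_sum => k _; exact: integral_term.
    by rewrite sumEFin lee_fin big_mkord; exact: term_mean_sum.
  by rewrite -EFinD lee_fin le_eqVlt; apply/orP; left; apply/eqP; ring.
move=> w n k pi hpi nk.
have termV : ((term k w)%:E <= V w)%E.
  rewrite /V (@nneseriesD1 _ (fun k => (term k w)%:E) k xpredT) //; last by move=> j _; rewrite lee_fin.
  by rewrite leeDl // nneseries_ge0 // => j _ _; rewrite lee_fin.
have /and4P[/eqP szp hd up sp] := hpi.
suff H : (exceed_count t pi w)%:R <= 2 ^+ k * (c%:R / 2 ^+ m + term k w).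
  apply: (@le_trans _ _ (2 ^+ k * (c%:R / 2 ^+ m + term k w))%:E).
    by rewrite lee_fin.
  rewrite EFinM; apply: lee_wpmul2l; first by rewrite lee_fin exprn_ge0.
  by rewrite EFinD leeD2l.
rewrite mulrDr /term; have k20 : 0 < 2 ^+ k :> R by rewrite exprn_gt0.
rewrite [2 ^+ k * (_^-1 * _)]mulVKf ?gt_eqF //.
case: ifP => km.
  apply: (@le_trans _ _ (short_bound k w)); last first.
    by rewrite lerDr mulr_ge0 ?exprn_ge0.
  rewrite ler_nat; apply: count_le_subset => // v vp.
  have [i <-] := near_pos (near_site_le nk (self_avoiding_path_near hpi vp)).
  by apply: map_f; rewrite mem_enum.
have mk : (m <= k)%N by rewrite leqNgt km.
have L0 : (0 < L)%N by rewrite expn_gt0.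
have [||||s sK sP] := @skeletons_cover d L L0 (2 ^ (k - m)) 0 0 pi.
- by apply/forallP => j; rewrite !mxE mulr0 add0r mulr1 lexx ltz_nat.
- by case: (pi) hd => //= a s /eqP[->].
- exact: sp.
- by rewrite szp /L -expnD subnK.
have sub : (exceed_count t pi w <= exceed_count t (skeleton_sites L s) w)%N.
  apply: count_le_subset => // v /sP[u us uv].
  exact: skeleton_sites_mem uv.
apply: (@le_trans _ _ (exceed_count t (skeleton_sites L s) w)%:R); first by rewrite ler_nat.
set N := exceed_count t (skeleton_sites L s) w.
set K := (2 ^ (k - m))%N.
have -> : 2 ^+ k * (c%:R / 2 ^+ m) = (c * K)%:R :> R.
  by rewrite natrM natrX -{1}(subnK mk) exprD; field; rewrite gt_eqF ?exprn_gt0.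
have long : 2 ^+ N / 2 ^+ (c * K) <= long_bound K w.
  rewrite mulrC /long_bound ler_wpM2l ?invr_ge0 ?exprn_ge0 //.
  by rewrite (big_rem s) //= lerDl sumr_ge0 // => s' _; rewrite exprn_ge0.
apply: le_trans (lerD (lexx _) long).
have [NcK|cKN] := leqP N (c * K).
  by rewrite -[leLHS]addr0 lerD ?ler_nat // divr_ge0 ?exprn_ge0.
rewrite -{1}(subnKC (ltnW cKN)) natrD lerD2l.
rewrite -{2}(subnK (ltnW cKN)) exprD mulfK ?gt_eqF ?exprn_gt0 //.
by rewrite -natrX ler_nat ltnW // ltn_expl.
Qed.

End Maximal.
End Counting.

(* [2 ^ layer_exp i] is, up to a constant, [i ^ (1 + b)]; being constant on
   dyadic blocks of [i] makes the summability of its inverse a geometric sum. *)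
Section LayerExponent.
Variables (R : realType) (b : R).
Hypothesis b0 : 0 < b.

Definition layer_exp (i : nat) : nat := Num.truncn ((1 + b) * (trunc_log 2 i)%:R).

Let arg_ge0 i : 0 <= (1 + b) * (trunc_log 2 i)%:R.
Proof. by rewrite mulr_ge0 // addr_ge0 ?ltW. Qed.

Lemma layer_exp_le d i : (0 < i)%N ->
  ((2 : R) ^+ layer_exp i) ^+ d <= i%:R `^ (d%:R * (1 + b)).
Proof.
move=> i0; rewrite -exprM -powR_mulrn // natrM.
apply: (@le_trans _ _ (2 `^ ((trunc_log 2 i)%:R * (d%:R * (1 + b))))).
  apply: ler_powR; first lra.
  rewrite [_ * (d%:R * _)]mulrC -mulrA [leRHS]mulrC [_ * d%:R]mulrC.
  rewrite [leRHS]mulrC ler_wpM2l //.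
  by have /andP[] := truncn_itv (arg_ge0 i).
rewrite powRrM powR_mulrn //.
apply: ge0_ler_powR; rewrite ?nnegrE ?exprn_ge0 //.
  by rewrite mulr_ge0 // addr_ge0 ?ltW.
by rewrite -natrX ler_nat trunc_logP.
Qed.

Lemma layer_exp_ge i :
  (2 ^+ layer_exp i)^-1 <= 2 * (2 ^+ trunc_log 2 i)^-1 * (2 `^ (- b)) ^+ trunc_log 2 i :> R.
Proof.
set j := trunc_log 2 i.
have h : (1 + b) * j%:R <= (layer_exp i).+1%:R.
  by apply/ltW/truncnS_gt.
have : 2 `^ ((1 + b) * j%:R) <= 2 `^ (layer_exp i).+1%:R :> R.
  by apply: ler_powR => //; lra.
rewrite powR_mulrn // exprS mulrDl mul1r powRD; last by apply/implyP.
rewrite powR_mulrn // powRrM powR_mulrn ?powR_ge0 // powRN exprVn => h'.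
rewrite -mulrA -invfM -ler_pdivrMl // -invfM lef_pV2 ?posrE ?mulr_gt0 ?exprn_gt0 ?powR_gt0 //.
Qed.

(** Bounds the linear factor [m] of the maximal inequality after division by [2 ^+ layer_exp i]. *)
Lemma layer_exp_ratio i : i%:R / 2 ^+ layer_exp i <= 4 :> R.
Proof.
have h := layer_exp_ge i.
apply: (@le_trans _ _ (i%:R * (2 * (2 ^+ trunc_log 2 i)^-1 * 1))).
  rewrite ler_wpM2l //; apply: (le_trans h); rewrite ler_wpM2l //.
  apply: exprn_ile1; first exact: powR_ge0.
  rewrite powRN invf_le1 ?powR_gt0 //.
  have : 2 `^ 0 <= 2 `^ b :> R by apply: ler_powR; [lra | exact: ltW].
  by rewrite powRr0.
rewrite mulr1 mulrCA.
have : i%:R <= 2 * 2 ^+ trunc_log 2 i :> R.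
  by rewrite -exprS -natrX ler_nat ltnW // trunc_log_ltn.
have p0 : 0 < 2 ^+ trunc_log 2 i :> R by rewrite exprn_gt0.
by rewrite -ler_pdivrMr // => ?; lra.
Qed.

Lemma layer_exp_sum : exists B : R, forall N, \sum_(1 <= i < N) (2 ^+ layer_exp i)^-1 <= B.
Proof.
set rho : R := 2 `^ (- b).
have r0 : 0 <= rho by exact: powR_ge0.
have r1 : rho < 1.
  rewrite /rho powRN invf_lt1 ?powR_gt0 //.
  rewrite -[ltLHS](congr1 (fun f => f b) (powR1 R)).
  by apply: gt0_ltr_powR; rewrite ?nnegrE //; lra.
have step J : \sum_(1 <= i < 2 ^ J) (2 ^+ layer_exp i)^-1 <= \sum_(j < J) 2 * rho ^+ j.
  elim: J => [|J IH]; first by rewrite expn0 big_geq // big_ord0.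
  rewrite (@big_cat_nat _ _ _ (2 ^ J)%N) ?expn_gt0 //=; last by rewrite leq_exp2l.
  rewrite big_ord_recr /=; apply: lerD => //.
  apply: (@le_trans _ _ (\sum_(2 ^ J <= i < 2 ^ J.+1) 2 * (2 ^+ J)^-1 * rho ^+ J)).
    rewrite big_nat [leRHS]big_nat; apply: ler_sum => i iJ.
    by rewrite -(trunc_log_eq (isT : 1 < 2)%N iJ); exact: layer_exp_ge.
  rewrite sumr_const_nat -[_ *+ _]mulr_natl expnS mul2n -addnn addnK natrX.
  by rewrite !mulrA [2 ^+ J * 2]mulrC mulfK ?gt_eqF ?exprn_gt0.
have geo J : \sum_(j < J) 2 * rho ^+ j = 2 * (1 - rho ^+ J) / (1 - rho).
  elim: J => [|J IH]; first by rewrite big_ord0 subrr mulr0 mul0r.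
  by rewrite big_ord_recr /= IH exprS; field; rewrite subr_eq0 gt_eqF.
exists (2 / (1 - rho)) => N.
apply: (@le_trans _ _ (\sum_(1 <= i < 2 ^ N) (2 ^+ layer_exp i)^-1)).
  have [N1|N1] := leqP N 1.
    by rewrite big_geq // sumr_ge0 // => i _; rewrite invr_ge0 exprn_ge0.
  rewrite [leRHS](@big_cat_nat _ _ _ N) //=; [|exact: ltnW|by rewrite ltnW // ltn_expl].
  by rewrite lerDl sumr_ge0 // => i _; rewrite invr_ge0 exprn_ge0.
apply: (le_trans (step N)); rewrite geo ler_wpM2r ?invr_ge0 ?subr_ge0 ?(ltW r1) //.
by rewrite ler_piMr // gerBl exprn_ge0.
Qed.

End LayerExponent.

(** * Dyadic layers and the logarithmic moment *)

Section Layers.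
Context disp (T : measurableType disp) (R : realType) (P : probability T R).
Variables (d : nat) (X : 'rV[int]_d -> {RV P >-> R}).
Hypotheses (d1 : (1 <= d)%N)
  (Xind : mutually_independent X) (Xid : identically_distributed X).
Variable alpha : R.
Hypothesis alpha0 : 0 < alpha.

Let g : R := d%:R + alpha.
Let g_gt0 : 0 < g. Proof. by rewrite ltr_wpDl. Qed.
(** Chosen so that d (1 + b) is the logarithmic exponent d + alpha: the moment then exactly pays for
    [(2 ^+ layer_exp i) ^+ d], while b > 0 makes the inverses summable. *)
Let b : R := alpha / d%:R.
Let dR : 0 < d%:R :> R. Proof. by rewrite ltr0n. Qed.
Let b0 : 0 < b. Proof. by rewrite divr_gt0. Qed.
Let gE : g = d%:R * (1 + b).
Proof. by rewrite /g /b; field; rewrite gt_eqF. Qed.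

Definition log_moment (x : R) : R := Num.max x 0 ^+ d * log_plus (Num.max x 0) `^ g.

Lemma geometric_below (x : R) N :
  \sum_(i < N) (2 ^+ i) ^+ d * (2 ^+ i < x)%R%:R <= 2 * Num.max x 0 ^+ d.
Proof.
elim: N => [|N IH].
  by rewrite big_ord0 mulr_ge0 // exprn_ge0 // le_max lexx orbT.
rewrite big_ord_recr /=; have [Nx|xN] := boolP (2 ^+ N < x); last first.
  by rewrite mulr0 addr0.
rewrite mulr1.
have H n : \sum_(i < n) ((2 : R) ^+ i) ^+ d * (2 ^+ i < x)%R%:R <= (2 ^+ n) ^+ d.
  elim: n => [|n IHn]; first by rewrite big_ord0 exprn_ge0.
  rewrite big_ord_recr /=; apply: (@le_trans _ _ ((2 ^+ n) ^+ d + (2 ^+ n) ^+ d)).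
    by apply: lerD => //; rewrite ler_piMr ?exprn_ge0 // lern1 leq_b1.
  rewrite exprS exprMn -[leLHS]mulr2n -[leLHS]mulr_natl ler_wpM2r ?exprn_ge0 //.
  by rewrite -[leLHS]expr1 ler_eXn2l //; lra.
apply: (le_trans (lerD (H N) (lexx _))); rewrite -[leLHS]mulr2n -[leLHS]mulr_natl ler_wpM2l //.
rewrite lerXn2r ?nnegrE ?exprn_ge0 // ?le_max ?lexx ?orbT //.
by rewrite (ltW Nx).
Qed.

(** On 2^i < x the factor (i ln 2)^g is at most the power of the logarithm of x, which comes out of
    the sum; the remaining geometric sum is dominated by its largest term. *)
Lemma log_moment_ge (x : R) N :
  \sum_(i < N) (2 ^+ i) ^+ d * (i%:R * ln 2) `^ g * (2 ^+ i < x)%R%:R <=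
  2 * log_moment x.
Proof.
rewrite /log_moment mulrA.
apply: (@le_trans _ _ ((\sum_(i < N) (2 ^+ i) ^+ d * (2 ^+ i < x)%R%:R) *
    log_plus (Num.max x 0) `^ g)); last first.
  by rewrite ler_wpM2r ?powR_ge0 // geometric_below.
rewrite mulr_suml; apply: ler_sum => i _; rewrite mulrAC.
have [ix|] := boolP (2 ^+ i < x); last by rewrite !mulr0 !mul0r.
rewrite mulr1 ler_wpM2l ?exprn_ge0 //.
have i0 : 0 < 2 ^+ i :> R by rewrite exprn_gt0.
have x0 : 0 < x by exact: lt_trans ix.
have l2 : 0 <= i%:R * ln 2 :> R by rewrite mulr_ge0 // ln_ge0 // ler1n.
have il : i%:R * ln 2 <= ln x.
  rewrite mulr_natl -lnXn // ler_ln ?posrE // ltW //.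
have mE : Num.max x 0 = x by apply: max_l; exact: ltW.
apply: ge0_ler_powR; rewrite ?nnegrE ?(ltW g_gt0) //.
  by rewrite /log_plus le_max lexx orbT.
by rewrite mE /log_plus le_max il.
Qed.

Section Envelope.
Variable Q : R.
Hypothesis Q_ge : (\int[P]_w (log_moment (X 0 w))%:E <= Q%:E)%E.

Let p i := tail_prob X (2 ^+ i).
Let s i : R := (2 ^+ i) ^+ d * i%:R `^ g * p i.

Let p_ge0 i : 0 <= p i. Proof. exact: tail_prob_ge0. Qed.
Let s_ge0 i : 0 <= s i.
Proof. by rewrite !mulr_ge0 ?exprn_ge0 ?powR_ge0. Qed.

Let measurable_log_moment : measurable_fun setT log_moment.
Proof.
have mm : measurable_fun setT (fun x : R => Num.max x 0).
  by apply: measurable_maxr => //; exact: measurable_id.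
apply: measurable_funM; first exact: measurable_funX.
apply: (@measurableT_comp _ _ _ _ _ _ (@powR R ^~ g)).
  exact: measurable_powR.
apply: measurable_maxr => //.
exact: measurableT_comp.
Qed.

Let Q' : R := 2 * Q / ln 2 `^ g.

Let ln2_gt0 : 0 < ln 2 :> R.
Proof. by rewrite ln_gt0 // ltr1n. Qed.

Lemma layer_tail_sum N : \sum_(i < N) s i <= Q'.
Proof.
rewrite /Q' ler_pdivlMr ?powR_gt0 // mulr_suml.
have lm0 x : 0 <= log_moment x.
  by rewrite mulr_ge0 ?powR_ge0 // exprn_ge0 // le_max lexx orbT.
have mi i : measurable (X 0 @^-1` [set t | 2 ^+ i < t]).
  apply: measurable_site_preimage.
  by rewrite -set_itvoy; exact: measurable_itv.
pose c i : R := (2 ^+ i) ^+ d * (i%:R * ln 2) `^ g.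
have c0 i : 0 <= c i by rewrite mulr_ge0 ?powR_ge0 ?exprn_ge0.
have : (\int[P]_w (\sum_(i < N) c i * \1_(X 0 @^-1` [set t | 2 ^+ i < t]) w)%:E <=
    (2 * Q)%:E)%E.
  apply: (@le_trans _ _ (\int[P]_w (2%:E * (log_moment (X 0 w))%:E))%E).
    apply: ge0_le_integral => //.
    - by move=> w _; rewrite lee_fin sumr_ge0 // => i _; rewrite mulr_ge0.
    - apply/measurable_EFinP; apply: measurable_sum => i.
      by apply: measurable_funM => //; exact: measurable_indic.
    - apply: emeasurable_funM => //; apply/measurable_EFinP.
      exact: (measurable_site_comp X).
    - move=> w _; rewrite -EFinM lee_fin; apply: le_trans (log_moment_ge _ N).
      rewrite le_eqVlt; apply/orP; left; apply/eqP; apply: eq_bigr => i _.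
      rewrite indicE; congr (_ * (nat_of_bool _)%:R).
      by apply/idP/idP => [/set_mem //|h]; exact/mem_set.
  rewrite ge0_integralZl_EFin //; last 2 first.
  - by move=> w _; rewrite lee_fin.
  - apply/measurable_EFinP; exact: (measurable_site_comp X).
  by rewrite EFinM; apply: lee_wpmul2l.
under eq_integral do rewrite -sumEFin.
rewrite ge0_integral_sum //; last 2 first.
- by move=> i; apply/measurable_EFinP; apply: measurable_funM => //; exact: measurable_indic.
- by move=> i w _; rewrite lee_fin mulr_ge0.
rewrite (eq_bigr (fun i : 'I_N => (s i * ln 2 `^ g)%:E)).
  by rewrite sumEFin lee_fin.
move=> i _; under eq_integral do rewrite EFinM.
rewrite ge0_integralZl_EFin //; try (by apply/measurable_EFinP; exact: measurable_indic).
rewrite integral_indic // setIT [X in (_ * X)%E](tail_probE Xid (2 ^+ i) 0) -EFinM /c /s.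
by rewrite powRM ?ler0n ?(ltW ln2_gt0) // -/(p i); congr EFin; ring.
Qed.

Lemma layer_envelopes : exists (V : nat -> T -> \bar R) (W : R),
  [/\ forall i, measurable_fun setT (V i), forall i w, (0 <= V i w)%E,
    forall N, (\sum_(i < N) \int[P]_w V i w <= W%:E)%E &
    forall i w n pi, self_avoiding_path 0 n pi -> (0 < n)%N ->
      ((2 ^+ i.+2 * (exceed_count X (2 ^+ i.+1) pi w)%:R)%:E <= n%:R%:E * V i w)%E].
Proof.
(* The scale 2^(m i) exceeds the level 2^(i+1) by the factor [2 ^+ layer_exp]: enough for 2^i / 2^(m
   i) to be summable, while the logarithmic moment still bounds p 2^(m d) uniformly in i. *)
pose m i := (i.+1 + layer_exp b i.+1)%N.
have sQ i : s i <= Q'.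
  apply: le_trans (layer_tail_sum i.+1); rewrite big_ord_recr /= lerDr.
  exact: sumr_ge0.
have ps i : p i.+1 * (2 ^+ m i) ^+ d <= s i.+1.
  rewrite /m exprD exprMn /s [leLHS]mulrC ler_wpM2r // ler_wpM2l ?exprn_ge0 //.
  by rewrite gE; exact: layer_exp_le.
pose A : R := (Num.bound ((3 ^ d)%:R * expR (5 ^+ d * Q')))%:R.
have /choice[U HU] : forall i, exists U : T -> \bar R,
    [/\ measurable_fun setT U, (forall w, 0 <= U w)%E,
    (\int[P]_w U w <= ((A + 2) / 2 ^+ m i +
       3 ^+ d * (p i.+1 * ((m i)%:R * (2 ^+ m i) ^+ d.-1)))%:E)%E &
    forall w n k pi, self_avoiding_path 0 n pi -> (n <= 2 ^ k)%N ->
      (((exceed_count X (2 ^+ i.+1) pi w)%:R)%:E <= (2 ^+ k)%:E * U w)%E].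
  move=> i; apply: exceed_count_maximal => //.
  by rewrite natrX; apply: le_trans (ps i) (sQ _).
have [B HB] := layer_exp_sum b0.
(* One factor 2 more than in the weight 2^(i+2), since the power of two chosen above n may be as
   large as 2 n. *)
exists (fun i w => (2 ^+ i.+3)%:E * U i w)%E.
exists (4 * ((A + 2) * B + 3 ^+ d * 5 * Q')).
split.
- by move=> i; apply: emeasurable_funM => //; have [] := HU i.
- by move=> i w; apply: mule_ge0; rewrite ?lee_fin ?exprn_ge0 //; have [_ ->] := HU i.
- move=> N.
  have iV i : (\int[P]_w ((2 ^+ i.+3)%:E * U i w) <=
      (4 * ((A + 2) * (2 ^+ layer_exp b i.+1)^-1 + 3 ^+ d * 5 * s i.+1))%:E)%E.
    have [mU U0 IU _] := HU i.
    rewrite ge0_integralZl_EFin ?exprn_ge0 //.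
    apply: (le_trans (lee_wpmul2l _ IU)); first by rewrite lee_fin exprn_ge0.
    rewrite -EFinM lee_fin.
    set l := layer_exp b i.+1.
    have l2 : 0 < 2 ^+ l :> R by rewrite exprn_gt0.
    have i2 : 0 < 2 ^+ i.+1 :> R by rewrite exprn_gt0.
    have m2 : 0 < 2 ^+ m i :> R by rewrite exprn_gt0.
    have ml : 2 ^+ m i = 2 ^+ i.+1 * 2 ^+ l :> R by rewrite /m exprD.
    have E3 : 2 ^+ i.+3 = 4 * 2 ^+ i.+1 :> R by rewrite !exprS; ring.
    rewrite E3 -[leLHS]mulrA ler_wpM2l // mulrDr; apply: lerD.
      by rewrite ml invfM mulrCA [_ * (_^-1 * _)]mulrA divff ?gt_eqF // mul1r.
    have -> : 2 ^+ i.+1 * (3 ^+ d * (p i.+1 * ((m i)%:R * 2 ^+ m i ^+ d.-1))) =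
       3 ^+ d * ((p i.+1 * (2 ^+ m i) ^+ d) * ((m i)%:R / 2 ^+ l)).
      have -> : (2 ^+ m i) ^+ d = 2 ^+ m i * (2 ^+ m i) ^+ d.-1 :> R.
        by rewrite -exprS prednK.
      set z := _ ^+ d.-1; rewrite ml; move: l2; set y := 2 ^+ l => l2.
      by field; rewrite gt_eqF.
    rewrite -[leRHS]mulrA ler_wpM2l ?exprn_ge0 // [leRHS]mulrC.
    apply: ler_pM => //.
    - by rewrite mulr_ge0 ?exprn_ge0.
    (* The constant 5 is 4 from the index i + 1 plus 1 from the layer exponent l, each divided by
       2^l. *)
    rewrite /m natrD mulrDl.
    have h1 := @layer_exp_ratio R b b0 i.+1.
    have h2 : l%:R / 2 ^+ l <= 1 :> R.
      by rewrite ler_pdivrMr // mul1r -natrX ler_nat ltnW // ltn_expl.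
    by rewrite -/l in h1; lra.
  apply: (@le_trans _ _ (\sum_(i < N)
     (4 * ((A + 2) * (2 ^+ layer_exp b i.+1)^-1 + 3 ^+ d * 5 * s i.+1))%:E)%E).
    by apply: lee_sum => i _; exact: iV.
  rewrite sumEFin lee_fin -mulr_sumr ler_wpM2l // big_split /= -!mulr_sumr.
  apply: lerD; apply: ler_wpM2l.
  - by rewrite addr_ge0.
  - by have := HB N.+1; rewrite big_add1 /= big_mkord.
  - by rewrite mulr_ge0 ?exprn_ge0.
  have := layer_tail_sum N.+1; rewrite big_ord_recl /=; apply: le_trans.
  by rewrite lerDr.
move=> i w n pi hpi n0; have [_ U0 _ HC] := HU i.
have [k [nk kn]] : exists k, (n <= 2 ^ k)%N /\ (2 ^ k <= n.*2)%N.
  exists (up_log 2 n); split; first exact: up_logP.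
  have [n1|n1] := leqP n 1.
    by have -> : n = 1%N by [apply/eqP; rewrite eqn_leq n1]; rewrite up_log1.
  have /andP[h _] := up_log_bounds (isT : 1 < 2)%N n1.
  have : (0 < up_log 2 n)%N by rewrite up_log_gt0 n1.
  by case: (up_log 2 n) h => // k /=; rewrite expnS; lia.
rewrite EFinM; apply: (@le_trans _ _ ((2 ^+ i.+2)%:E * ((2 ^+ k)%:E * U i w))%E).
  by apply: lee_wpmul2l; [rewrite lee_fin exprn_ge0 | exact: (HC _ _ _ _ hpi nk)].
rewrite !muleA -!EFinM; apply: lee_wpmul2r => //.
rewrite lee_fin [2 ^+ i.+3]exprS mulrA [leRHS]mulrC ler_wpM2l ?exprn_ge0 //.
by rewrite -natrX -natrM ler_nat muln2.
Qed.

End Envelope.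
End Layers.

Section LayerSum.
Variable R : realType.

(** A single term suffices: the highest level with 2^(i+1) < x satisfies x <= 2^(i+2). *)
Lemma layer_sum_ge (x : R) r N : x <= 2 ^+ N.+1 ->
  (if 2 ^+ r.+1 < x then x else 0) <=
  \sum_(r <= i < N) 2 ^+ i.+2 * (2 ^+ i.+1 < x)%R%:R.
Proof.
have S0 n : 0 <= \sum_(r <= i < n) 2 ^+ i.+2 * (2 ^+ i.+1 < x)%R%:R.
  by apply: sumr_ge0 => i _; rewrite mulr_ge0 ?exprn_ge0.
case: ifP => [rx|_ _]; last exact: S0.
elim: N => [|N IH] xN.
  have : 2 ^+ 1 <= 2 ^+ r.+1 :> R by rewrite ler_eXn2l //; lra.
  by move=> /(le_trans xN); rewrite leNgt rx.
have rN : (r <= N)%N.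
  rewrite leqNgt; apply/negP => Nr.
  have : 2 ^+ N.+2 <= 2 ^+ r.+1 :> R by rewrite ler_eXn2l //; lra.
  by move=> /(le_trans xN); rewrite leNgt rx.
rewrite big_nat_recr //=; have [/IH h|Nx] := leP x (2 ^+ N.+1).
  by rewrite -[leLHS]addr0 lerD // mulr0.
by rewrite mulr1 -[leLHS]add0r lerD ?S0.
Qed.

End LayerSum.

(** * A common envelope for the values above a level *)

Section TailEnvelope.
Context disp (T : measurableType disp) (R : realType) (P : probability T R).
Variables (d : nat) (X : 'rV[int]_d -> {RV P >-> R}).
Variables (V : nat -> T -> \bar R) (W : R).
Hypotheses (mV : forall i, measurable_fun setT (V i))
  (V0 : forall i w, (0 <= V i w)%E)
  (VW : forall N, (\sum_(i < N) \int[P]_w V i w <= W%:E)%E)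
  (VX : forall i w n pi, self_avoiding_path 0 n pi -> (0 < n)%N ->
      ((2 ^+ i.+2 * (exceed_count X (2 ^+ i.+1) pi w)%:R)%:E <= n%:R%:E * V i w)%E).

Definition tail_env (r : nat) (w : T) : \bar R := (\sum_(r <= i <oo) V i w)%E.

Lemma tail_env_ge0 r w : (0 <= tail_env r w)%E.
Proof. by apply: nneseries_ge0 => i _ _. Qed.

Let total (w : T) : \bar R := (\sum_(i <oo) V i w)%E.

Lemma measurable_tail_env r : measurable_fun setT (tail_env r).
Proof.
rewrite (_ : tail_env r = fun w => (\sum_(i <oo) V (i + r)%N w)%E).
  by apply: ge0_emeasurable_sum => [k w _ _|k _].
by apply/funext => w; rewrite /tail_env -(@nneseries_addn _ (V ^~ w) r).
Qed.

Lemma integral_tail_env r :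
  (\int[P]_w tail_env r w = \sum_(r <= i <oo) \int[P]_w V i w)%E.
Proof.
have IV i : (0 <= \int[P]_w V i w)%E by apply: integral_ge0.
rewrite -(@nneseries_addn _ (fun i => \int[P]_w V i w)%E) // -integral_nneseries //.
by apply: eq_integral => w _; rewrite /tail_env -(@nneseries_addn _ (V ^~ w) r).
Qed.

Let series_lty : (\sum_(i <oo) \int[P]_w V i w < +oo)%E.
Proof.
apply: le_lt_trans (ltry W); apply: lime_le.
  by apply: is_cvg_nneseries => k _ _; exact: integral_ge0.
by apply: nearW => n; rewrite big_mkord; exact: VW.
Qed.

Lemma integral_tail_env_cvg0 : (\int[P]_w tail_env r w)%E @[r --> \oo] --> 0%E.
Proof.
under eq_cvg do rewrite integral_tail_env.
by apply: nneseries_tail_cvg => // k _; exact: integral_ge0.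
Qed.

Lemma ae_tail_env_cvg0 : {ae P, forall w, tail_env r w @[r --> \oo] --> 0%E}.
Proof.
have it : P.-integrable setT total.
  apply/integrableP; split; first exact: ge0_emeasurable_sum.
  rewrite (eq_integral total); last first.
    by move=> w _; rewrite gee0_abs // nneseries_ge0.
  by rewrite integral_nneseries.
have := integrable_ae measurableT it.
apply: filterS => w /(_ Logic.I) tf.
apply: nneseries_tail_cvg => //; rewrite -ge0_fin_numE //.
exact: nneseries_ge0.
Qed.

Lemma path_tail_le r w n pi : self_avoiding_path 0 n pi -> (0 < n)%N ->
  ((\sum_(v <- pi) if 2 ^+ r.+1 < X v w then X v w else 0)%:E <=
   n%:R%:E * tail_env r w)%E.
Proof.
move=> hpi n0.
pose N := Num.bound (\sum_(v <- pi) `|X v w|).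
have XN v : v \in pi -> X v w <= 2 ^+ N.+1.
  move=> vpi; apply: (le_trans (ler_norm _)).
  apply: (@le_trans _ _ (\sum_(v <- pi) `|X v w|)).
    by rewrite (big_rem v) //= lerDl sumr_ge0.
  apply: (@le_trans _ _ N%:R).
    by apply/ltW/archi_boundP; exact: sumr_ge0.
  by rewrite -natrX ler_nat ltnW // (leq_trans (ltn_expl N (isT : 1 < 2)%N)) // leq_exp2l.
apply: (@le_trans _ _ (\sum_(r <= i < N)
    (2 ^+ i.+2 * (exceed_count X (2 ^+ i.+1) pi w)%:R)%:E)%E).
  rewrite sumEFin lee_fin.
  apply: (@le_trans _ _ (\sum_(v <- pi) \sum_(r <= i < N)
      2 ^+ i.+2 * (2 ^+ i.+1 < X v w)%R%:R)).
    by rewrite big_seq [leRHS]big_seq; apply: ler_sum => v /XN; exact: layer_sum_ge.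
  rewrite exchange_big /= le_eqVlt; apply/orP; left; apply/eqP.
  apply: eq_bigr => i _; rewrite -mulr_sumr; congr (_ * _).
  rewrite /exceed_count; elim: (pi) => [|v s IH]; first by rewrite big_nil.
  by rewrite big_cons IH /= natrD.
apply: (@le_trans _ _ (\sum_(r <= i < N) (n%:R%:E * V i w))%E).
  by apply: lee_sum => i _; exact: VX.
rewrite -ge0_sume_distrr //; apply: lee_wpmul2l; first by rewrite lee_fin.
exact: nneseries_lim_ge.
Qed.

End TailEnvelope.

(** * Measurability of the maximum and limits along squares *)

Section MaxMeasurable.
Context disp (T : measurableType disp) (R : realType).
Variables (d : nat) (x : 'rV[int]_d -> T -> R).
Hypotheses (d1 : (1 <= d)%N) (mx : forall v, measurable_fun setT (x v)).

Lemma measurable_greedy_path_max n : (0 < n)%N ->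
  measurable_fun setT (fun w => greedy_path_max (fun v => x v w) n).
Proof.
move=> n0.
have [s /seteqP[s1 s2]] := (finite_seqP _).1 (@self_avoiding_path_finite d n 0).
have [p0 hp0] := self_avoiding_path_exists d1 n0.
have mS p : measurable_fun setT (fun w => path_sum (fun v => x v w) p).
  exact: measurable_sum.
rewrite (_ : (fun _ => _) = fun w =>
    foldr (fun p m => Num.max (path_sum (fun v => x v w) p) m)
      (path_sum (fun v => x v w) p0) s).
  by elim: (s) => [|p s' IH] //=; exact: measurable_maxr.
apply/funext => w.
have [[q hq qE] qmax] := greedy_path_max_attained (fun v => x v w) d1 n0.
apply/eqP; rewrite eq_le; apply/andP; split.
  rewrite qE; have : q \in s by exact: s1.
  elim: (s) => // p s' IH; rewrite inE => /orP[/eqP ->|/IH h] /=.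
    by rewrite le_max lexx.
  by rewrite le_max h orbT.
have : {subset s <= [pred p | self_avoiding_path 0 n p]} by move=> p /s2.
elim: (s) => [|p s' IH] sub /=; first exact: qmax.
rewrite ge_max qmax; last by apply: sub; rewrite mem_head.
by apply: IH => p' p's; apply: sub; rewrite inE p's orbT.
Qed.

End MaxMeasurable.

(** At length (k+1)^2 the second moment of the normalised variable is at most B / (k+1)^2, which is
    summable. *)
Lemma ae_square_cvg0 disp (T : measurableType disp) (R : realType)
    (P : probability T R) (D : nat -> T -> R) (B : R) :
  (forall n, (0 < n)%N -> measurable_fun setT (D n)) ->
  (forall n, (0 < n)%N -> \int[P]_w (D n w ^+ 2)%:E <= (B * n%:R)%:E)%E ->
  {ae P, forall w, D (k.+1 ^ 2)%N w / (k.+1 ^ 2)%:R @[k --> \oo] --> 0}.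
Proof.
move=> mD HB; have k0 k : (0 < k.+1 ^ 2)%N by rewrite expn_gt0.
apply: (@ae_cvg0_of_sum_sqr _ _ _ P (fun k w => D (k.+1 ^ 2)%N w / (k.+1 ^ 2)%:R)
  (fun k => B * k.+1%:R ^- 2) (`|B| * 2)) => [k|k|n].
- by apply: measurable_funM => //; exact: mD.
- rewrite (eq_integral (fun w => ((k.+1 ^ 2)%:R ^- 2)%:E *
      (D (k.+1 ^ 2)%N w ^+ 2)%:E)%E); last first.
    by move=> w _; rewrite -EFinM expr_div_n mulrC.
  rewrite ge0_integralZl_EFin ?invr_ge0 ?exprn_ge0 //; last 2 first.
  - by move=> w _; rewrite lee_fin sqr_ge0.
  - by apply/measurable_EFinP; apply: measurable_funX; exact: mD.
  apply: (le_trans (lee_wpmul2l _ (HB _ (k0 k)))).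
    by rewrite lee_fin invr_ge0 exprn_ge0.
  rewrite -EFinM lee_fin natrX le_eqVlt; apply/orP; left; apply/eqP.
  have : 0 < k.+1%:R :> R by []; set z := k.+1%:R => z0.
  by field; rewrite gt_eqF.
rewrite -mulr_sumr; apply: (@le_trans _ _ (`|B| * \sum_(k < n) k.+1%:R ^- 2)).
  apply: ler_wpM2r; last exact: ler_norm.
  by apply: sumr_ge0 => k _; rewrite invr_ge0 exprn_ge0.
by rewrite ler_wpM2l // sum_inv_sqr_le.
Qed.

Section LabelAlmostSure.
Context disp (T : measurableType disp) (R : realType) (P : probability T R).
Variables (d : nat) (X : 'rV[int]_d -> {RV P >-> R}).
Hypotheses (d1 : (1 <= d)%N)
  (Xind : mutually_independent X) (Xid : identically_distributed X).
Variables (C : finType) (cl : R -> C).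
Hypothesis mcl : forall c, measurable (cl @^-1` [set c]).
Variables (y : C -> R) (c0 : C).
Hypothesis y_min : forall c, y c0 <= y c.

Let D : R := 2 * \sum_c `|y c|.

Let D_ge c : y c - y c0 <= D.
Proof.
have h c' := @ler_sum_term R C (fun c => `|y c|) (fun _ => normr_ge0 _) c'.
apply: (le_trans (ler_norm _)); apply: (le_trans (ler_normB _ _)).
by rewrite /D mulr_natl mulr2n lerD.
Qed.

Lemma label_mean_cvg : exists L : R,
  mean_max X cl y n / n%:R @[n --> \oo] --> L.
Proof. exact: (mean_max_cvg d1 Xind Xid mcl y_min D_ge). Qed.

Lemma label_max_L2 : exists B : R, forall n, (0 < n)%N ->
  (\int[P]_w ((label_max X cl y n 0 w - mean_max X cl y n) ^+ 2)%:E <= (B * n%:R)%:E)%E.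
Proof.
exists (D ^+ 2) => n n0.
exact: (label_max_variance d1 Xind Xid mcl y_min D_ge).
Qed.

Lemma ae_label_max_square (L : R) : mean_max X cl y n / n%:R @[n --> \oo] --> L ->
  {ae P, forall w, label_max X cl y (k.+1 ^ 2) 0 w / (k.+1 ^ 2)%:R @[k --> \oo] --> L}.
Proof.
move=> cL; have [B HB] := label_max_L2.
have := @ae_square_cvg0 _ _ _ P
  (fun n w => label_max X cl y n 0 w - mean_max X cl y n) B _ HB.
have mY n : (0 < n)%N ->
    measurable_fun setT (fun w => label_max X cl y n 0 w - mean_max X cl y n).
  by move=> n0; apply: measurable_funB => //; exact: label_max_measurable.
move=> /(_ mY).
apply: filterS => w cY.
have cLs : mean_max X cl y (k.+1 ^ 2) / (k.+1 ^ 2)%:R @[k --> \oo] --> L.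
  apply: (@cvg_comp _ _ _ (fun k => k.+1 ^ 2)%N (fun n => mean_max X cl y n / n%:R) _ \oo) => //.
  move=> A [N _ HN]; exists N => // k /= Nk; apply: HN => /=; nia.
rewrite -[L]add0r.
under eq_cvg => k do rewrite -[label_max _ _ _ _ _ _](subrK (mean_max X cl y (k.+1 ^ 2))) mulrDl.
exact: cvgD.
Qed.

End LabelAlmostSure.

(** * Truncation and discretisation *)

Section Discretisation.
Variables (R : realType) (r : nat).

Definition cut : R := 2 ^+ r.+1.

(** The interval from -cut to cut has length 2^(r+2); at mesh 2^-r it splits into 2^(2r+2) cells. *)
Definition ncell : nat := 2 ^ (r.+1).*2.

(* Cell 0 is the half-line below [- cut]; the cells 1, ..., ncell + 1 start at
   the points [- cut + k / 2 ^ r], the last one being unbounded. *)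
Definition cell_nat (x : R) : nat :=
  if x < - cut then 0%N else (minn (Num.truncn ((x + cut) * 2 ^+ r)) ncell).+1.

Definition cell_of (x : R) : 'I_ncell.+2 := inord (cell_nat x).

(** The value [a] of the lowest cell is left free because two choices are made below: [- cut], and
    the conditional mean of the field on that cell. *)
Definition cell_val (a : R) (j : 'I_ncell.+2) : R :=
  if j == ord0 then a else - cut + (j.-1)%:R / 2 ^+ r.

Lemma cut_gt0 : 0 < cut. Proof. by rewrite exprn_gt0. Qed.

Lemma cell_ofE x : cell_of x = cell_nat x :> nat.
Proof. by rewrite inordK // /cell_nat; case: ifP => // _; rewrite !ltnS geq_minr. Qed.

Lemma cell_of0 x : (cell_of x == ord0) = (x < - cut).
Proof. by rewrite -val_eqE /= cell_ofE /cell_nat; case: ifP. Qed.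

Lemma measurable_cell c : measurable (cell_of @^-1` [set c]).
Proof.
pose F (x : R) : R := (cell_nat x)%:R.
have mF : measurable_fun setT F.
  (* Measurability of the cells comes from the monotonicity of the cell number. *)
  apply: nondecreasing_measurable => // x x' xx'; rewrite ler_nat /cell_nat.
  case: ifP => // /negbT; rewrite -leNgt => cx.
  rewrite ltNge (le_trans cx xx') /= ltnS leq_min geq_minr andbT.
  apply: (leq_trans (geq_minl _ _)); apply: le_truncn.
  by rewrite ler_wpM2r ?exprn_ge0 // lerD2r.
have -> : cell_of @^-1` [set c] = setT `&` F @^-1` [set (c : nat)%:R].
  rewrite setTI; apply/seteqP; split=> x /=; first by move=> <-; rewrite cell_ofE.
  by move=> /eqP; rewrite eqr_nat -cell_ofE => /eqP h; exact: val_inj.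
exact: mF.
Qed.

Lemma cell_val_min a c : a <= - cut -> cell_val a ord0 <= cell_val a c.
Proof.
move=> ac; rewrite /cell_val eqxx; case: ifP => // _.
by apply: (le_trans ac); rewrite lerDl divr_ge0 ?exprn_ge0.
Qed.

Lemma cell_val_lt a x : x < - cut -> cell_val a (cell_of x) = a.
Proof. by move=> xc; rewrite /cell_val cell_of0 xc. Qed.

Lemma cell_val_ge a x : - cut <= x ->
  [/\ cell_val a (cell_of x) <= x, cell_val a (cell_of x) <= cut &
   x <= cell_val a (cell_of x) + (2 ^+ r)^-1 + (if cut < x then x else 0)].
Proof.
move=> cx; have xc : (x < - cut) = false by rewrite ltNge cx.
rewrite /cell_val cell_of0 xc cell_ofE /cell_nat xc /=.
have p0 : 0 < 2 ^+ r :> R by rewrite exprn_gt0.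
have t0 : 0 <= (x + cut) * 2 ^+ r by rewrite mulr_ge0 ?exprn_ge0 // -lerBlDr sub0r.
have /andP[h1 h2] := truncn_itv t0; set t := Num.truncn _ in h1 h2 *.
have NE : ncell%:R / 2 ^+ r = cut + cut :> R.
  rewrite /ncell natrX /cut -addnn exprD [in X in X / _]exprSr exprS.
  by field; rewrite gt_eqF.
have m1 : (minn t ncell)%:R / 2 ^+ r <= x + cut.
  by rewrite ler_pdivrMr //; apply: le_trans h1; rewrite ler_nat geq_minl.
have m2 : (minn t ncell)%:R / 2 ^+ r <= cut + cut.
  by rewrite -NE ler_wpM2r ?invr_ge0 ?(ltW p0) // ler_nat geq_minr.
split; [lra | lra |].
have i0 : 0 < (2 ^+ r)^-1 :> R by rewrite invr_gt0.
case: (ltP cut x) => xC.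
  have -> : minn t ncell = ncell.
    apply/minn_idPr; rewrite /t truncn_ge_nat //.
    by rewrite -ler_pdivrMr // NE; lra.
  by rewrite NE; have := cut_gt0; lra.
have tN : (t <= ncell)%N.
  rewrite truncn_le_nat -[ltRHS]natr1.
  apply: (@le_lt_trans _ _ ncell%:R); last by rewrite ltrDl.
  by rewrite -ler_pdivlMr // NE; lra.
rewrite (minn_idPl tN) addr0.
have : x + cut <= t.+1%:R / 2 ^+ r by rewrite ler_pdivlMr // ltW.
rewrite -natr1 mulrDl mul1r; lra.
Qed.

End Discretisation.

(** * Comparison of the field with its discretisations *)

Section Comparison.
Context disp (T : measurableType disp) (R : realType) (P : probability T R).
Variables (d : nat) (X : 'rV[int]_d -> {RV P >-> R}).
Hypotheses (d1 : (1 <= d)%N)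
  (Xind : mutually_independent X) (Xid : identically_distributed X).
Variables (V : nat -> T -> \bar R) (W : R).
Hypotheses (mV : forall i, measurable_fun setT (V i))
  (V0 : forall i w, (0 <= V i w)%E)
  (VW : forall N, (\sum_(i < N) \int[P]_w V i w <= W%:E)%E)
  (VX : forall i w n pi, self_avoiding_path 0 n pi -> (0 < n)%N ->
      ((2 ^+ i.+2 * (exceed_count X (2 ^+ i.+1) pi w)%:R)%:E <= n%:R%:E * V i w)%E).
Hypothesis Xneg : (\int[P]_w (Num.max (- X 0 w) 0)%:E < +oo)%E.

Let cl r := @cell_of R r.
Let yv r := @cell_val R r (- cut R r).

Definition path_max n w : R := greedy_path_max (fun v => X v w) n.

Definition trunc_max r n w : R := label_max X (cl r) (@yv r) n 0 w.

Definition trunc_mean r n : R := mean_max X (cl r) (@yv r) n.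

Definition below r (x : R) : R := Num.max (- cut R r - x) 0.

Lemma below_ge0 r x : 0 <= below r x.
Proof. by rewrite /below le_max lexx orbT. Qed.

Lemma below_supp r x : cl r x != ord0 -> below r x = 0.
Proof.
by rewrite /cl cell_of0 -leNgt => h; rewrite /below max_r // subr_le0.
Qed.

Lemma below_le_neg r x : below r x <= Num.max (- x) 0.
Proof.
rewrite /below ge_max !le_max lexx orbT andbT; apply/orP; left.
by have := cut_gt0 R r; lra.
Qed.

Lemma measurable_below r : measurable_fun setT (below r).
Proof. by apply: measurable_maxr => //; exact: measurable_funB. Qed.

Let measurable_neg : measurable_fun setT (fun x : R => Num.max (- x) 0).
Proof. by apply: measurable_maxr => //; exact: measurable_funN. Qed.

Definition below_mean r : R := fine (\int[P]_w (below r (X 0 w))%:E)%E.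

Lemma below_meanE r : (\int[P]_w (below r (X 0 w))%:E = (below_mean r)%:E)%E.
Proof.
rewrite fineK // ge0_fin_numE; last first.
  by apply: integral_ge0 => w _; rewrite lee_fin below_ge0.
apply: le_lt_trans Xneg; apply: ge0_le_integral => //.
- by move=> w _; rewrite lee_fin below_ge0.
- apply/measurable_EFinP; exact: (measurable_site_comp X 0 (measurable_below r)).
- apply/measurable_EFinP; exact: (measurable_site_comp X 0 measurable_neg).
- by move=> w _; rewrite lee_fin below_le_neg.
Qed.

Lemma below_mean_ge0 r : 0 <= below_mean r.
Proof. by rewrite fine_ge0 // integral_ge0 // => w _; rewrite lee_fin below_ge0. Qed.

Lemma cut_cvg (x : R) : \forall r \near \oo, x <= cut R r.
Proof.
exists (Num.bound `|x|) => // r /= xr.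
apply: (@le_trans _ _ (Num.bound `|x|)%:R).
  by apply: (le_trans (ler_norm _)); apply/ltW/archi_boundP.
rewrite /cut -natrX ler_nat; apply: (leq_trans xr).
by rewrite ltnW // (leq_trans (ltn_expl r (isT : 1 < 2)%N)) // leq_exp2l.
Qed.

Lemma below_mean_cvg0 : below_mean r @[r --> \oo] --> 0.
Proof.
have ig : P.-integrable setT (fun w => (Num.max (- X 0 w) 0)%:E).
  apply/integrableP; split.
    by apply/measurable_EFinP; exact: (measurable_site_comp X 0 measurable_neg).
  rewrite (eq_integral (fun w => (Num.max (- X 0 w) 0)%:E)) // => w _.
  by rewrite gee0_abs // lee_fin le_max lexx orbT.
have mf r : measurable_fun setT (fun w => (below r (X 0 w))%:E).
  by apply/measurable_EFinP; exact: (measurable_site_comp X 0 (measurable_below r)).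
have [|||_ _] := @dominated_convergence _ T R P setT measurableT
  (fun r w => (below r (X 0 w))%:E) (fun=> 0%E) _ mf _ _ ig _.
- exact: measurable_cst.
- apply: aeW => w _; apply: cvg_near_cst.
  have := cut_cvg (- X 0 w); apply: filterS => r h.
  by rewrite /below max_r // subr_le0; lra.
- apply: aeW => w r _; rewrite gee0_abs ?lee_fin ?below_ge0 //.
  exact: below_le_neg.
rewrite integral0 => h.
have : (below_mean r)%:E @[r --> \oo] --> 0%E.
  by under eq_cvg do rewrite -below_meanE; exact: h.
by move/fine_cvg.
Qed.

Let tail r w := tail_env V r w.

Lemma trunc_max_lower r n w : (0 < n)%N ->
  trunc_max r n w - opt_sum X (cl r) (@yv r) n (below r) w <= path_max n w.
Proof.
move=> n0; apply: (greedy_path_max_ge_opt_sum X d1 n0 (f := id)) => t.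
have [tc|ct] := ltP t (- cut R r).
  by rewrite /yv /cl cell_val_lt // /below max_l; lra.
have [h _ _] := cell_val_ge (- cut R r) ct.
by have := below_ge0 r t; rewrite -/(cl r t) -/(@yv r _) in h; lra.
Qed.

(** Here the path is the maximiser of the true field, whose dependence on the large values is
    uncontrolled. This is why the envelope has to dominate every path of every length. *)
Lemma trunc_max_upper r n w : (0 < n)%N ->
  ((path_max n w)%:E <= (trunc_max r n w + n%:R / 2 ^+ r)%:E + n%:R%:E * tail r w)%E.
Proof.
move=> n0; have [hp] := opt_pathP d1 (fun v => X v w) n0.
rewrite /path_max => ->; set p := opt_path _ _ in hp *.
have := path_tail_le V0 VX r w hp n0; set s := \sum_(v <- p) _ => hs.
suff h : path_sum (fun v => X v w) p <= trunc_max r n w + n%:R / 2 ^+ r + s.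
  apply: (@le_trans _ _ ((trunc_max r n w + n%:R / 2 ^+ r)%:E + s%:E)%E).
    by rewrite -EFinD lee_fin.
  exact: leeD2l.
have := path_sum_le_max d1 (fun v => @yv r (cl r (X (0 + v) w))) n0 hp.
rewrite -/(label_max X (cl r) (@yv r) n 0 w) -/(trunc_max r n w) => h.
apply: le_trans (lerD (lerD h (lexx _)) (lexx _)).
have /and4P[/eqP <- _ _ _] := hp.
rewrite /s /path_sum; elim: (p) => [|v q IH].
  by rewrite !big_nil mul0r !addr0.
rewrite !big_cons /= -natr1 mulrDl mul1r add0r.
have : X v w <= @yv r (cl r (X v w)) + (2 ^+ r)^-1 + (if 2 ^+ r.+1 < X v w then X v w else 0).
  have [tc|ct] := ltP (X v w) (- cut R r).
    rewrite {1}/yv {1}/cl cell_val_lt //.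
    have : 0 < (2 ^+ r)^-1 :> R by rewrite invr_gt0 exprn_gt0.
    have h0 : 0 <= (if 2 ^+ r.+1 < X v w then X v w else 0).
      by case: ifP => // /ltW; apply: le_trans; rewrite exprn_ge0.
    by rewrite -/(cut R r) in h0 *; lra.
  by have [] := cell_val_ge (- cut R r) ct.
move=> hv; apply: (le_trans (lerD hv IH)).
by rewrite addrACA [X in X + _ <= _]addrACA [2 ^- r + _]addrC.
Qed.

Lemma integral_tail_lty r : (\int[P]_w tail r w <= W%:E)%E.
Proof.
rewrite /tail integral_tail_env //.
have IV i : (0 <= \int[P]_w V i w)%E by apply: integral_ge0.
apply: (@le_trans _ _ (\sum_(i <oo) \int[P]_w V i w)%E).
  rewrite (@nneseries_split _ (fun i => \int[P]_w V i w)%E 0 r) // add0n.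
  by rewrite leeDr // sume_ge0.
apply: lime_le; first by apply: is_cvg_nneseries.
by apply: nearW => n; rewrite big_mkord; exact: VW.
Qed.

Definition tail_mean r : R := fine (\int[P]_w tail r w)%E.

Lemma tail_meanE r : (\int[P]_w tail r w = (tail_mean r)%:E)%E.
Proof.
rewrite fineK // ge0_fin_numE; last first.
  by apply: integral_ge0 => w _; exact: tail_env_ge0.
exact: le_lt_trans (integral_tail_lty r) (ltry _).
Qed.

Lemma tail_mean_cvg0 : tail_mean r @[r --> \oo] --> 0.
Proof.
have h := integral_tail_env_cvg0 mV V0 VW.
have : (tail_mean r)%:E @[r --> \oo] --> 0%E.
  by under eq_cvg do rewrite -tail_meanE; exact: h.
by move/fine_cvg.
Qed.

Definition trunc_err r : R := below_mean r + (2 ^+ r)^-1 + tail_mean r.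

Lemma pow2_inv_cvg0 : (2 ^+ r)^-1 @[r --> \oo] --> (0 : R).
Proof.
have : `|2^-1 : R| < 1 by rewrite ger0_norm ?invr_ge0 // invf_lt1 //; lra.
by move/cvg_expr; under eq_cvg do rewrite exprVn.
Qed.

Lemma trunc_err_cvg0 : trunc_err r @[r --> \oo] --> 0.
Proof.
rewrite -[0]addr0 -[X in _ --> X + _]addr0.
apply: cvgD tail_mean_cvg0; apply: cvgD below_mean_cvg0 pow2_inv_cvg0.
Qed.

Lemma measurable_path_max n : (0 < n)%N -> measurable_fun setT (path_max n).
Proof. by move=> n0; apply: measurable_greedy_path_max. Qed.

Lemma measurable_trunc_max r n : (0 < n)%N -> measurable_fun setT (trunc_max r n).
Proof. by move=> n0; apply: label_max_measurable => //; exact: measurable_cell. Qed.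

Lemma integral_dev_le r n : (0 < n)%N ->
  (\int[P]_w (`|path_max n w - trunc_max r n w|)%:E <= (n%:R * trunc_err r)%:E)%E.
Proof.
move=> n0.
pose D w := opt_sum X (cl r) (@yv r) n (below r) w.
have D0 w : 0 <= D w by apply: sumr_ge0 => i _; exact: below_ge0.
have mD : measurable_fun setT D.
  exact: (measurable_opt_sum X (@measurable_cell R r) _ _ (measurable_below r)).
have mt : measurable_fun setT (tail r) by exact: measurable_tail_env.
have t0 w : (0 <= tail r w)%E by exact: tail_env_ge0.
have r0 : 0 <= n%:R / 2 ^+ r :> R by rewrite divr_ge0 ?exprn_ge0.
apply: (@le_trans _ _ (\int[P]_w (((D w)%:E + (n%:R / 2 ^+ r)%:E) + n%:R%:E * tail r w))%E).
  apply: ge0_le_integral => //.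
  - apply/measurable_EFinP; apply: measurableT_comp => //.
    apply: measurable_funB; [exact: measurable_path_max | exact: measurable_trunc_max].
  - apply: emeasurable_funD; last by apply: emeasurable_funM.
    by apply: emeasurable_funD => //; exact/measurable_EFinP.
  - move=> w _; have lo := @trunc_max_lower r n w n0; have up := @trunc_max_upper r n w n0.
    have := t0 w; have := D0 w; move: up; rewrite -/(D w) in lo.
    case: (tail r w) => [t| |] //.
      rewrite -!EFinM -!EFinD !lee_fin => up Dw tw.
      have : 0 <= n%:R * t by rewrite mulr_ge0.
      by rewrite ler_norml => nt; apply/andP; split; lra.
    by rewrite gt0_muley ?lte_fin ?ltr0n // addey ?leey.
rewrite ge0_integralD //; last 3 first.
- by apply: emeasurable_funD => //; exact/measurable_EFinP.
- by move=> w _; rewrite mule_ge0.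
- exact: emeasurable_funM.
rewrite ge0_integralD //; last exact/measurable_EFinP.
rewrite ge0_integralZl_EFin // integral_prob_cst tail_meanE.
have h : (\int[P]_w (D w)%:E <= (n%:R * below_mean r)%:E)%E.
  apply: (integral_opt_sum_le d1 Xind Xid (@measurable_cell R r) (c0 := ord0) _ n0 (measurable_below r)).
  - by move=> c; exact: cell_val_min.
  - by move=> t; exact: below_supp.
  - exact: below_ge0.
  - by rewrite below_meanE.
have := le_trans (leeD2r _ (leeD2r _ h)); apply.
- by rewrite -!EFinM -!EFinD lee_fin /trunc_err !mulrDr.
- by move=> w _; rewrite lee_fin.
- by move=> w _; rewrite -EFinD lee_fin addr_ge0.
Qed.

Lemma integrable_trunc_max (h : R -> R) r n : (0 < n)%N ->
  P.-integrable setT (fun w => (h (trunc_max r n w))%:E).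
Proof.
move=> n0; exact: (integrable_label_max X d1 (@measurable_cell R r) (@yv r) h 0 n0).
Qed.

Lemma integral_trunc_max r n : (0 < n)%N ->
  (\int[P]_w (trunc_max r n w)%:E = (trunc_mean r n)%:E)%E.
Proof.
move=> n0; exact: (integral_label_max d1 Xind Xid (@measurable_cell R r) (@yv r) id 0 n0).
Qed.

Lemma integrable_dev r n : (0 < n)%N ->
  P.-integrable setT (fun w => (`|path_max n w - trunc_max r n w|)%:E).
Proof.
move=> n0; apply/integrableP; split.
  apply/measurable_EFinP; apply: measurableT_comp => //.
  apply: measurable_funB; [exact: measurable_path_max | exact: measurable_trunc_max].
under eq_integral do rewrite gee0_abs ?lee_fin //.
exact: le_lt_trans (integral_dev_le r n0) (ltry _).
Qed.

(** Both truncated maxima are compared with the same untruncated one. *)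
Lemma trunc_mean_le r s n : (0 < n)%N ->
  trunc_mean r n <= trunc_mean s n + n%:R * (trunc_err r + trunc_err s).
Proof.
move=> n0.
have is_ := integrable_trunc_max id s n0.
have dr := integrable_dev r n0; have ds := integrable_dev s n0.
have : (\int[P]_w (trunc_max r n w)%:E <= \int[P]_w ((trunc_max s n w)%:E +
   ((`|path_max n w - trunc_max r n w|)%:E + (`|path_max n w - trunc_max s n w|)%:E)))%E.
  apply: le_integral => //.
  - exact: (integrable_trunc_max id).
  - by apply: integrableD => //; exact: integrableD.
  move=> w _; rewrite -!EFinD lee_fin.
  have := ler_norm (path_max n w - trunc_max s n w).
  have := ler_norm (- (path_max n w - trunc_max r n w)); rewrite normrN; lra.
rewrite (integralD measurableT is_ (integrableD measurableT dr ds)).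
rewrite (integralD measurableT dr ds) !integral_trunc_max // => h.
rewrite -lee_fin mulrDr !EFinD; apply: (le_trans h); apply: leeD2l.
by apply: leeD; exact: integral_dev_le.
Qed.

Lemma trunc_rate_exists r : exists L : R, trunc_mean r n / n%:R @[n --> \oo] --> L.
Proof.
apply: (@label_mean_cvg _ _ _ _ _ X d1 Xind Xid _ _ (@measurable_cell R r) (@yv r) ord0).
by move=> c; exact: cell_val_min.
Qed.

(** For all r and s one has L r - err r <= L s + err s. Hence the infimum of the numbers L s + err s
    lies within err r of every L r. *)
Lemma rate_exists : exists (M : R) (L : nat -> R),
  (forall r, trunc_mean r n / n%:R @[n --> \oo] --> L r) /\
  (forall r, `|L r - M| <= trunc_err r).
Proof.
have /choice[L HL] := trunc_rate_exists.
have key r s : L r <= L s + (trunc_err r + trunc_err s).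
  apply: (ler_cvg_to (HL r) (cvgD (HL s) (cvg_cst (trunc_err r + trunc_err s)))).
  exists 1%N => // n /= n0; have nR : 0 < n%:R :> R by rewrite ltr0n.
  rewrite ler_pdivrMr // mulrDl divfK ?gt_eqF // [_ * n%:R]mulrC.
  exact: trunc_mean_le.
pose f r := L r + trunc_err r.
have lb r : lbound (range f) (L r - trunc_err r).
  by move=> _ [s _ <-]; rewrite /f; have := key r s; lra.
exists (inf (range f)), L; split => // r.
rewrite ler_distl; apply/andP; split.
  by rewrite lerBlDr; apply: ge_inf; [exists (L r - trunc_err r); exact: lb | exists r].
by rewrite -lerBlDr; apply: lb_le_inf; [exists (f r), r | exact: lb].
Qed.

Variables (M : R) (L : nat -> R).
Hypotheses (HL : forall r, trunc_mean r n / n%:R @[n --> \oo] --> L r)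
  (HM : forall r, `|L r - M| <= trunc_err r).

Lemma integrable_path_max n : (0 < n)%N ->
  P.-integrable setT (EFin \o path_max n).
Proof.
move=> n0.
apply: (le_integrable measurableT _ _ (integrableD measurableT
  (integrable_dev 0 n0) (integrable_trunc_max (fun t => `|t|) 0 n0))).
  by apply/measurable_EFinP; exact: measurable_path_max.
move=> w _ /=; rewrite lee_fin [leRHS]ger0_norm ?addr_ge0 //.
have := ler_normD (path_max n w - trunc_max 0 n w) (trunc_max 0 n w).
by rewrite subrK.
Qed.

Lemma path_max_L1 (e : R) : 0 < e -> \forall n \near \oo,
  (\int[P]_w (`|path_max n w / n%:R - M|)%:E <= e%:E)%E.
Proof.
move=> e0; have e5 : 0 < e / 5 by lra.
have [r er] : exists r, trunc_err r <= e / 5.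
  by have [r _ hr] := cvgr_le _ trunc_err_cvg0 _ e5; exists r; exact: (hr r (leqnn r)).
have [B HB] := label_max_L2 d1 Xind Xid (@measurable_cell R r)
  (fun c => cell_val_min c (lexx (- cut R r))).
have c1 : \forall n \near \oo, `|L r - trunc_mean r n / n%:R| <= e / 5.
  by move/cvgrPdist_le : (@HL r); apply.
have c2 : \forall n \near \oo, `|B| / (e / 5) / n%:R <= e / 5.
  have h : `|B| / (e / 5) / n%:R @[n --> \oo] --> (0 : R).
    rewrite -[X in _ --> X](mulr0 (`|B| / (e / 5))); apply: cvgM; first exact: cvg_cst.
    apply/gtr0_cvgV0; last exact: cvgr_idn.
    by near=> n; rewrite ltr0n; near: n; exists 1%N.
  exact: (cvgr_le _ h _ e5).
near=> n.
have n0 : (0 < n)%N by near: n; exists 1%N.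
have nR : 0 < n%:R :> R by rewrite ltr0n.
have h1 : `|L r - trunc_mean r n / n%:R| <= e / 5 by near: n.
have h2 : `|B| / (e / 5) / n%:R <= e / 5 by near: n.
pose q w : R := (trunc_max r n w - trunc_mean r n) ^+ 2.
(* With z the normalised fluctuation in absolute value, [a * q w] is z^2 / (e/5), and z <= z^2 /
   (e/5) + e/5 turns the variance bound into a bound on the mean of z. The five parts are the
   truncation, the variance, and three constants. *)
pose a : R := ((e / 5) * n%:R ^+ 2)^-1.
have a0 : 0 < a by rewrite invr_gt0 mulr_gt0 // exprn_gt0.
have pt w : `|path_max n w / n%:R - M| <=
    n%:R^-1 * `|path_max n w - trunc_max r n w| + (a * q w + (e / 5 + e / 5 + e / 5)).
  have E : path_max n w / n%:R - M = (path_max n w - trunc_max r n w) / n%:R +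
     ((trunc_max r n w - trunc_mean r n) / n%:R + ((trunc_mean r n / n%:R - L r) + (L r - M))).
    by field; rewrite gt_eqF.
  rewrite E; apply: (le_trans (ler_normD _ _)); apply: lerD.
    by rewrite normrM mulrC (ger0_norm (ltW _)) ?invr_gt0.
  apply: (le_trans (ler_normD _ _)).
  apply: (@le_trans _ _ ((a * q w + e / 5) + (e / 5 + e / 5))); last by lra.
  apply: lerD; last first.
    apply: (le_trans (ler_normD _ _)); apply: lerD; first by rewrite distrC.
    exact: le_trans (HM r) er.
  set t := trunc_max r n w - trunc_mean r n; set z := `|t / n%:R|.
  have zE : a * q w = z ^+ 2 / (e / 5).
    rewrite /z real_normK ?num_real // /a /q -/t; field.
    by rewrite !gt_eqF.
  rewrite zE -(ler_pM2r e5) mulrDl divfK ?gt_eqF //.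
  have z0 : 0 <= z by exact: normr_ge0.
  have ze : 0 <= z * (e / 5) by rewrite mulr_ge0 // ltW.
  by have := sqr_ge0 (z - e / 5); rewrite sqrrB -[e / 5 * (e / 5)]expr2; lra.
have mq : measurable_fun setT (fun w => (q w)%:E).
  apply/measurable_EFinP; apply: measurable_funX; apply: measurable_funB => //.
  exact: measurable_trunc_max.
have mdev := measurable_int _ (integrable_dev r n0).
have q0 w : 0 <= q w by exact: sqr_ge0.
apply: (@le_trans _ _ (\int[P]_w ((n%:R^-1)%:E * (`|path_max n w - trunc_max r n w|)%:E +
   (a%:E * (q w)%:E + (e / 5 + (e / 5 + e / 5))%:E)))%E).
  apply: ge0_le_integral => //.
  - apply/measurable_EFinP; apply: measurableT_comp => //.
    apply: measurable_funB => //; apply: measurable_funM => //.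
    exact: measurable_path_max.
  - apply: emeasurable_funD; first exact: emeasurable_funM.
    by apply: emeasurable_funD => //; exact: emeasurable_funM.
  - by move=> w _; rewrite -!EFinM -!EFinD lee_fin !addrA; have := pt w; rewrite !addrA.
have e30 : 0 <= e / 5 + (e / 5 + e / 5) by lra.
rewrite ge0_integralD //; last 3 first.
- exact: emeasurable_funM.
- by move=> w _; rewrite -EFinM -EFinD lee_fin addr_ge0 // mulr_ge0 // ltW.
- by apply: emeasurable_funD => //; exact: emeasurable_funM.
rewrite ge0_integralD //; last 2 first.
- by move=> w _; rewrite -EFinM lee_fin mulr_ge0 // ltW.
- exact: emeasurable_funM.
rewrite ge0_integralZl_EFin ?invr_ge0 // ge0_integralZl_EFin ?(ltW a0) //; last first.
  by move=> w _; rewrite lee_fin.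
rewrite integral_prob_cst.
have b1 : ((n%:R^-1)%:E * \int[P]_w (`|path_max n w - trunc_max r n w|)%:E <= (e / 5)%:E)%E.
  apply: (le_trans (lee_wpmul2l _ (integral_dev_le r n0))); first by rewrite lee_fin invr_ge0.
  by rewrite -EFinM lee_fin mulKf ?gt_eqF.
have b2 : (a%:E * \int[P]_w (q w)%:E <= (e / 5)%:E)%E.
  apply: (le_trans (lee_wpmul2l _ (HB n n0))); first by rewrite lee_fin ltW.
  rewrite -EFinM lee_fin; apply: le_trans h2.
  have -> : a * (B * n%:R) = B / (e / 5) / n%:R by rewrite /a; field; rewrite !gt_eqF.
  by rewrite !ler_wpM2r ?invr_ge0 ?(ltW e5) ?ler_norm // ltW.
apply: (le_trans (leeD b1 (leeD b2 (lexx _)))).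
by rewrite -!EFinD lee_fin; lra.
Unshelve. all: by end_near.
Qed.

Lemma cell_val_le_cut r t : @yv r (cl r t) <= cut R r.
Proof.
have c0 := cut_gt0 R r; have [tc|ct] := ltP t (- cut R r).
  by rewrite /yv /cl cell_val_lt //; lra.
by have [] := cell_val_ge (- cut R r) ct.
Qed.

(** The level r is chosen after the sample point, as the envelope tends to 0 only pointwise; the
    exceptional sets of all levels are therefore united first. Interpolation between squares applies
    to the truncated maximum, whose values are at most [cut]. *)
Lemma ae_path_max_le : {ae P, forall w, forall e, 0 < e ->
  \forall n \near \oo, path_max n w / n%:R <= M + e}.
Proof.
have H r : {ae P, forall w, trunc_max r (k.+1 ^ 2) w / (k.+1 ^ 2)%:R @[k --> \oo] --> L r}.
  apply: (ae_label_max_square d1 Xind Xid (@measurable_cell R r) (c0 := ord0)); last exact: HL.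
  by move=> c; exact: cell_val_min.
move/ae_foralln : H; apply: filterS2 (ae_tail_env_cvg0 mV V0 VW) => w ct cs e e0.
have e4 : 0 < e / 4 by lra.
have [r [h1 h2 h3]] : exists r, [/\ trunc_err r <= e / 4, (2 ^+ r)^-1 <= e / 4 &
    (tail r w <= (e / 4)%:E)%E].
  have c1 : \forall r \near \oo, trunc_err r <= e / 4 by exact: (cvgr_le _ trunc_err_cvg0 _ e4).
  have c2 : \forall r \near \oo, (2 ^+ r)^-1 <= e / 4 by exact: (cvgr_le _ pow2_inv_cvg0 _ e4).
  have c3 : \forall r \near \oo, (tail r w <= (e / 4)%:E)%E.
    have /fine_cvgP[fn cv] := ct; apply: filterS2 fn (cvgr_le _ cv _ e4) => r fr.
    by rewrite -lee_fin fineK.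
  have [r _ hr] := filterI c1 (filterI c2 c3).
  by have [? [? ?]] := hr r (leqnn r); exists r.
have : \forall n \near \oo, trunc_max r n w / n%:R <= L r + e / 4.
  apply: (square_interpolation_le (K := cut R r) (ltW (cut_gt0 R r))) => //.
    move=> n m n0; apply: greedy_path_max_extend => // v; exact: cell_val_le_cut.
  move=> e' e'0; apply: (cvgr_le _ (@cs r)); rewrite ltrDl //.
apply: filterS2 (nbhs_infty_gt 0) => n n0 hn.
have nR : 0 < n%:R :> R by rewrite ltr0n.
have := trunc_max_upper r w n0; have := @tail_env_ge0 _ _ _ V V0 r w.
rewrite -/(tail r w); case: (tail r w) h3 => [t| |] //; rewrite lee_fin => h3 t0.
rewrite -EFinM -EFinD lee_fin => up.
rewrite ler_pdivrMr //; apply: (le_trans up).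
have := HM r; rewrite ler_distl => /andP[_ hL].
rewrite ler_pdivrMr // in hn.
have : n%:R * t <= n%:R * (e / 4) by rewrite ler_wpM2l.
have : n%:R / 2 ^+ r <= n%:R * (e / 4) by rewrite ler_wpM2l.
have : (L r + e / 4) * n%:R <= (M + e / 4 + e / 4) * n%:R by rewrite ler_wpM2r //; lra.
lra.
Qed.

Section LowerBound.
Variable s : R.
Hypothesis Xneg2 : (\int[P]_w (Num.max (- X 0 w) 0 ^+ 2)%:E <= s%:E)%E.

Let low r (t : R) : R := (t < - cut R r)%R%:R.

Let measurable_low r : measurable_fun setT (low r).
Proof.
rewrite (_ : low r = \1_(`]-oo, - cut R r[%classic)); last first.
  by apply/funext => t; rewrite indicE /low mem_setE in_itv.
by apply: measurable_indic; exact: measurable_itv.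
Qed.

Let low_ge0 r t : 0 <= low r t. Proof. exact: ler0n. Qed.

Let low_prob r : R := fine (\int[P]_w (low r (X 0 w))%:E)%E.

Let low_probE r : (\int[P]_w (low r (X 0 w))%:E = (low_prob r)%:E)%E.
Proof.
rewrite fineK // ge0_fin_numE; last by apply: integral_ge0 => w _; rewrite lee_fin.
apply: (@le_lt_trans _ _ (\int[P]_w 1%:E)%E); last by rewrite integral_prob_cst ltry.
apply: ge0_le_integral => //.
- by move=> w _; rewrite lee_fin.
- apply/measurable_EFinP; exact: (measurable_site_comp X 0 (measurable_low r)).
- by move=> w _; rewrite lee_fin lern1 leq_b1.
Qed.

Let gap r : R := below_mean r / low_prob r.

Let low_prob_ge0 r : 0 <= low_prob r.
Proof. by rewrite fine_ge0 // integral_ge0 // => w _; rewrite lee_fin. Qed.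

Let gap_ge0 r : 0 <= gap r.
Proof. by rewrite divr_ge0 // below_mean_ge0. Qed.

(** If the lowest cell has probability 0, division by 0 makes [gap] equal to 0, and the identity
    survives because [below] then vanishes almost surely. *)
Let gapK r : gap r * low_prob r = below_mean r.
Proof.
have [p0|] := eqVneq (low_prob r) 0; last by move=> h; rewrite /gap divfK.
rewrite p0 mulr0; apply/esym; have := low_probE r; rewrite p0 => h.
have ml : measurable_fun setT (fun w => (low r (X 0 w))%:E).
  apply/measurable_EFinP; exact: (measurable_site_comp X 0 (measurable_low r)).
have h0 : ae_eq P setT (fun w => (low r (X 0 w))%:E) (cst 0%E).
  apply/(ae_eq_integral_abs P measurableT ml); rewrite -[RHS]h; apply: eq_integral => w _.
  by rewrite gee0_abs // lee_fin.
apply: EFin_inj; rewrite -below_meanE.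
transitivity (\int[P]_w cst 0%E w)%E; last by rewrite integral0.
apply: ae_eq_integral => //.
  apply/measurable_EFinP; exact: (measurable_site_comp X 0 (measurable_below r)).
apply: filterS h0 => w /(_ Logic.I) [] /eqP; rewrite /low pnatr_eq0 eqb0 -leNgt => c _.
by rewrite below_supp // cell_of0 -leNgt.
Qed.

Let gap_low_mean r : (\int[P]_w (gap r * low r (X 0 w))%:E = (below_mean r)%:E)%E.
Proof.
under eq_integral do rewrite EFinM.
rewrite ge0_integralZl_EFin //; first by rewrite low_probE -EFinM gapK.
  by move=> w _; rewrite lee_fin.
apply/measurable_EFinP; exact: (measurable_site_comp X 0 (measurable_low r)).
Qed.

Let yl r := @cell_val R r (- cut R r - gap r).

Let yl_min r c : @yl r ord0 <= @yl r c.
Proof. by apply: cell_val_min; rewrite lerBlDr lerDl. Qed.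

(* The value [- cut - gap] is the conditional mean of [X 0] on the lowest cell,
   so that [excess r (X 0)] is centred. *)
Let excess r t := below r t - gap r * low r t.

Let excess_supp r t : cl r t != ord0 -> excess r t = 0.
Proof.
move=> h; rewrite /excess below_supp // /low -cell_of0.
by move/negbTE : h; rewrite /cl => ->; rewrite mulr0 subrr.
Qed.

Let measurable_excess r : measurable_fun setT (excess r).
Proof. by apply: measurable_funB; [exact: measurable_below | exact: measurable_funM]. Qed.

(** Centring is expressed as equality of the means of the positive and negative parts, which keeps
    all integrands nonnegative. It follows by comparing [ep + gap * low] with [below + en], which
    agree pointwise. *)
Let excess_mean r : exists e : R,
  (\int[P]_w (Num.max (excess r (X 0 w)) 0)%:E = e%:E)%E /\
  (\int[P]_w (Num.max (- excess r (X 0 w)) 0)%:E = e%:E)%E.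
Proof.
pose ep t := Num.max (excess r t) 0; pose en t := Num.max (- excess r t) 0.
have mp : measurable_fun setT (fun w => (ep (X 0 w))%:E).
  by apply/measurable_EFinP; apply: (measurable_site_comp X 0); exact: measurable_maxr.
have mn : measurable_fun setT (fun w => (en (X 0 w))%:E).
  apply/measurable_EFinP; apply: (measurable_site_comp X 0); apply: measurable_maxr => //.
  exact: measurableT_comp.
have mb : measurable_fun setT (fun w => (below r (X 0 w))%:E).
  apply/measurable_EFinP; exact: (measurable_site_comp X 0 (measurable_below r)).
have ml : measurable_fun setT (fun w => (gap r * low r (X 0 w))%:E).
  have mg : measurable_fun setT (fun t => gap r * low r t) by exact: measurable_funM.
  by apply/measurable_EFinP; exact: (measurable_site_comp X 0 mg).
have p0 t : 0 <= ep t by rewrite /ep le_max lexx orbT.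
have n0 t : 0 <= en t by rewrite /en le_max lexx orbT.
have g0 t : 0 <= gap r * low r t by exact: mulr_ge0.
have fp : (\int[P]_w (ep (X 0 w))%:E)%E \is a fin_num.
  rewrite ge0_fin_numE ?integral_ge0 // => [|w _]; last by rewrite lee_fin.
  apply: (@le_lt_trans _ _ (\int[P]_w (below r (X 0 w))%:E)%E); last by rewrite below_meanE ltry.
  apply: ge0_le_integral => // w _; rewrite lee_fin //.
  by rewrite /ep /excess ge_max below_ge0 andbT gerBl.
have fn : (\int[P]_w (en (X 0 w))%:E)%E \is a fin_num.
  rewrite ge0_fin_numE ?integral_ge0 // => [|w _]; last by rewrite lee_fin.
  apply: (@le_lt_trans _ _ (\int[P]_w (gap r * low r (X 0 w))%:E)%E); last by rewrite gap_low_mean ltry.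
  apply: ge0_le_integral => // w _; rewrite lee_fin //.
  by rewrite /en /excess ge_max g0 andbT opprB gerBl below_ge0.
have : (\int[P]_w (ep (X 0 w))%:E + (below_mean r)%:E =
        (below_mean r)%:E + \int[P]_w (en (X 0 w))%:E)%E.
  rewrite -[in LHS]gap_low_mean -below_meanE -!ge0_integralD //; last 4 first.
  - by move=> w _; rewrite lee_fin below_ge0.
  - by move=> w _; rewrite lee_fin.
  - by move=> w _; rewrite lee_fin.
  - by move=> w _; rewrite lee_fin.
  apply: eq_integral => w _; rewrite -!EFinD; congr (_%:E).
  rewrite /ep /en /excess.
  set a := below _ _; set b := gap r * _.
  by case: (leP (a - b) 0); case: (leP (- (a - b)) 0); lra.
rewrite -(fineK fp) -(fineK fn) -!EFinD => -[] h.
exists (fine (\int[P]_w (ep (X 0 w))%:E)); split; first by rewrite fineK.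
by rewrite -(fineK fn); congr (_%:E); lra.
Qed.

Let excess_sqr r :
  (\int[P]_w (excess r (X 0 w) ^+ 2)%:E <= (2 * s + 2 * gap r ^+ 2)%:E)%E.
Proof.
have mneg2 : measurable_fun setT (fun w => (Num.max (- X 0 w) 0 ^+ 2)%:E).
  apply/measurable_EFinP; apply: measurable_funX.
  exact: (measurable_site_comp X 0 measurable_neg).
apply: (@le_trans _ _ (\int[P]_w (2%:E * (Num.max (- X 0 w) 0 ^+ 2)%:E + (2 * gap r ^+ 2)%:E))%E).
  apply: ge0_le_integral => //.
  - by move=> w _; rewrite lee_fin sqr_ge0.
  - apply/measurable_EFinP; apply: measurable_funX.
    exact: (measurable_site_comp X 0 (measurable_excess r)).
  - by apply: emeasurable_funD => //; exact: emeasurable_funM.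
  move=> w _; rewrite -EFinM -EFinD lee_fin /excess.
  have := below_le_neg r (X 0 w); have := below_ge0 r (X 0 w).
  have : low r (X 0 w) <= 1 by rewrite lern1 leq_b1.
  have := low_ge0 r (X 0 w); have := gap_ge0 r.
  set a := below _ _; set b := low _ _; set c := Num.max _ _; set g := gap r.
  move=> g0 b0 b1 a0 ac.
  have h1 : a ^+ 2 <= c ^+ 2 by rewrite ler_sqr ?nnegrE // (le_trans a0).
  have h2 : (g * b) ^+ 2 <= g ^+ 2.
    have gb : g * b <= g by rewrite ler_piMr.
    by rewrite ler_sqr // nnegrE mulr_ge0.
  have h3 := mulr_ge0 a0 (mulr_ge0 g0 b0).
  by rewrite sqrrB; have := sqr_ge0 c; have := sqr_ge0 g; lra.
rewrite ge0_integralD //; last 3 first.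
- by move=> w _; rewrite -EFinM lee_fin mulr_ge0 // sqr_ge0.
- exact: emeasurable_funM.
- by move=> w _; rewrite lee_fin mulr_ge0 // sqr_ge0.
rewrite ge0_integralZl_EFin //; last by move=> w _; rewrite lee_fin sqr_ge0.
rewrite integral_prob_cst [leRHS]EFinD; apply: leeD => //.
by rewrite EFinM; exact: lee_wpmul2l.
Qed.

Lemma ae_path_max_ge : {ae P, forall w, forall e, 0 < e ->
  \forall n \near \oo, M - e <= path_max n w / n%:R}.
Proof.
have /choice[l Hl] r : exists l : R, mean_max X (cl r) (@yl r) n / n%:R @[n --> \oo] --> l.
  exact: (label_mean_cvg d1 Xind Xid (@measurable_cell R r) (@yl_min r)).
pose D r n w := opt_sum X (cl r) (@yl r) n (excess r) w.
have HD r : {ae P, forall w, D r (k.+1 ^ 2)%N w / (k.+1 ^ 2)%:R @[k --> \oo] --> 0}.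
  apply: (@ae_square_cvg0 _ _ _ P (D r) (2 * s + 2 * gap r ^+ 2)) => n n0.
    exact: (measurable_opt_sum X (@measurable_cell R r) (@yl r) n (@measurable_excess r)).
  have [e [ep en]] := excess_mean r; rewrite mulrC.
  exact: (integral_opt_sum_sqr_le d1 Xind Xid (@measurable_cell R r) (@yl_min r) n0
    (@measurable_excess r) (@excess_supp r) ep en (excess_sqr r)).
have Hs r : {ae P, forall w,
    label_max X (cl r) (@yl r) (k.+1 ^ 2) 0 w / (k.+1 ^ 2)%:R @[k --> \oo] --> l r}.
  exact: (ae_label_max_square d1 Xind Xid (@measurable_cell R r) (@yl_min r) (@Hl r)).
(* Lowering the lowest label by [gap] costs at most [gap] for each lowest-label site on the [yv]
   maximiser. Negative association bounds the mean cost by n times [gap * low_prob], that is, n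
   times [below_mean]. *)
have key r : L r <= l r + below_mean r.
  apply: (ler_cvg_to (@HL r) (cvgD (@Hl r) (cvg_cst (below_mean r)))).
  exists 1%N => // n /= n0; have nR : 0 < n%:R :> R by rewrite ltr0n.
  rewrite ler_pdivrMr // mulrDl divfK ?gt_eqF // [_ * n%:R]mulrC.
  pose D' w := opt_sum X (cl r) (@yv r) n (fun t => gap r * low r t) w.
  have mD' : measurable_fun setT D'.
    apply: (measurable_opt_sum X (@measurable_cell R r) (@yv r) n).
    exact: measurable_funM.
  have D'0 w : 0 <= D' w by apply: sumr_ge0 => i _; exact: mulr_ge0.
  have ID' : (\int[P]_w (D' w)%:E <= (n%:R * below_mean r)%:E)%E.
    apply: (integral_opt_sum_le d1 Xind Xid (@measurable_cell R r) (c0 := ord0) _ n0).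
    - by move=> c; exact: cell_val_min.
    - exact: measurable_funM.
    - by move=> t; rewrite /low -cell_of0 => /negbTE; rewrite /cl => ->; rewrite mulr0.
    - by move=> t; exact: mulr_ge0.
    - by rewrite gap_low_mean.
  have iD' : P.-integrable setT (fun w => (D' w)%:E).
    apply/integrableP; split; first exact/measurable_EFinP.
    under eq_integral do rewrite gee0_abs ?lee_fin //.
    exact: le_lt_trans ID' (ltry _).
  have il := integrable_label_max X d1 (@measurable_cell R r) (@yl r) id 0 n0.
  have : (\int[P]_w (trunc_max r n w)%:E <=
      \int[P]_w ((label_max X (cl r) (@yl r) n 0 w)%:E + (D' w)%:E))%E.
    apply: le_integral => //.
    - exact: (integrable_trunc_max id).
    - exact: integrableD.
    move=> w _; rewrite -EFinD lee_fin -lerBlDr.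
    have := greedy_path_max_ge_opt_sum X d1 n0 (cl := cl r) (y := @yv r)
      (f := fun t => yl (cl r t)) (h := fun t => gap r * low r t) w.
    rewrite -/(trunc_max r n w) -/(D' w) => h; apply: (le_trans (h _)) => [t|].
      rewrite /yv /yl /low /cell_val /cl cell_of0.
      by case: ifP => _; rewrite ?mulr1 ?mulr0 ?subr0.
    by apply: greedy_path_max_le => // v _; rewrite add0r.
  rewrite (integralD measurableT il iD') integral_trunc_max //.
  rewrite (integral_label_max d1 Xind Xid (@measurable_cell R r) (@yl r) id 0 n0) => h.
  by rewrite -lee_fin EFinD; apply: (le_trans h); exact: leeD2l.
apply: filterS2 (ae_foralln HD) (ae_foralln Hs) => w cD cs e e0.
have e4 : 0 < e / 4 by lra.
have [r [h1 h2]] : exists r, trunc_err r <= e / 4 /\ below_mean r <= e / 4.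
  have c1 : \forall r \near \oo, trunc_err r <= e / 4 by exact: (cvgr_le _ trunc_err_cvg0 _ e4).
  have c2 : \forall r \near \oo, below_mean r <= e / 4 by exact: (cvgr_le _ below_mean_cvg0 _ e4).
  have [r _ hr] := filterI c1 c2.
  by have [? ?] := hr r (leqnn r); exists r.
(* Interpolation between squares needs a field bounded above, and the centred error is controlled at
   squares only. The field is therefore capped at [cut], which can only lower the maximum. *)
pose u n := greedy_path_max (fun v => Num.min (X v w) (cut R r)) n.
have : \forall n \near \oo, l r - e / 4 <= u n / n%:R.
  apply: (square_interpolation_ge (K := cut R r) (ltW (cut_gt0 R r))) => //.
    by move=> n m n0; apply: greedy_path_max_extend => // v; rewrite ge_min lexx orbT.
  move=> e' e'0.
  have cc : label_max X (cl r) (@yl r) (k.+1 ^ 2) 0 w / (k.+1 ^ 2)%:R -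
      D r (k.+1 ^ 2)%N w / (k.+1 ^ 2)%:R @[k --> \oo] --> l r.
    by rewrite -[l r]subr0; apply: cvgB; [exact: cs | exact: cD].
  have : \forall k \near \oo, l r - e' <= label_max X (cl r) (@yl r) (k.+1 ^ 2) 0 w / (k.+1 ^ 2)%:R -
      D r (k.+1 ^ 2)%N w / (k.+1 ^ 2)%:R.
    have le' : l r - e' < l r by rewrite gtrBl.
    exact: (cvgr_ge _ cc _ le').
  apply: filterS => k; have k0 : (0 < k.+1 ^ 2)%N by rewrite expn_gt0.
  move=> hk; apply: (le_trans hk); rewrite -mulrBl ler_wpM2r ?invr_ge0 //.
  apply: (greedy_path_max_ge_opt_sum X d1 k0 (f := fun t => Num.min t (cut R r))) => t.
  have [tc|ct] := ltP t (- cut R r).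
    rewrite /yl /cl cell_val_lt // /excess /below /low tc mulr1.
    rewrite max_l; last by lra.
    have c0 := cut_gt0 R r.
    have : t <= Num.min t (cut R r) by rewrite le_min lexx /=; lra.
    lra.
  rewrite excess_supp ?cell_of0 -?leNgt // subr0 le_min.
  by have [-> -> _] := cell_val_ge (- cut R r - gap r) ct.
apply: filterS2 (nbhs_infty_gt 0) => n n0 hn.
have nR : 0 < n%:R :> R by rewrite ltr0n.
have : u n / n%:R <= path_max n w / n%:R.
  rewrite ler_wpM2r ?invr_ge0 //; apply: greedy_path_max_le => // v _.
  by rewrite ge_min lexx.
have := key r; have := HM r; rewrite ler_distl => /andP[hL _].
lra.
Qed.

End LowerBound.

End Comparison.

Theorem theorem1p1 (R : realType) (disp : measure_display)
    (T : measurableType disp) (P : probability T R)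
    (d : nat) (hd : (1 <= d)%N)
    (X : 'rV[int]_d -> {RV P >-> R})
    (Xind : mutually_independent X)
    (Xid : identically_distributed X)
    (Xpos : exists2 alpha : R, 0 < alpha &
      ('E_P[fun w => ((X 0)^\+ w ^+ d *
                      log_plus ((X 0)^\+ w) `^ (d%:R + alpha))%R] < +oo)%E)
    (Xneg : ('E_P[fun w => ((X 0)^\- w)%R] < +oo)%E) :
  exists M : R,
    cvg_L1 P (fun n w => greedy_path_max (fun v => X v w) n / n%:R) (cst M) /\
    (('E_P[fun w => ((X 0)^\- w ^+ 4)%R] < +oo)%E ->
     {ae P, forall w,
       greedy_path_max (fun v => X v w) n / n%:R @[n --> \oo] --> M}).
Proof.
case: Xpos => alpha alpha0 Xlog.
have lm0 t : 0 <= log_moment d alpha t.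
  by rewrite mulr_ge0 ?powR_ge0 // exprn_ge0 // le_max lexx orbT.
have [Q HQ] : exists Q : R, (\int[P]_w (log_moment d alpha (X 0 w))%:E <= Q%:E)%E.
  exists (fine (\int[P]_w (log_moment d alpha (X 0 w))%:E)); rewrite fineK //.
  rewrite ge0_fin_numE; last by apply: integral_ge0 => w _; rewrite lee_fin.
  by move: Xlog; rewrite unlock.
have [V [W [mV V0 VW VX]]] := layer_envelopes hd Xind Xid alpha0 HQ.
have Xn : (\int[P]_w (Num.max (- X 0 w) 0)%:E < +oo)%E by move: Xneg; rewrite unlock.
have [M [L [HL HM]]] := rate_exists hd Xind Xid mV V0 VW VX Xn.
exists M; split; first split.
- case=> [|n].
    (* At n = 0 the quotient is 0 because the inverse of 0 is 0. *)
    rewrite (_ : _ \o _ = cst 0%E); first exact: integrable0.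
    by apply/funext => w; rewrite /= invr0 mulr0.
  have := integrableZr measurableT (n.+1%:R^-1) (integrable_path_max hd Xind Xid mV V0 VW VX Xn (ltn0Sn n)).
  by apply: eq_integrable.
- exact: (finite_measure_integrable_cst P M).
- rewrite unlock; apply/fine_cvgP.
  have c := path_max_L1 hd Xind Xid mV V0 VW VX Xn HL HM.
  have I0 n : (0 <= \int[P]_w (`|path_max X n w / n%:R - M|)%:E)%E.
    by apply: integral_ge0 => w _; rewrite lee_fin.
  have fn : \forall n \near \oo, (\int[P]_w (`|path_max X n w / n%:R - M|)%:E)%E \is a fin_num.
    have := c 1 ltr01; apply: filterS => n h.
    by rewrite ge0_fin_numE //; exact: le_lt_trans h (ltry _).
  split=> //; apply/cvgr0Pnorm_le => e e0.
  apply: filterS2 fn (c e e0) => n fn h.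
  have h' : fine (\int[P]_w (`|path_max X n w / n%:R - M|)%:E) <= e.
    by rewrite -lee_fin fineK.
  by rewrite /= ger0_norm // fine_ge0 // I0.
move=> X4.
pose neg w := Num.max (- X 0 w) 0.
have mneg : measurable_fun setT neg.
  by apply: measurable_maxr => //; exact: measurable_funN.
have [s Hs] : exists s : R, (\int[P]_w (neg w ^+ 2)%:E <= s%:E)%E.
  have fin : (\int[P]_w (neg w ^+ 4)%:E < +oo)%E by move: X4; rewrite unlock.
  have ff : (\int[P]_w (neg w ^+ 4)%:E)%E \is a fin_num.
    rewrite ge0_fin_numE // integral_ge0 // => w _.
    by rewrite lee_fin exprn_even_ge0.
  (* The second moment is finite by t^2 <= 1 + t^4. *)
  exists (1 + fine (\int[P]_w (neg w ^+ 4)%:E)%E); rewrite EFinD fineK //.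
  rewrite -(integral_prob_cst P 1) -ge0_integralD //; last 2 first.
  - by move=> w _; rewrite lee_fin exprn_even_ge0.
  - by apply/measurable_EFinP; exact: measurable_funX.
  apply: ge0_le_integral => //.
  - by move=> w _; rewrite lee_fin sqr_ge0.
  - by apply/measurable_EFinP; exact: measurable_funX.
  - by apply: emeasurable_funD => //; apply/measurable_EFinP; exact: measurable_funX.
  move=> w _; rewrite -EFinD lee_fin (exprM _ 2 2).
  by have := sqr_ge0 (neg w ^+ 2 - 1); have := sqr_ge0 (neg w); rewrite sqrrB1; lra.
apply: filterS2 (ae_path_max_le hd Xind Xid mV V0 VW VX Xn HL HM)
  (ae_path_max_ge hd Xind Xid mV V0 VW Xn HL HM Hs) => w up lo.
apply/cvgrPdist_le => e e0.
apply: filterS2 (up e e0) (lo e e0) => n h1 h2.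
by rewrite ler_distl; apply/andP; split; rewrite /path_max in h1 h2 *; lra.
Qed.
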